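(* The generalized Solitaire Chess problem is NP-complete. That is: given an integer $N \ge 1$ and a placement of finitely many chess pieces (each a king, queen, rook, bishop, knight or pawn, with any type allowed to occur any number of times, and at most one piece per square) on an $N\times N$ board, deciding whether there is a sequence of capturing moves leaving exactly one piece on the board is NP-complete.
   Context: Squares of the board are identified with integer positions $(i,j)$. In Solitaire Chess all pieces are treated as being of one color, and every move must be a capture: a move is an ordered pair $(p_1,p_2)$ of distinct pieces on the board, meaning that $p_1$ moves to the square of $p_2$ and $p_2$ is removed from the board. The move is feasible if $p_1$ could capture a piece on $p_2$'s square under the ordinary rules of chess movement (ignoring colors): a rook moves any distance along its row or column, a bishop any distance along a diagonal, a queen either way, with none of these allowed to pass over an occupied square; a king moves to any of the (up to) eight adjacent squares; a knight moves to a square differing by $(\pm1,\pm2)$ or $(\pm2,\pm1)$; a pawn at $(i,j)$ can only capture a piece at $(i-1,j+1)$ or $(i+1,j+1)$. An instance is solvable if there exists a sequence of feasible moves after which exactly one piece remains. *)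

(* Defs.v *)
From Stdlib Require Import ZArith NArith Relations Permutation.
From mathcomp Require Import all_boot.
Set Implicit Arguments. Unset Strict Implicit.

Inductive dir := DL | DR | DS.

(* Tape symbols: None = blank, Some (inl b) = bit b, Some (inr g) = extra
   work symbol g from a finite set.  States form a finite set.  The machine
   halts when the transition function returns None. *)
Record TM := {
  tm_Q : finType;
  tm_G : finType;
  tm_start : tm_Q;
  tm_delta : tm_Q -> option (bool + tm_G) ->
             option (tm_Q * option (bool + tm_G) * dir);
  tm_acc : tm_Q -> bool }.

Definition sym (M : TM) := option (bool + tm_G M).

(* configuration: state, tape left of head (reversed), tape from head on *)
Record config (M : TM) := Cfg { cq : tm_Q M; cl : seq (sym M); cr : seq (sym M) }.

Definition read_sym (M : TM) (r : seq (sym M)) : sym M :=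
  match r with [::] => None | s :: _ => s end.

Definition tm_step (M : TM) (c : config M) : option (config M) :=
  match tm_delta (cq c) (read_sym (cr c)) with
  | None => None
  | Some (q', s, d) =>
      let l := cl c in let r := behead (cr c) in
      Some (match d with
            | DS => Cfg q' l (s :: r)
            | DR => Cfg q' (s :: l) r
            | DL => match l with
                    | [::] => Cfg q' [::] (None :: s :: r)
                    | x :: l' => Cfg q' l' (x :: s :: r)
                    end
            end)
  end.

Fixpoint tm_steps (M : TM) (n : nat) (c : config M) : option (config M) :=
  match n with
  | 0 => Some c
  | n'.+1 => match tm_step c with Some c' => tm_steps n' c' | None => None end
  end.

Definition tm_init (M : TM) (w : seq bool) : config M :=
  Cfg (tm_start M) [::] (map (fun b => Some (inl b)) w).

Definition halts_within (M : TM) (w : seq bool) (t : nat) (c' : config M) : Prop :=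
  exists k, k <= t /\ tm_steps k (tm_init M w) = Some c' /\ tm_step c' = None.

Fixpoint read_bits (M : TM) (r : seq (sym M)) : seq bool :=
  match r with
  | Some (inl b) :: r' => b :: read_bits r'
  | _ => [::]
  end.

Definition language := seq bool -> Prop.

Definition decides_in_poly_time (M : TM) (L : language) : Prop :=
  exists c k, forall w, exists c', @halts_within M w (c * size w ^ k + c) c' /\
    (tm_acc (cq c') = true <-> L w).

Definition computes_in_poly_time (M : TM) (f : seq bool -> seq bool) : Prop :=
  exists c k, forall w, exists c', @halts_within M w (c * size w ^ k + c) c' /\
    read_bits (cr c') = f w.

Definition in_P (L : language) : Prop := exists M, decides_in_poly_time M L.

Definition poly_time_computable (f : seq bool -> seq bool) : Prop :=
  exists M, computes_in_poly_time M f.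

Definition pair_enc (w y : seq bool) : seq bool :=
  flatten (map (fun b => [:: b; b]) w) ++ [:: false; true] ++ y.

Definition in_NP (L : language) : Prop :=
  exists V : language, in_P V /\ exists c k, forall w,
    L w <-> exists y, size y <= c * size w ^ k + c /\ V (pair_enc w y).

Definition poly_reduces (L1 L2 : language) : Prop :=
  exists f, poly_time_computable f /\ forall w, L1 w <-> L2 (f w).

Definition NP_hard (L : language) : Prop :=
  forall L', in_NP L' -> poly_reduces L' L.

Definition NP_complete (L : language) : Prop := in_NP L /\ NP_hard L.

Inductive piece := King | Queen | Rook | Bishop | Knight | Pawn.

Definition square := (Z * Z)%type.
(* a position: the multiset of pieces on the board with their squares *)
Definition board := seq (piece * square).

Definition occupied (s : board) (x : square) : Prop :=
  exists k, List.In (k, x) s.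

Local Open Scope Z_scope.

(* no occupied square strictly between a and b (used for aligned a, b) *)
Definition clear_path (s : board) (a b : square) : Prop :=
  let di := b.1 - a.1 in let dj := b.2 - a.2 in
  let n := Z.max (Z.abs di) (Z.abs dj) in
  forall t, 0 < t < n ->
    ~ occupied s (a.1 + t * Z.sgn di, a.2 + t * Z.sgn dj).

Definition rook_line (a b : square) : Prop := a.1 = b.1 \/ a.2 = b.2.
Definition bishop_line (a b : square) : Prop :=
  Z.abs (b.1 - a.1) = Z.abs (b.2 - a.2).

Definition can_capture (s : board) (k : piece) (a b : square) : Prop :=
  let di := b.1 - a.1 in let dj := b.2 - a.2 in
  match k with
  | King => Z.abs di <= 1 /\ Z.abs dj <= 1
  | Knight => (Z.abs di = 1 /\ Z.abs dj = 2) \/ (Z.abs di = 2 /\ Z.abs dj = 1)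
  | Pawn => (di = -1 \/ di = 1) /\ dj = 1
  | Rook => rook_line a b /\ clear_path s a b
  | Bishop => bishop_line a b /\ clear_path s a b
  | Queen => (rook_line a b \/ bishop_line a b) /\ clear_path s a b
  end.

Local Close Scope Z_scope.

Definition chess_move (s s' : board) : Prop :=
  exists k1 a k2 b rest,
    a <> b /\ Permutation s ((k1, a) :: (k2, b) :: rest) /\
    can_capture s k1 a b /\ s' = (k1, b) :: rest.

Definition solvable (s : board) : Prop :=
  exists s', clos_refl_trans board chess_move s s' /\ List.length s' = 1%nat.

Definition valid_instance (N : nat) (ps : seq (piece * (nat * nat))) : Prop :=
  1 <= N /\ (forall k i j, List.In (k, (i, j)) ps -> i < N /\ j < N) /\
  List.NoDup (map snd ps).

Definition to_board (ps : seq (piece * (nat * nat))) : board :=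
  map (fun p => (p.1, (Z.of_nat p.2.1, Z.of_nat p.2.2))) ps.

Fixpoint pos_bits (p : positive) : seq bool :=
  match p with
  | xI p' => true :: pos_bits p'
  | xO p' => false :: pos_bits p'
  | xH => [:: true]
  end.

Definition nat_bits (n : nat) : seq bool :=
  match N.of_nat n with N0 => [::] | Npos p => pos_bits p end.

(* self-delimiting binary code of a natural number *)
Definition enc_nat (n : nat) : seq bool :=
  flatten (map (fun b => [:: true; b]) (nat_bits n)) ++ [:: false].

Definition piece_idx (k : piece) : nat :=
  match k with King => 0 | Queen => 1 | Rook => 2 | Bishop => 3
             | Knight => 4 | Pawn => 5 end.

Definition enc_instance (N : nat) (ps : seq (piece * (nat * nat))) : seq bool :=
  enc_nat N ++ enc_nat (size ps) ++
  flatten (map (fun p => enc_nat (piece_idx p.1) ++ enc_nat p.2.1 ++ enc_nat p.2.2) ps).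

Definition SolitaireChess : language := fun w =>
  exists N ps, w = enc_instance N ps /\ valid_instance N ps /\ solvable (to_board ps).

(* Main.v *)
Require Import Defs.
From Stdlib Require Import ZArith NArith Relations Permutation Lia Classical.
From mathcomp Require Import all_boot zify.
Set Implicit Arguments. Unset Strict Implicit. Unset Printing Implicit Defensive.

(** Hardness: acceptance of a word by the verifier of an NP language becomes a
    CNF with four literals per clause describing the run of the machine, and
    the CNF becomes a position of bishops, rooks and pawns whose coordinates are
    all even, so that pawns never capture.  A variable is a bishop from which two
    diagonal tracks leave, one per sign; the pawn of a literal stands on the
    track of its variable and sign, and the bishop can only ever sweep one of its
    two tracks.  The four pawns of a clause lie within reach of only three
    helper rooks, each good for one pawn, hence all of them can disappear iff a
    bishop takes at least one, that is, iff the clause is satisfied.  What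
    remains is then collected by one rook along a column and one bishop along
    a diagonal, which meet on a last square.

    Membership: the certificate lists the board size, the pieces and the moves,
    which are replayed with binary arithmetic on the coordinates.

    Polynomial time is established for functions on serialised trees computed by
    structured programs over four binary stacks, each step of which costs
    a single-tape machine a number of moves linear in the height of the stacks. *)

(** * Stack programs on a single-tape machine *)

(** The clauses have four literals because a step of the machine is stated by implications with
    three premises (state, scanned symbol, one more cell) and one conclusion.

    The obstacle in the chess part is that every piece has to disappear, the helpers and the pawns
    of false literals included, without opening unwanted captures. This dictates the geometry: the
    variables are much further apart than a track is long, and the exits stand on a diagonal far to
    the right, so that no piece in play has an unintended target on its lines. In the proof that a
    solvable position yields an assignment, the absence of pieces in between is therefore used at
    one point only, for a rook that passes over a literal on its way to an exit.

    The two directions treat numbers differently. The coordinates built by the reduction are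
    polynomial in the formula, so it computes in unary. Those of an arbitrary instance may be
    exponential in its length, so the verifier works on bits and asks which pieces are in the way
    instead of walking along a path. *)

Inductive ix := I0 | I1 | I2 | I3.

Definition quad (T : Type) : Type := (T * T * T * T)%type.

Definition get T (i : ix) (v : quad T) : T :=
  let: (a, b, c, d) := v in
  match i with I0 => a | I1 => b | I2 => c | I3 => d end.

Definition put T (i : ix) (x : T) (v : quad T) : quad T :=
  let: (a, b, c, d) := v in
  match i with
  | I0 => (x, b, c, d) | I1 => (a, x, c, d)
  | I2 => (a, b, x, d) | I3 => (a, b, c, x)
  end.

Definition ix_eq (i j : ix) : bool :=
  match i, j with I0, I0 | I1, I1 | I2, I2 | I3, I3 => true | _, _ => false end.

Lemma ix_eqP (i j : ix) : reflect (i = j) (ix_eq i j).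
Proof. by case: i; case: j; constructor. Qed.

Lemma get_put T (i j : ix) (x : T) (v : quad T) :
  get i (put j x v) = if ix_eq i j then x else get i v.
Proof. by case: v => [[[a b] c] d]; case: i; case: j. Qed.

Definition stacks : Type := quad (seq bool).

Inductive instr :=
  | Ipush of ix & bool & nat
  | Ipop of ix & nat & nat & nat
  | Inop of nat.

Definition istep (c : instr) (s : stacks) : nat * stacks :=
  match c with
  | Ipush i b n => (n, put i (b :: get i s) s)
  | Ipop i ne n0 n1 =>
      match get i s with
      | [::] => (ne, s)
      | b :: r => (if b then n1 else n0, put i r s)
      end
  | Inop n => (n, s)
  end.

Inductive frun (code : seq instr) : nat -> nat -> stacks -> nat -> stacks -> Prop :=
  | frun0 pc s : frun code 0 pc s pc s
  | frunS t pc s i pc1 s1 pc2 s2 :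
      onth code pc = Some i -> istep i s = (pc1, s1) ->
      frun code t pc1 s1 pc2 s2 -> frun code t.+1 pc s pc2 s2.

Lemma frun_cat code t1 t2 pc s pc1 s1 pc2 s2 :
  frun code t1 pc s pc1 s1 -> frun code t2 pc1 s1 pc2 s2 ->
  frun code (t1 + t2) pc s pc2 s2.
Proof.
elim=> // t pca sa i pcb sb pcc sc Hi Hs _ IH H2.
by rewrite addSn; apply: frunS Hi Hs (IH H2).
Qed.

Definition trk : Type := (option bool * option bool * option bool * option bool)%type.
Definition cell : Type := option (bool + trk).

Definition blank : trk := (None, None, None, None).

Definition tk (x : cell) : trk :=
  match x with
  | None => blank
  | Some (inl b) => (Some b, None, None, None)
  | Some (inr v) => v
  end.

(* A cell whose tracks 1-3 are blank is stored as a plain input/output bit, so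
   that track 0 doubles as the input and the output of the machine. *)
Definition mkc (v : trk) : cell :=
  match v with
  | (Some b, None, None, None) => Some (inl b)
  | _ => Some (inr v)
  end.

Definition rd (i : ix) (x : cell) : option bool := get i (tk x : quad (option bool)).
Definition wr (i : ix) (o : option bool) (x : cell) : cell :=
  mkc (put i o (tk x : quad (option bool))).

Lemma tk_mkc v : tk (mkc v) = v.
Proof. by case: v => [[[[a|] [b|]] [c|]] [d|]]. Qed.

Lemma mkc_some v : mkc v <> None.
Proof. by case: v => [[[[a|] [b|]] [c|]] [d|]]. Qed.

Definition smode := option bool.

(* Mode [None] searches rightwards for the first cell blank on the track of the
   current instruction, [Some false] has stepped back onto the top of the
   stack, [Some true] returns to the home cell, just right of the first blank
   cell met going left. *)
Definition sdelta (code : seq instr) (q : 'I_(size code).+2 * smode) (x : cell) :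
    option (('I_(size code).+2 * smode) * cell * dir) :=
  let: (pc, md) := q in
  match md with
  | None =>
      match onth code pc with
      | None => None
      | Some (Ipush i b n) =>
          if rd i x is Some _ then Some ((pc, None), x, DR)
          else Some ((inord n, Some true), wr i (Some b) x, DS)
      | Some (Ipop i _ _ _) =>
          if rd i x is Some _ then Some ((pc, None), x, DR)
          else Some ((pc, Some false), x, DL)
      | Some (Inop n) => Some ((inord n, None), x, DS)
      end
  | Some false =>
      match onth code pc with
      | Some (Ipop i ne n0 n1) =>
          if x is None then Some ((inord ne, None), x, DR)
          else match rd i x with
               | Some b => Some ((inord (if b then n1 else n0), Some true),
                                 wr i None x, DS)
               | None => None
               end
      | _ => None
      end
  | Some true =>
      if x is None then Some ((pc, None), x, DR) else Some ((pc, Some true), x, DL)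
  end.

(** Two program counters lie past the code. Both halt, since [onth] is [None] there, and only the
    second one accepts. *)
Definition smach (code : seq instr) : TM :=
  {| tm_Q := ('I_(size code).+2 * smode)%type : finType;
     tm_G := (option bool * option bool * option bool * option bool)%type : finType;
     tm_start := (ord0, None);
     tm_delta := @sdelta code;
     tm_acc := fun q => q.1 == (size code).+1 :> nat |}.

(* Cell 0 of [f] is the blank left of the input; the home cell is 1. *)
Definition rep (f : nat -> cell) (h : nat) (l r : seq cell) : Prop :=
  (forall j, nth None r j = f (h + j)) /\
  (forall j, j < h -> nth None l j = f (h - j.+1)).

Definition treach (code : seq instr) (t : nat) (q : tm_Q (smach code)) f h q' f' h' : Prop :=
  forall l r, rep f h l r ->
    exists l' r', tm_steps t (@Cfg (smach code) q l r) = Some (@Cfg (smach code) q' l' r')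
                  /\ rep f' h' l' r'.

Lemma tm_steps_add (M : TM) t1 t2 (c c1 : config M) :
  tm_steps t1 c = Some c1 -> tm_steps (t1 + t2) c = tm_steps t2 c1.
Proof.
elim: t1 c => [|t1 IH] c /=; first by case=> ->.
by case: (tm_step c) => // c2 /IH.
Qed.

Lemma treach_trans code t1 t2 q f h q1 f1 h1 q2 f2 h2 :
  @treach code t1 q f h q1 f1 h1 -> @treach code t2 q1 f1 h1 q2 f2 h2 ->
  @treach code (t1 + t2) q f h q2 f2 h2.
Proof.
move=> H1 H2 l r /H1[l1 [r1 [E1 /H2[l2 [r2 [E2 R2]]]]]].
by exists l2, r2; split=> //; rewrite (tm_steps_add _ E1).
Qed.

Definition mv (d : dir) (h : nat) : nat :=
  match d with DL => h.-1 | DR => h.+1 | DS => h end.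

(** Cells are numbered by naturals, so a move to the left must not start on cell 0. *)
Lemma treach1 code q f h q' s d (f' : nat -> cell) :
  @sdelta code q (f h) = Some (q', s, d) ->
  (d = DL -> 0 < h) -> (forall j, f' j = if j == h then s else f j) ->
  @treach code 1 q f h q' f' (mv d h).
Proof.
move=> Hd Hl Hf l r [Hr Hll] /=.
have Er : read_sym (M := smach code) r = f h.
  by have := Hr 0; rewrite addn0 => <-; case: (r).
have Hb j : nth None (behead r) j = f (h + j.+1) by rewrite nth_behead Hr.
rewrite /tm_step /= Er Hd; case: d Hd Hl => Hd Hl /=.
- have h0 := Hl erefl.
  case: l Hll => [|x l] Hll; eexists _, _; split=> //; split=> /=.
  + case=> [|[|j]] /=; rewrite Hf.
    * rewrite addn0; case: eqP => [|_]; first lia.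
      by have := Hll 0 h0; rewrite /= subn1.
    * by case: eqP => //; lia.
    * rewrite Hb; case: eqP => [|_]; [lia|congr f; lia].
  + move=> j jh; rewrite Hf; case: eqP => [|_]; first lia.
    have /= := Hll j.+1; rewrite nth_nil => -> //; [congr f; lia|lia].
  + case=> [|[|j]] /=; rewrite Hf.
    * rewrite addn0; case: eqP => [|_]; first lia.
      by have := Hll 0 h0; rewrite /= subn1.
    * by case: eqP => //; lia.
    * rewrite Hb; case: eqP => [|_]; [lia|congr f; lia].
  + move=> j jh; rewrite Hf; case: eqP => [|_]; first lia.
    have /= -> := Hll j.+1; [congr f; lia|lia].
- eexists _, _; split=> //; split=> /=.
  + move=> j; rewrite Hf Hb; case: eqP => [|_]; [lia|congr f; lia].
  + case=> [|j] jh /=; rewrite Hf; first by rewrite subn1 eqxx.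
    rewrite Hll //; case: eqP => [|_]; [lia|congr f; lia].
- eexists _, _; split=> //; split=> /=.
  + case=> [|j] /=; rewrite Hf; first by rewrite addn0 eqxx.
    rewrite Hb; case: eqP => [|_]; [lia|congr f; lia].
  + move=> j jh; rewrite Hf Hll //; case: eqP => [|_]; [lia|congr f; lia].
Qed.

Lemma treach1_same code q f h q' d :
  @sdelta code q (f h) = Some (q', f h, d) -> (d = DL -> 0 < h) ->
  @treach code 1 q f h q' f (mv d h).
Proof. by move=> Hd Hl; apply: treach1 Hd Hl _ => j; case: eqP => [->|]. Qed.

Lemma find_walk code (pc : 'I_(size code).+2) ins i f h d :
  onth code pc = Some ins ->
  (exists b n, ins = Ipush i b n) \/ (exists ne n0 n1, ins = Ipop i ne n0 n1) ->
  (forall j, j < d -> rd i (f (h + j)) != None) ->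
  @treach code d (pc, None) f h (pc, None) f (h + d).
Proof.
move=> Hi Hins; elim: d h => [|d IH] h Hd; first by rewrite addn0 => l r R; exists l, r.
rewrite -add1n; apply: (@treach_trans _ _ _ _ _ _ (pc, None) f h.+1); last first.
  by rewrite -addSnnS; apply: IH => j jd; rewrite addSnnS; apply: Hd.
apply: (@treach1_same _ _ _ _ _ DR) => //=.
have := Hd 0 isT; rewrite addn0 Hi.
by case: Hins => [[b [n ->]]|[ne [n0 [n1 ->]]]]; case: (rd i (f h)).
Qed.

Lemma back_walk code (pc : 'I_(size code).+2) f h :
  f 0 = None -> (forall j, 0 < j <= h -> f j != None) ->
  @treach code h.+1 (pc, Some true) f h (pc, None) f 1.
Proof.
move=> f0; elim: h => [|h IH] Hh.
  by apply: (@treach1_same _ _ _ _ _ DR); rewrite //= f0.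
rewrite -[X in treach X]add1n.
apply: (@treach_trans _ _ _ _ _ _ (pc, Some true) f h).
  apply: (@treach1_same _ _ _ _ _ DL) => //=.
  by have := Hh h.+1; rewrite leqnn; case: (f h.+1) => // /(_ isT).
by apply: IH => j /andP[j0 jh]; apply: Hh; rewrite j0 ltnW.
Qed.

(** Stacks have their bottom at the home cell and grow to the right. The last clause excludes a lone
    bit of track 0 stored as a work symbol, which [read_bits] would not see. *)
Definition tape_inv (s : stacks) (f : nat -> cell) : Prop :=
  [/\ f 0 = None,
      forall i j, rd i (f j.+1) = onth (rev (get i s)) j
    & forall j, f j = None \/ f j = mkc (tk (f j))].

Definition height (s : stacks) : nat :=
  size (get I0 s) + size (get I1 s) + size (get I2 s) + size (get I3 s).

Lemma size_get_height i s : size (get i s) <= height s.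
Proof. by rewrite /height; case: i; lia. Qed.

Lemma height_put i l s :
  height (put i l s) + size (get i s) = height s + size l.
Proof. by case: s => [[[a b] c] d]; rewrite /height; case: i => /=; lia. Qed.

Lemma rd_wr i j o x : rd i (wr j o x) = if ix_eq i j then o else rd i x.
Proof. by rewrite /rd /wr tk_mkc get_put. Qed.

Lemma rd_some_cell i x : rd i x != None -> x != None.
Proof. by case: x => //; case: i. Qed.

(** Covers push and pop at once: the cell that changes lies just above the shorter of the two
    stacks. *)
Lemma tape_inv_write s f i l h o :
  tape_inv s f -> h = (minn (size l) (size (get i s))).+1 ->
  (forall j, onth (rev l) j =
     if j.+1 == h then o else onth (rev (get i s)) j) ->
  tape_inv (put i l s) (fun j => if j == h then wr i o (f h) else f j).
Proof.
move=> [f0 Hrd Hc] Eh Hl; split.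
- by rewrite Eh.
- move=> i' j /=; rewrite get_put; case: ifP => jh; last first.
    rewrite Hrd; case: ix_eqP => // E.
    by rewrite Hl jh E.
  rewrite rd_wr; case: ix_eqP => [_|_]; first by rewrite Hl jh.
  by rewrite -(eqP jh) Hrd.
- by move=> j; case: ifP => _ //; right; rewrite /wr tk_mkc.
Qed.

(** One walk up to the top of a stack and one back, hence twice the height up to a constant. *)
Lemma instr_sim code pc ins s f pc1 s1 :
  onth code pc = Some ins -> istep ins s = (pc1, s1) -> tape_inv s f ->
  exists t f', [/\ 0 < t <= 2 * height s + 6,
    @treach code t (inord pc, None) f 1 (inord pc1, None) f' 1,
    tape_inv s1 f' & height s1 <= (height s).+1].
Proof.
move=> Hi Hs Inv; have [f0 Hrd Hc] := Inv.
have pcs : pc < size code by rewrite -(onthTE code pc) Hi.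
have Epc : (inord pc : 'I_(size code).+2) = pc :> nat by rewrite inordK //; lia.
have Hi' : onth code (inord pc : 'I_(size code).+2) = Some ins by rewrite Epc.
have some_lt i j : j < size (get i s) -> rd i (f j.+1) != None.
  by move=> ij; rewrite Hrd; have := onthTE (rev (get i s)) j; rewrite size_rev ij; case: onth.
have none_ge i : rd i (f (size (get i s)).+1) = None.
  by rewrite Hrd onth_default // size_rev.
case: ins Hi Hi' Hs => [i b n|i ne n0 n1|n] Hi Hi' /=.
- case=> <- <-; pose d := size (get i s).
  have ds : d <= height s by apply: size_get_height.
  set f' := fun j => if j == d.+1 then wr i (Some b) (f d.+1) else f j.
  exists (d + (1 + d.+2)), f'; split.
  + lia.
  + apply: (@treach_trans _ _ _ _ _ _ (inord pc, None) f d.+1).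
      rewrite -[d.+1]add1n; apply: (find_walk Hi' (i := i)); first by left; exists b, n.
      by move=> j jd; rewrite add1n; apply: some_lt.
    apply: (@treach_trans _ _ _ _ _ _ (inord n, Some true) f' d.+1).
      by apply: (@treach1 _ _ _ _ _ (wr i (Some b) (f d.+1)) DS); rewrite //= Hi' none_ge.
    apply: back_walk; first by rewrite /f'.
    move=> j /andP[j0 jd]; rewrite /f'; case: ifP => [_|/eqP jd'].
      by apply/eqP; apply: mkc_some.
    by apply: (@rd_some_cell i); rewrite -(prednK j0); apply: some_lt; lia.
  + apply: (tape_inv_write Inv); first by rewrite /= (minn_idPr _).
    move=> j; rewrite rev_cons onthE map_rcons nth_rcons size_map size_rev -/d -onthE.
    rewrite eqSS; case: ltngtP => // jd; by rewrite onth_default // size_rev ltnW.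
  + by have /= := height_put i (b :: get i s) s; lia.
- case Eg: (get i s) => [|b l] /=.
    (* Empty stack: the home cell is already blank on this track, and one step to the left meets the
       blank cell 0. *)
    case=> <- <-; exists (1 + 1), f; split=> //; first lia.
    have Hn := none_ge i; rewrite Eg /= in Hn.
    apply: (@treach_trans _ _ _ _ _ _ (inord pc, Some false) f 0).
      by apply: (@treach1_same _ _ _ _ _ DL); rewrite //= Hi' Hn.
    by apply: (@treach1_same _ _ _ _ _ DR); rewrite //= Hi' f0.
  case=> <- <-; pose d := size l.
  have Ed : size (get i s) = d.+1 by rewrite Eg.
  have ds : d.+1 <= height s by rewrite -Ed; apply: size_get_height.
  have Hb : rd i (f d.+1) = Some b.
    by rewrite Hrd Eg rev_cons onthE map_rcons nth_rcons size_map size_rev /d ltnn eqxx.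
  set pc' := (if b then n1 else n0).
  set f' := fun j => if j == d.+1 then wr i None (f d.+1) else f j.
  exists (d.+1 + (1 + (1 + d.+2))), f'; split.
  + lia.
  + apply: (@treach_trans _ _ _ _ _ _ (inord pc, None) f d.+2).
      rewrite -[d.+2]add1n; apply: (find_walk Hi' (i := i)).
        by right; exists ne, n0, n1.
      by move=> j jd; rewrite add1n; apply: some_lt; rewrite Ed.
    apply: (@treach_trans _ _ _ _ _ _ (inord pc, Some false) f d.+1).
      apply: (@treach1_same _ _ _ _ _ DL) => //=; rewrite Hi'.
      by have := none_ge i; rewrite Ed => ->.
    apply: (@treach_trans _ _ _ _ _ _ (inord pc', Some true) f' d.+1).
      apply: (@treach1 _ _ _ _ _ (wr i None (f d.+1)) DS) => //=.
      rewrite Hi' Hb; have : f d.+1 != None by apply: (@rd_some_cell i); rewrite Hb.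
      by case: (f d.+1).
    apply: back_walk; first by rewrite /f'.
    move=> j /andP[j0 jd]; rewrite /f'; case: ifP => [_|/eqP jd'].
      by apply/eqP; apply: mkc_some.
    by apply: (@rd_some_cell i); rewrite -(prednK j0); apply: some_lt; lia.
  + apply: (tape_inv_write Inv); first by rewrite Eg /=; lia.
    move=> j; rewrite Eg rev_cons !onthE map_rcons nth_rcons size_map size_rev -/d.
    by rewrite eqSS; case: ltngtP => jd //; rewrite nth_default // size_map size_rev -/d; lia.
  + by have := height_put i l s; rewrite Eg /=; lia.
- case=> <- <-; exists 1, f; split=> //; first lia.
  by apply: (@treach1_same _ _ _ _ _ DS); rewrite //= Hi'.
Qed.

(** Each instruction raises the height by at most one, so [height s + t] bounds it throughout and
    the cost is quadratic. *)
Lemma frun_sim code t pc s pc1 s1 f :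
  frun code t pc s pc1 s1 -> tape_inv s f ->
  exists t' f', [/\ t' <= t * (2 * (height s + t) + 6),
    @treach code t' (inord pc, None) f 1 (inord pc1, None) f' 1 & tape_inv s1 f'].
Proof.
move=> H; elim: H f => [pc0 s0|t0 pc0 s0 i pca sa pcb sb Hi Hs _ IH] f Inv.
  by exists 0, f; split=> // l r R; exists l, r.
have [t1 [f1 [Ht1 R1 Inv1 Hh]]] := instr_sim Hi Hs Inv.
have [t2 [f2 [Ht2 R2 Inv2]]] := IH _ Inv1.
exists (t1 + t2), f2; split=> //; last exact: treach_trans R1 R2.
have : t0 * (2 * (height sa + t0) + 6) <= t0 * (2 * (height s0 + t0.+1) + 6).
  by rewrite leq_mul2l; lia.
rewrite mulSn; lia.
Qed.

(** * Structured programs and their compilation *)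

Inductive prog :=
  | Skip
  | Push of ix & bool
  | Seq of prog & prog
  | Case of ix & prog & prog & prog
  | Loop of ix & prog & prog.

Inductive exec : prog -> stacks -> nat -> stacks -> Prop :=
  | exec_skip s : exec Skip s 1 s
  | exec_push i b s : exec (Push i b) s 1 (put i (b :: get i s) s)
  | exec_seq p q s t1 s1 t2 s2 :
      exec p s t1 s1 -> exec q s1 t2 s2 -> exec (Seq p q) s (t1 + t2) s2
  | exec_case_nil i pe p0 p1 s t s' :
      get i s = [::] -> exec pe s t s' -> exec (Case i pe p0 p1) s t.+1 s'
  | exec_case_cons i pe p0 p1 s b l t s' :
      get i s = b :: l -> exec (if b then p1 else p0) (put i l s) t s' ->
      exec (Case i pe p0 p1) s t.+1 s'
  | exec_loop_nil i p0 p1 s : get i s = [::] -> exec (Loop i p0 p1) s 1 s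
  | exec_loop_cons i p0 p1 s b l t1 s1 t2 s2 :
      get i s = b :: l -> exec (if b then p1 else p0) (put i l s) t1 s1 ->
      exec (Loop i p0 p1) s1 t2 s2 -> exec (Loop i p0 p1) s (t1 + t2).+1 s2.

Fixpoint psize (p : prog) : nat :=
  match p with
  | Skip | Push _ _ => 1
  | Seq p q => psize p + psize q
  | Case _ pe p0 p1 => (psize pe + psize p0 + psize p1).+1
  | Loop _ p0 p1 => (psize p0 + psize p1).+1
  end.

(** [pc] is the address of the code and [nx] the address to continue at; a loop body continues at
    [pc], where the next bit is popped. *)
Fixpoint comp (p : prog) (pc nx : nat) : seq instr :=
  match p with
  | Skip => [:: Inop nx]
  | Push i b => [:: Ipush i b nx]
  | Seq p q => comp p pc (pc + psize p) ++ comp q (pc + psize p) nx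
  | Case i pe p0 p1 =>
      let a := pc.+1 in let b := a + psize pe in let c := b + psize p0 in
      Ipop i a b c :: comp pe a nx ++ comp p0 b nx ++ comp p1 c nx
  | Loop i p0 p1 =>
      let a := pc.+1 in let b := a + psize p0 in
      Ipop i nx a b :: comp p0 a pc ++ comp p1 b pc
  end.

Lemma size_comp p pc nx : size (comp p pc nx) = psize p.
Proof.
elim: p pc nx => [|i b|p IHp q IHq|i pe IHe p0 IH0 p1 IH1|i p0 IH0 p1 IH1] pc nx //=;
  rewrite ?size_cat ?IHp ?IHq ?IHe ?IH0 ?IH1; lia.
Qed.

Definition code_at (code c : seq instr) (pc : nat) : Prop :=
  forall j, j < size c -> onth code (pc + j) = onth c j.

Lemma code_at_catl code c1 c2 pc : code_at code (c1 ++ c2) pc -> code_at code c1 pc.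
Proof.
move=> H j jc; rewrite H ?onth_cat ?jc // size_cat; lia.
Qed.

Lemma code_at_catr code c1 c2 pc n :
  size c1 = n -> code_at code (c1 ++ c2) pc -> code_at code c2 (pc + n).
Proof.
move=> <- H j jc; rewrite -addnA H ?size_cat ?ltn_add2l // onth_cat ltnNge leq_addr /=.
by rewrite addKn.
Qed.

Lemma code_at_cons code i c pc :
  code_at code (i :: c) pc -> onth code pc = Some i /\ code_at code c pc.+1.
Proof.
move=> H; split; first by have := H 0 isT; rewrite addn0.
by move=> j jc; have := H j.+1 jc; rewrite addnS.
Qed.

Lemma exec_frun p s t s' : exec p s t s' ->
  forall code pc nx, code_at code (comp p pc nx) pc -> frun code t pc s nx s'.
Proof.
have one code i pc s0 pc1 s1 : onth code pc = Some i -> istep i s0 = (pc1, s1) ->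
    frun code 1 pc s0 pc1 s1.
  by move=> Hi Hs; apply: frunS Hi Hs (frun0 _ _ _).
elim=> {p s t s'}.
- by move=> s code pc nx /= /code_at_cons[H _]; apply: one H _.
- by move=> i b s code pc nx /= /code_at_cons[H _]; apply: one H _.
- move=> p q s t1 s1 t2 s2 _ IH1 _ IH2 code pc nx /= H.
  apply: frun_cat (IH1 _ _ _ (code_at_catl H)) (IH2 _ _ _ _).
  exact: code_at_catr (size_comp _ _ _) H.
- move=> i pe p0 p1 s t s' Hg _ IH code pc nx /= /code_at_cons[H1 H2].
  apply: frunS H1 _ (IH _ _ _ (code_at_catl H2)); by rewrite /= Hg.
- move=> i pe p0 p1 s b l t s' Hg _ IH code pc nx /= /code_at_cons[H1 H2].
  have H3 := code_at_catr (size_comp _ _ _) H2.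
  have H4 := code_at_catr (size_comp _ _ _) H3.
  apply: frunS H1 _ (IH _ _ _ _); first by rewrite /= Hg.
  by case: (b) => //; apply: code_at_catl H3.
- move=> i p0 p1 s Hg code pc nx /= /code_at_cons[H1 H2].
  by apply: one H1 _; rewrite /= Hg.
- move=> i p0 p1 s b l t1 s1 t2 s2 Hg _ IH1 _ IH2 code pc nx /= Hc.
  have [H1 H2] := code_at_cons Hc.
  have H3 := code_at_catr (size_comp _ _ _) H2.
  apply: frunS H1 _ (frun_cat (IH1 _ _ pc _) (IH2 _ _ _ Hc)); first by rewrite /= Hg.
  by case: (b) => //; apply: code_at_catl H2.
Qed.

(** * Input and output of the machine *)

Definition init_tape (w : seq bool) (j : nat) : cell :=
  if j is j'.+1 then nth None [seq Some (inl b) | b <- w] j' else None.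

(** A word written from the home cell on is a stack with its last bit on top; hence the [rev] in all
    conditions on input and output. *)
Lemma init_tape_inv w : tape_inv (rev w, [::], [::], [::]) (init_tape w).
Proof.
split=> //.
- move=> i j /=; case: i => /=; rewrite ?revK ?onth0n;
    elim: w j => [|b w IH] [|j] //=; rewrite ?nth_nil //; exact: IH.
- case=> [|j] /=; first by left.
  elim: w j => [|b w IH] [|j] //=; rewrite ?nth_nil; by [left|right|].
Qed.

Lemma init_rep w : rep (init_tape w) 1 [::] [seq Some (inl b) | b <- w].
Proof. by split=> [j|[|j]] //=; rewrite add1n. Qed.

Lemma final_read code out r f :
  tape_inv (rev out, [::], [::], [::]) f -> (forall j, nth None r j = f j.+1) ->
  @read_bits (smach code) r = out.
Proof.
move=> [_ Hrd Hc] Hr.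
have {Hrd} : forall j, tk (nth None r j) = (onth out j, None, None, None).
  move=> j; rewrite Hr.
  have := Hrd I0 j; have := Hrd I1 j; have := Hrd I2 j; have := Hrd I3 j.
  rewrite /rd /= revK onth0n; case: (tk (f j.+1)) => [[[a b] c] d] /=.
  by move=> -> -> -> ->.
have {Hc f Hr} : forall j, nth None r j = None \/ nth None r j = mkc (tk (nth None r j)).
  by move=> j; rewrite Hr; apply: Hc.
elim: r out => [|x r IH] out Hc Ht.
  by case: out Ht => // b out /(_ 0).
have := Ht 0; have := Hc 0; case: out Ht => [|b out] Ht /=.
  by move=> H1 H2; move: H1; rewrite H2; case=> ->.
case=> [-> //|-> ]; rewrite tk_mkc => ->; congr cons.
by apply: IH => j; [exact: (Hc j.+1)|exact: (Ht j.+1)].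
Qed.

(** * Polynomial bounds *)

(** Syntax instead of functions: without subtraction every bound is monotone, and substitution
    composes bounds. [ev_bound] returns to the form [c * n ^ k + c]. *)
Inductive pexp := PX | PC of nat | PAdd of pexp & pexp | PMul of pexp & pexp.

Fixpoint ev (P : pexp) (n : nat) : nat :=
  match P with
  | PX => n
  | PC c => c
  | PAdd p q => ev p n + ev q n
  | PMul p q => ev p n * ev q n
  end.

Fixpoint psubst (P Q : pexp) : pexp :=
  match P with
  | PX => Q
  | PC c => PC c
  | PAdd p q => PAdd (psubst p Q) (psubst q Q)
  | PMul p q => PMul (psubst p Q) (psubst q Q)
  end.

Lemma ev_subst P Q n : ev (psubst P Q) n = ev P (ev Q n).
Proof. by elim: P => //= p -> q ->. Qed.

Lemma ev_mono P m n : m <= n -> ev P m <= ev P n.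
Proof.
move=> mn; elim: P => //= p IHp q IHq; first exact: leq_add.
exact: leq_mul.
Qed.

(** The added 1 is for [n = 0] and [k1 = 0], where the left side is 1. *)
Lemma expn_leD n k1 k2 : n ^ k1 <= n ^ (k1 + k2) + 1.
Proof.
case: n => [|n]; first by case: k1 => [|k1]; [exact: leq_addl | rewrite exp0n].
by apply: leq_trans (leq_addr _ _); rewrite leq_pexp2l // leq_addr.
Qed.

Lemma ev_bound P : exists c k, forall n, ev P n <= c * n ^ k + c.
Proof.
elim: P => [|c|p [c1 [k1 H1]] q [c2 [k2 H2]]|p [c1 [k1 H1]] q [c2 [k2 H2]]].
- by exists 1, 1 => n /=; rewrite expn1; lia.
- by exists c, 0 => n /=; lia.
- exists (2 * (c1 + c2)), (k1 + k2) => n /=.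
  have := H1 n; have := H2 n; have := expn_leD n k1 k2.
  have := expn_leD n k2 k1; rewrite [k2 + k1]addnC.
  move: (n ^ k1) (n ^ k2) (n ^ (k1 + k2)) => a b e Hb Ha; nia.
- exists (3 * (c1 * c2)), (k1 + k2) => n /=.
  apply: leq_trans (leq_mul (H1 n) (H2 n)) _.
  have := expn_leD n k1 k2; have := expn_leD n k2 k1; rewrite [k2 + k1]addnC.
  rewrite expnD; move: (n ^ k1) (n ^ k2) => a b Hb Ha.
  have H : a * b + a + b + 1 <= 3 * (a * b + 1) by lia.
  have := leq_mul (leqnn (c1 * c2)) H; lia.
Qed.

Lemma smach_run code t s1 pc1 w P :
  frun code t 0 (rev w, [::], [::], [::]) pc1 s1 ->
  t <= ev P (size w) -> size code <= pc1 <= (size code).+1 ->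
  exists l r f, [/\ @halts_within (smach code) w
      (ev (PMul P (PAdd (PMul (PC 2) (PAdd PX P)) (PC 6))) (size w))
      (Cfg (M := smach code) (inord pc1, None) l r),
    tape_inv s1 f & forall j, nth None r j = f j.+1].
Proof.
move=> Hrun Ht /andP[pc1a pc1b].
have [t' [f' [Ht' R Inv]]] := frun_sim Hrun (init_tape_inv w).
have [l [r [E [Hr _]]]] := R _ _ (init_rep w).
exists l, r, f'; split=> //.
exists t'; split.
  apply: leq_trans Ht' _; rewrite /= /height /= size_rev.
  by apply: leq_mul => //; lia.
split.
  rewrite -E /tm_init; congr (tm_steps _ (Cfg _ _ _)).
  by congr pair; apply/val_inj; rewrite /= inordK.
by rewrite /tm_step /= inordK ?ltnS // onth_default.
Qed.

Lemma exec_computes p f P :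
  (forall w, exists t, t <= ev P (size w) /\
     exec p (rev w, [::], [::], [::]) t (rev (f w), [::], [::], [::])) ->
  poly_time_computable f.
Proof.
move=> H; pose code := comp p 0 (psize p).
have sc : size code = psize p by apply: size_comp.
exists (smach code).
have [c [k Hck]] := ev_bound (PMul P (PAdd (PMul (PC 2) (PAdd PX P)) (PC 6))).
exists c, k => w; have [t [Ht He]] := H w.
have Hf : frun code t 0 (rev w, [::], [::], [::]) (psize p) (rev (f w), [::], [::], [::]).
  by apply: (exec_frun He) => j jc; rewrite add0n.
have [|l [r [g [Hh Inv Hr]]]] := smach_run Hf Ht; first by rewrite sc leqnn leqnSn.
exists (Cfg (M := smach code) (inord (psize p), None) l r); split.
  case: Hh => n [Hn Hn']; exists n; split=> //; exact: leq_trans Hn (Hck _).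
exact: final_read Inv Hr.
Qed.

Lemma exec_decides p f P :
  (forall w, exists t s r, [/\ t <= ev P (size w), get I0 s = f w :: r &
     exec p (rev w, [::], [::], [::]) t s]) ->
  in_P (fun w => f w = true).
Proof.
move=> H; pose n := (psize p).+1.
(* The added instruction pops the answer and jumps to one of the two halting addresses. *)
pose code := comp p 0 (psize p) ++ [:: Ipop I0 n n n.+1].
have sc : size code = n by rewrite size_cat size_comp addn1.
exists (smach code).
set Q := PAdd P (PC 1).
have [c [k Hck]] := ev_bound (PMul Q (PAdd (PMul (PC 2) (PAdd PX Q)) (PC 6))).
exists c, k => w; have [t [s [r [Ht Hs He]]]] := H w.
have Hf : frun code (t + 1) 0 (rev w, [::], [::], [::]) (if f w then n.+1 else n) (put I0 r s).
  apply: (@frun_cat _ _ _ _ _ (psize p) s).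
    by apply: (exec_frun He) => j jc; rewrite add0n onth_cat jc.
  apply: frunS (frun0 _ _ _); first by rewrite onth_cat size_comp ltnn subnn.
  by rewrite /= Hs.
have Ht' : t + 1 <= ev Q (size w) by rewrite /= leq_add2r.
have [|l [r' [g [Hh Inv Hr]]]] := smach_run Hf Ht'.
  by rewrite sc; case: (f w); rewrite ?leqnn ?leqnSn.
exists (Cfg (M := smach code) (inord (if f w then n.+1 else n), None) l r'); split.
  case: Hh => m [Hm Hm']; exists m; split=> //; exact: leq_trans Hm (Hck _).
rewrite /= sc; case: (f w); rewrite inordK ?sc ?ltnS ?leqnSn ?eqxx //.
by rewrite eqn_leq leqnSn ltnn.
Qed.

(** * Polynomial-time functions on trees *)

Definition run (p : prog) (s s' : stacks) (T : nat) : Prop :=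
  exists t, t <= T /\ exec p s t s'.

Lemma run_weaken p s s' T T' : run p s s' T -> T <= T' -> run p s s' T'.
Proof. by case=> t [H E] HT; exists t; split=> //; apply: leq_trans H HT. Qed.

Lemma run_skip s : run Skip s s 1.
Proof. by exists 1; split=> //; constructor. Qed.

Lemma run_push i b s : run (Push i b) s (put i (b :: get i s) s) 1.
Proof. by exists 1; split=> //; constructor. Qed.

Lemma run_seq p q s s1 s2 T1 T2 :
  run p s s1 T1 -> run q s1 s2 T2 -> run (Seq p q) s s2 (T1 + T2).
Proof.
move=> [t1 [H1 E1]] [t2 [H2 E2]]; exists (t1 + t2); split; first exact: leq_add.
exact: exec_seq E1 E2.
Qed.

Lemma run_case i pe p0 p1 s b l s' T :
  get i s = b :: l -> run (if b then p1 else p0) (put i l s) s' T ->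
  run (Case i pe p0 p1) s s' T.+1.
Proof. by move=> Hg [t [H E]]; exists t.+1; split=> //; apply: exec_case_cons Hg E. Qed.

Lemma run_loop_nil i p0 p1 s : get i s = [::] -> run (Loop i p0 p1) s s 1.
Proof. by move=> Hg; exists 1; split=> //; constructor. Qed.

Lemma run_loop_cons i p0 p1 s b l s1 s2 T1 T2 :
  get i s = b :: l -> run (if b then p1 else p0) (put i l s) s1 T1 ->
  run (Loop i p0 p1) s1 s2 T2 -> run (Loop i p0 p1) s s2 (T1 + T2).+1.
Proof.
move=> Hg [t1 [H1 E1]] [t2 [H2 E2]]; exists (t1 + t2).+1; split; first exact: leq_add.
exact: exec_loop_cons Hg E1 E2.
Qed.

(** A time bound is thus also a bound on the size of the output; [PT_size] is obtained this way. *)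
Lemma exec_height p s t s' : exec p s t s' -> height s' <= height s + t.
Proof.
elim=> {p s t s'} //=.
- by move=> s; lia.
- by move=> i b s; have /= := height_put i (b :: get i s) s; lia.
- by move=> p q s t1 s1 t2 s2 _ H1 _ H2; lia.
- by move=> i pe p0 p1 s t s' _ _ H; lia.
- move=> i pe p0 p1 s b l t s' Hg _ H; have := height_put i l s; rewrite Hg /=; lia.
- by move=> i p0 p1 s _; lia.
- move=> i p0 p1 s b l t1 s1 t2 s2 Hg _ H1 _ H2; have := height_put i l s; rewrite Hg /=; lia.
Qed.

Definition pour (i j : ix) : prog := Loop i (Push j false) (Push j true).

Lemma run_pour i j s : ~~ ix_eq i j ->
  run (pour i j) s (put j (rev (get i s) ++ get j s) (put i [::] s))
      (2 * size (get i s) + 1).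
Proof.
move=> ij; move El: (get i s) => l; elim: l s El => [|b l IH] s El.
  have -> : put j (rev [::] ++ get j s) (put i [::] s) = s.
    by case: s El ij => [[[a1 a2] a3] a4]; case: i; case: j => //= ->.
  by rewrite /= muln0; apply: run_loop_nil.
pose s1 := put j (b :: get j s) (put i l s).
have E1 : get i s1 = l by rewrite !get_put (negbTE ij); case: (i).
have H1 : run (if b then Push j true else Push j false) (put i l s) s1 1.
  have -> : s1 = put j (b :: get j (put i l s)) (put i l s).
    by rewrite /s1; case: (s) ij => [[[? ?] ?] ?]; case: (i); case: (j).
  by case: (b); apply: run_push.
have E2 : put j (rev l ++ get j s1) (put i [::] s1) =
          put j (rev (b :: l) ++ get j s) (put i [::] s).
  rewrite rev_cons cat_rcons /s1.
  by case: s El ij {IH s1 E1 H1} => [[[a1 a2] a3] a4]; case: i; case: j.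
rewrite -E2; apply: run_weaken (run_loop_cons El H1 (IH s1 E1)) _; rewrite /=; lia.
Qed.

(** * Serialised trees on a stack *)

Inductive tree := Lf | Nd of tree & tree.

(** Preorder with one bit per node. The code is self-delimiting, so values lying on top of each
    other on a stack need no separators. *)
Fixpoint ser (t : tree) : seq bool :=
  match t with Lf => [:: false] | Nd a b => true :: ser a ++ ser b end.

Definition st (x : seq bool) : stacks := (x, [::], [::], [::]).

(* Stack 3 counts, in unary, the subtrees still to be read. *)
Definition mv_body (j : ix) : prog :=
  Case I0 Skip (Push j false)
    (Seq (Push j true) (Seq (Push I3 true) (Push I3 true))).
Definition mv_tree (j : ix) : prog :=
  Seq (Push I3 true) (Loop I3 (mv_body j) (mv_body j)).

(** The rest of the loop is a hypothesis, so that the induction can treat the two subtrees of a node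
    one after the other. *)
Lemma mv_loop j t x l m c s' T : j = I1 \/ j = I2 ->
  run (Loop I3 (mv_body j) (mv_body j)) (put j (rev (ser t) ++ get j (x, l, m, c)) (x, l, m, c)) s' T ->
  run (Loop I3 (mv_body j) (mv_body j)) (ser t ++ x, l, m, true :: c) s' (5 * size (ser t) + T).
Proof.
move=> Hj; elim: t x l m c T => [|a IHa b IHb] x l m c T H.
  apply: (@run_weaken _ _ _ (2 + T).+1); last by rewrite /=; lia.
  apply: run_loop_cons; [reflexivity| |exact: H].
  case: Hj H => -> /= H; (apply: run_case; [reflexivity|]);
    by apply: (run_push _ false (x, l, m, c)).
pose s1 := put j (true :: get j (x, l, m, c)) (ser a ++ ser b ++ x, l, m, true :: true :: c).
have H1 : run (mv_body j) (true :: (ser a ++ ser b ++ x), l, m, c) s1 4.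
  rewrite /s1; case: Hj {H IHa IHb} => Ej; rewrite {}Ej /=; (apply: run_case; [reflexivity|]);
  exact: run_seq (run_push _ _ _) (run_seq (run_push _ _ _) (run_push _ _ _)).
apply: (@run_weaken _ _ _ (4 + (5 * size (ser a) + (5 * size (ser b) + T))).+1).
  apply: run_loop_cons; [reflexivity| |].
    by rewrite /= -catA; apply: H1.
  case: Hj {H1} => Ej; subst j; rewrite /s1 /=; apply: IHa => /=; apply: IHb => /=;
    by move: H; rewrite rev_cons rev_cat -cats1 -!catA.
by rewrite /= size_cat; lia.
Qed.

Lemma run_mv1 t x l m :
  run (mv_tree I1) (ser t ++ x, l, m, [::]) (x, rev (ser t) ++ l, m, [::]) (5 * size (ser t) + 2).
Proof.
apply: (@run_weaken _ _ _ (1 + (5 * size (ser t) + 1))); last lia.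
apply: run_seq; first exact: run_push.
apply: mv_loop; first by left.
exact: run_loop_nil.
Qed.

Lemma run_mv2 t x l m :
  run (mv_tree I2) (ser t ++ x, l, m, [::]) (x, l, rev (ser t) ++ m, [::]) (5 * size (ser t) + 2).
Proof.
apply: (@run_weaken _ _ _ (1 + (5 * size (ser t) + 1))); last lia.
apply: run_seq; first exact: run_push.
apply: mv_loop; first by right.
exact: run_loop_nil.
Qed.

Definition pour2 : prog :=
  Loop I1 (Seq (Push I0 false) (Push I2 false)) (Seq (Push I0 true) (Push I2 true)).

Lemma run_pour2 x l m c :
  run pour2 (x, l, m, c) (rev l ++ x, [::], rev l ++ m, c) (3 * size l + 1).
Proof.
elim: l x m => [|b l IH] x m; first exact: run_loop_nil.
apply: (@run_weaken _ _ _ (2 + (3 * size l + 1)).+1); last by rewrite /=; lia.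
rewrite rev_cons !cat_rcons; apply: run_loop_cons (IH (b :: x) (b :: m)); first by [].
by case: b; apply: run_seq (run_push _ _ _) (run_push _ _ _).
Qed.

Definition dup_tree : prog :=
  Seq (mv_tree I1) (Seq pour2 (Seq (pour I2 I1) (pour I1 I0))).

Lemma run_dup t r :
  run dup_tree (st (ser t ++ r)) (st (ser t ++ ser t ++ r)) (12 * size (ser t) + 5).
Proof.
apply: (@run_weaken _ _ _ ((5 * size (ser t) + 2) + ((3 * size (ser t) + 1) +
          ((2 * size (ser t) + 1) + (2 * size (ser t) + 1))))); last lia.
apply: run_seq (run_mv1 _ _ _ _) _; rewrite cats0.
apply: run_seq; first by rewrite -[size (ser t)]size_rev; apply: run_pour2.
rewrite revK cats0; apply: run_seq; first exact: run_pour.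
rewrite -[X in 2 * X]size_rev.
have := @run_pour I1 I0 (ser t ++ r, rev (ser t), [::], [::]) isT.
by rewrite /= revK cats0.
Qed.

Definition swap_tree : prog :=
  Seq (mv_tree I1) (Seq (mv_tree I2) (Seq (pour I1 I0) (pour I2 I0))).

Lemma run_swap t u r :
  run swap_tree (st (ser t ++ ser u ++ r)) (st (ser u ++ ser t ++ r))
      (7 * (size (ser t) + size (ser u)) + 6).
Proof.
apply: (@run_weaken _ _ _ ((5 * size (ser t) + 2) + ((5 * size (ser u) + 2) +
          ((2 * size (ser t) + 1) + (2 * size (ser u) + 1))))); last lia.
apply: run_seq (run_mv1 _ _ _ _) _; apply: run_seq (run_mv2 _ _ _ _) _; rewrite !cats0.
rewrite -[X in 2 * X]size_rev; apply: run_seq; first exact: run_pour.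
rewrite /= revK -[X in 2 * X]size_rev.
have := @run_pour I2 I0 (ser t ++ r, [::], rev (ser u), [::]) isT.
by rewrite /= revK.
Qed.

Lemma run_discard x l m c : run (Loop I1 Skip Skip) (x, l, m, c) (x, [::], m, c) (2 * size l + 1).
Proof.
elim: l => [|b l IH]; first exact: run_loop_nil.
apply: (@run_weaken _ _ _ (1 + (2 * size l + 1)).+1); last by rewrite /=; lia.
apply: run_loop_cons IH; first by [].
by case: b; apply: run_skip.
Qed.

Definition drop_tree : prog := Seq (mv_tree I1) (Loop I1 Skip Skip).

Lemma run_drop t r : run drop_tree (st (ser t ++ r)) (st r) (7 * size (ser t) + 3).
Proof.
apply: (@run_weaken _ _ _ ((5 * size (ser t) + 2) + (2 * size (ser t) + 1))); last lia.
apply: run_seq (run_mv1 _ _ _ _) _; rewrite cats0 -[X in 2 * X]size_rev.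
exact: run_discard.
Qed.

Fixpoint pushes (l : seq bool) : prog :=
  if l is b :: l' then Seq (pushes l') (Push I0 b) else Skip.

Lemma run_pushes l r : run (pushes l) (st r) (st (l ++ r)) (size l + 1).
Proof.
elim: l => [|b l IH]; first exact: run_skip.
apply: (@run_weaken _ _ _ ((size l + 1) + 1)); last by rewrite /=; lia.
exact: run_seq IH (run_push _ _ _).
Qed.

Definition pop0 : prog := Case I0 Skip Skip Skip.

Lemma run_pop0 b r : run pop0 (st (b :: r)) (st r) 2.
Proof. by apply: run_case; [reflexivity|case: b; apply: run_skip]. Qed.

(** * Encodable types and polynomial-time combinators *)

(** Coincidences of codes are exploited: [x :: l] is coded as the pair [(x, l)] and [n.+1] as the
    pair [(tt, n)]. Naturals are unary, so polynomial time on [nat] means polynomial in the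
    value. *)
Structure encType := EncType { esort :> Type; enc : esort -> tree }.
Arguments enc {e}.

Canonical tree_encType := @EncType tree id.
Canonical unit_encType := @EncType unit (fun _ => Lf).
Canonical bool_encType := @EncType bool (fun b => if b then Nd Lf Lf else Lf).
Canonical nat_encType := @EncType nat (fun n => iter n (Nd Lf) Lf).
Canonical prod_encType (A B : encType) :=
  @EncType (A * B) (fun p => Nd (enc p.1) (enc p.2)).
Canonical seq_encType (A : encType) :=
  @EncType (seq A) (fix enc_seq l := if l is x :: l' then Nd (enc x) (enc_seq l') else Lf).

Definition sz (A : encType) (a : A) : nat := size (ser (enc a)).

(* The rest [r] of stack 0 is left in place and the other stacks are empty before
   and after, so that such programs compose in any context. *)
Definition PT (A B : encType) (f : A -> B) : Prop :=
  exists p P, forall a r,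
    run p (st (ser (enc a) ++ r)) (st (ser (enc (f a)) ++ r)) (ev P (sz a)).

Lemma sz_gt0 (A : encType) (a : A) : 0 < sz a.
Proof. by rewrite /sz; case: (enc a). Qed.

Lemma ser_pair (A B : encType) (p : A * B) :
  ser (enc p) = true :: ser (enc p.1) ++ ser (enc p.2).
Proof. by []. Qed.

Lemma ser_cons (A : encType) x (l : seq A) :
  ser (enc (x :: l)) = true :: ser (enc x) ++ ser (enc l).
Proof. by []. Qed.

Lemma sz_pair (A B : encType) (p : A * B) : sz p = (sz p.1 + sz p.2).+1.
Proof. by rewrite /sz /= size_cat. Qed.

Lemma sz_cons (A : encType) x (l : seq A) : sz (x :: l) = (sz x + sz l).+1.
Proof. by rewrite /sz /= size_cat. Qed.

Lemma sz_nil (A : encType) : sz ([::] : seq A) = 1.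
Proof. by []. Qed.

Lemma sz_cat (A : encType) (l1 l2 : seq A) : (sz (l1 ++ l2)).+1 = sz l1 + sz l2.
Proof.
elim: l1 => [|x l1 IH]; first by rewrite sz_nil add1n.
by rewrite cat_cons !sz_cons; lia.
Qed.

Lemma size_sz (A : encType) (l : seq A) : size l < sz l.
Proof. by elim: l => [|x l IH] //; rewrite sz_cons /=; lia. Qed.

Lemma sz_nat (n : nat) : sz n = (2 * n).+1.
Proof. by elim: n => // n IH; rewrite -[sz n.+1]/(sz n).+2 IH; lia. Qed.

Lemma sz_bool (b : bool) : sz b <= 3.
Proof. by case: b. Qed.

Lemma PT_size (A B : encType) (f : A -> B) :
  PT f -> exists P, forall a, sz (f a) <= ev P (sz a).
Proof.
move=> [p [P H]]; exists (PAdd PX P) => a.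
have [t [Ht He]] := H a [::].
have := exec_height He; rewrite /height /= !cats0 /sz; rewrite /sz in Ht; lia.
Qed.

(** A program sees codes only, so functions with equal codes share their program even if their
    result types differ. *)
Lemma PT_enc (A B C : encType) (f : A -> B) (g : A -> C) :
  PT f -> (forall a, enc (g a) = enc (f a)) -> PT g.
Proof. by move=> [p [P H]] E; exists p, P => a r; rewrite E. Qed.

Lemma PT_ext (A B : encType) (f g : A -> B) :
  PT f -> g =1 f -> PT g.
Proof. by move=> H E; apply: PT_enc H _ => a; rewrite E. Qed.

Lemma PT_id (A : encType) : PT (fun a : A => a).
Proof. by exists Skip, (PC 1) => a r; apply: run_skip. Qed.

Lemma PT_comp (A B C : encType) (g : B -> C) (f : A -> B) :
  PT g -> PT f -> PT (fun a => g (f a)).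
Proof.
move=> [pg [Pg Hg]] Hf; have [Q HQ] := PT_size Hf; move: Hf => [pf [Pf Hf]].
exists (Seq pf pg), (PAdd Pf (psubst Pg Q)) => a r.
apply: run_weaken (run_seq (Hf a r) (Hg (f a) r)) _.
by rewrite /= ev_subst leq_add2l; apply: ev_mono.
Qed.

Lemma PT_const (A B : encType) (b : B) : PT (fun _ : A => b).
Proof.
exists (Seq drop_tree (pushes (ser (enc b)))), (PAdd (PMul (PC 7) PX) (PC (sz b + 4))) => a r.
apply: run_weaken (run_seq (run_drop _ _) (run_pushes _ _)) _.
by rewrite /= /sz; lia.
Qed.

Lemma PT_pair (A B C : encType) (f : A -> B) (g : A -> C) :
  PT f -> PT g -> PT (fun a => (f a, g a)).
Proof.
move=> [pf [Pf Hf]] Hg; have [Q HQ] := PT_size Hg; move: Hg => [pg [Pg Hg]].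
exists (Seq dup_tree (Seq pg (Seq swap_tree (Seq pf (Push I0 true))))).
exists (PAdd (PAdd Pf Pg) (PAdd (PMul (PC 19) (PAdd PX Q)) (PC 20))) => a r.
apply: run_weaken.
  apply: run_seq (run_dup _ _) (run_seq (Hg a _) (run_seq (run_swap _ _ _)
    (run_seq (Hf a _) _))).
  have := run_push I0 true (st (ser (enc (f a)) ++ ser (enc (g a)) ++ r)).
  by rewrite ser_pair /= -catA; apply.
by rewrite /=; have := HQ a; rewrite /sz; lia.
Qed.

Lemma PT_fst (A B : encType) : PT (fun p : A * B => p.1).
Proof.
exists (Seq pop0 (Seq swap_tree drop_tree)), (PAdd (PMul (PC 14) PX) (PC 11)) => -[a b] r.
apply: run_weaken.
  rewrite ser_pair /= -catA.
  exact: run_seq (run_pop0 _ _) (run_seq (run_swap _ _ _) (run_drop _ _)).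
by rewrite sz_pair /= /sz; lia.
Qed.

Lemma PT_snd (A B : encType) : PT (fun p : A * B => p.2).
Proof.
exists (Seq pop0 drop_tree), (PAdd (PMul (PC 7) PX) (PC 5)) => -[a b] r.
apply: run_weaken.
  by rewrite ser_pair /= -catA; apply: run_seq (run_pop0 _ _) (run_drop _ _).
by rewrite sz_pair /= /sz; lia.
Qed.

(** Once its first bit is popped, the code of [true] still has two leaves to discard. *)
Definition branch (p0 p1 : prog) : prog := Case I0 Skip p0 (Seq pop0 (Seq pop0 p1)).

Lemma run_branch (b : bool) p0 p1 r s' T : run (if b then p1 else p0) (st r) s' T ->
  run (branch p0 p1) (st (ser (enc b) ++ r)) s' (T + 5).
Proof.
case: b => H; last by apply: (@run_weaken _ _ _ T.+1); [apply: run_case; [reflexivity|] | lia].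
apply: (@run_weaken _ _ _ (2 + (2 + T)).+1); last lia.
apply: run_case; first reflexivity.
exact: run_seq (run_pop0 _ _) (run_seq (run_pop0 _ _) H).
Qed.

Lemma PT_if (A B : encType) (c : A -> bool) (f g : A -> B) :
  PT c -> PT f -> PT g -> PT (fun a => if c a then f a else g a).
Proof.
move=> [pc [Pc Hc]] [pf [Pf Hf]] [pg [Pg Hg]].
exists (Seq dup_tree (Seq pc (branch pg pf))).
exists (PAdd (PAdd Pf Pg) (PAdd Pc (PAdd (PMul (PC 12) PX) (PC 10)))) => a r.
apply: (@run_weaken _ _ _ (12 * sz a + 5 + (ev Pc (sz a) + ((ev Pf (sz a) + ev Pg (sz a)) + 5)))).
  apply: run_seq (run_dup _ _) (run_seq (Hc a _) _).
  apply: run_branch; case: (c a); [apply: run_weaken (Hf a r) _|apply: run_weaken (Hg a r) _]; lia.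
by rewrite /=; lia.
Qed.

Lemma PT_cons (A B : encType) (f : A -> B) (g : A -> seq B) :
  PT f -> PT g -> PT (fun a => f a :: g a).
Proof. by move=> Hf Hg; apply: PT_enc (PT_pair Hf Hg) _. Qed.

Lemma PT_seq_case (A B X : encType) (l : A -> seq X)
    (g : A -> B) (h : A -> X -> seq X -> B) :
  PT l -> PT g -> PT (fun p : A * (X * seq X) => h p.1 p.2.1 p.2.2) ->
  PT (fun a => if l a is x :: t then h a x t else g a).
Proof.
move=> Hl [pg [Pg Hg]] [ph [Ph Hh]]; have [Q HQ] := PT_size Hl; move: Hl => [pl [Pl Hl]].
exists (Seq dup_tree (Seq pl (Case I0 Skip pg
  (Seq (Push I0 true) (Seq swap_tree (Seq (Push I0 true) ph)))))).
exists (PAdd (PAdd Pl Pg) (PAdd (psubst Ph (PAdd (PC 1) (PAdd PX Q)))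
         (PAdd (PMul (PC 19) (PAdd PX Q)) (PC 20)))) => a r.
have HQa := HQ a.
apply: (@run_weaken _ _ _ (12 * sz a + 5 + (ev Pl (sz a) +
   (1 + ((7 * (sz a + sz (l a)) + 6) + (1 + (ev Pg (sz a) + ev Ph (1 + (sz a + sz (l a))))))).+1))).
  apply: run_seq (run_dup _ _) (run_seq (Hl a _) _).
  case E: (l a) => [|x t].
    by apply: run_case; first reflexivity; apply: run_weaken (Hg a r) _; lia.
  apply: run_case; first reflexivity.
  (* Restoring the popped bit gives back the code of [x :: t]; after the swap, one more bit makes it
     the code of [(a, (x, t))]. *)
  apply: run_seq; first exact: run_push.
  apply: (@run_seq _ _ _ (st (ser (enc a) ++ ser (enc (x :: t)) ++ r))).
    by apply: run_weaken (run_swap (enc (x :: t)) (enc a) r) _; rewrite /sz; lia.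
  apply: run_seq; first exact: run_push.
  apply: run_weaken.
    by have := Hh (a, (x, t)) r; rewrite ser_pair /= -catA; apply.
  by rewrite !sz_pair /= sz_cons add1n; lia.
rewrite /= ev_subst /=.
have : ev Ph (1 + (sz a + sz (l a))) <= ev Ph (1 + (sz a + ev Q (sz a))).
  by apply: ev_mono; lia.
lia.
Qed.

(** [N] bounds the number of rounds and [S] all intermediate sizes, as iterating a polynomial growth
    could become exponential. The condition is passed on stack 3, which holds a bit exactly when
    another round is due. *)
Lemma PT_while (A0 A : encType) (start : A0 -> A) (c : A -> bool)
    (f : A -> A) (W : A0 -> A) (N S : pexp) :
  PT start -> PT c -> PT f ->
  (forall a0, let a := start a0 in exists n,
    [/\ n <= ev N (sz a0), W a0 = iter n f a, c (iter n f a) = false,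
     forall i, i < n -> c (iter i f a) & forall i, i <= n -> sz (iter i f a) <= ev S (sz a0)]) ->
  PT W.
Proof.
move=> [ps [Ps Hps]] [pc [Pc Hc]] [pf [Pf Hf]] HW.
pose test := Seq dup_tree (Seq pc (branch Skip (Push I3 true))).
pose K m := 12 * m + 5 + (ev Pc m + (1 + 5)).
have Htest (a : A) r : run test (st (ser (enc a) ++ r))
    (ser (enc a) ++ r, [::], [::], if c a then [:: true] else [::]) (K (sz a)).
  apply: run_seq (run_dup _ _) (run_seq (Hc a _) _).
  by apply: run_branch; case: (c a); [apply: run_push|apply: run_skip].
have Kmono m n : m <= n -> K m <= K n.
  by move=> mn; rewrite /K; have := ev_mono Pc mn; lia.
exists (Seq ps (Seq test (Loop I3 Skip (Seq pf test)))).
pose KP := PAdd (PAdd (PMul (PC 12) PX) (PC 12)) (PAdd Pc Pf).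
exists (PAdd Ps (PMul (PAdd N (PC 1)) (psubst KP S))) => a0 r.
have := HW a0; cbv zeta; set a := start a0 => -[n [Hn -> Hstop Hgo Hs]].
have Hloop m (i : nat) : m + i = n ->
  run (Loop I3 Skip (Seq pf test)) (ser (enc (iter i f a)) ++ r, [::], [::],
      if c (iter i f a) then [:: true] else [::])
      (st (ser (enc (iter n f a)) ++ r)) (m * ev KP (ev S (sz a0)) + 1).
  elim: m i => [|m IH] i Hi.
    by rewrite add0n in Hi; rewrite Hi Hstop; apply: run_loop_nil.
  rewrite Hgo; last lia.
  have Hsi : sz (iter i f a) <= ev S (sz a0) by apply: Hs; lia.
  have Hsi' : sz (iter i.+1 f a) <= ev S (sz a0) by apply: Hs; lia.
  apply: (@run_weaken _ _ _ ((ev Pf (sz (iter i f a)) + K (sz (iter i.+1 f a))) +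
             (m * ev KP (ev S (sz a0)) + 1)).+1).
    apply: run_loop_cons; [reflexivity| |apply: (IH i.+1); lia].
    exact: run_seq (Hf _ _) (Htest _ _).
  have := Kmono _ _ Hsi'; have := ev_mono Pf Hsi; rewrite /K /=; lia.
apply: run_weaken (run_seq (Hps a0 r) (run_seq (Htest a r) (Hloop n 0 (addn0 n)))) _.
have Ha : sz a <= ev S (sz a0) by apply: (Hs 0).
have HK := Kmono _ _ Ha.
rewrite -[ev (PAdd _ _) _]/(ev Ps (sz a0) + (ev N (sz a0) + 1) * ev (psubst KP S) (sz a0)) ev_subst leq_add2l.
have : (K (ev S (sz a0))).+1 <= ev KP (ev S (sz a0)) by rewrite /K /=; lia.
move: (ev KP _) HK => E; rewrite mulnDl mul1n => HK HE.
have : n * E <= ev N (sz a0) * E by rewrite leq_mul2r Hn orbT.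
lia.
Qed.

Lemma sz_bits (w : seq bool) : sz w <= 4 * size w + 1.
Proof. by elim: w => [|b w IH] //; rewrite sz_cons /=; have := sz_bool b; lia. Qed.

Definition read_in : prog :=
  Seq (pour I0 I1) (Seq (pour I1 I2) (Seq (Push I0 false) (Loop I2
    (Seq (Push I0 false) (Push I0 true))
    (Seq (Push I0 false) (Seq (Push I0 false) (Seq (Push I0 true) (Push I0 true))))))).

Lemma run_read_in w : run read_in (st (rev w)) (st (ser (enc w))) (9 * size w + 4).
Proof.
apply: (@run_weaken _ _ _ ((2 * size w + 1) + ((2 * size w + 1) + (1 + (5 * size w + 1))))); last lia.
apply: run_seq; first by rewrite -[size w]size_rev; apply: run_pour.
rewrite /= revK cats0; apply: run_seq; first exact: run_pour.
rewrite /= cats0; apply: run_seq; first exact: run_push.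
have Hloop (l : seq bool) : run (Loop I2 (Seq (Push I0 false) (Push I0 true))
    (Seq (Push I0 false) (Seq (Push I0 false) (Seq (Push I0 true) (Push I0 true)))))
    (ser (enc l), [::], rev w, [::]) (st (ser (enc (w ++ l)))) (5 * size w + 1).
  elim/last_ind: w l => [|w b IH] l; first exact: run_loop_nil.
  apply: (@run_weaken _ _ _ (4 + (5 * size w + 1)).+1); last by rewrite size_rcons; lia.
  rewrite rev_rcons cat_rcons; apply: run_loop_cons; [reflexivity| |exact: IH].
  case: b; last first.
    apply: (@run_weaken _ _ _ 2) => //; exact: run_seq (run_push _ _ _) (run_push _ _ _).
  exact: run_seq (run_push _ _ _) (run_seq (run_push _ _ _)
    (run_seq (run_push _ _ _) (run_push _ _ _))).
by have := Hloop [::]; rewrite cats0.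
Qed.

Definition write_out : prog :=
  Seq (Loop I0 Skip (Case I0 Skip (Push I1 false)
         (Seq pop0 (Seq pop0 (Push I1 true)))))
      (Seq (pour I1 I2) (pour I2 I0)).

Lemma run_write_out w : run write_out (st (ser (enc w))) (st (rev w)) (11 * size w + 5).
Proof.
have Hloop (l : seq bool) : run (Loop I0 Skip (Case I0 Skip (Push I1 false)
         (Seq pop0 (Seq pop0 (Push I1 true)))))
    (ser (enc w), l, [::], [::]) ([::], rev w ++ l, [::], [::]) (7 * size w + 3).
  elim: w l => [|b w IH] l.
    apply: (run_loop_cons (T1 := 1) (T2 := 1)); [reflexivity|exact: run_skip|].
    exact: run_loop_nil.
  apply: (@run_weaken _ _ _ (6 + (7 * size w + 3)).+1); last by rewrite /=; lia.
  rewrite rev_cons cat_rcons ser_cons; apply: run_loop_cons (IH (b :: l)); [reflexivity|].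
  case: b; last first.
    apply: (@run_weaken _ _ _ 2) => //; apply: run_case; first reflexivity.
    exact: run_push.
  apply: run_case; first reflexivity.
  apply: (run_seq (T1 := 2)); first by apply: run_case; [reflexivity|apply: run_skip].
  apply: (run_seq (T1 := 2)); first by apply: run_case; [reflexivity|apply: run_skip].
  exact: run_push.
apply: (@run_weaken _ _ _ ((7 * size w + 3) + ((2 * size w + 1) + (2 * size w + 1)))); last lia.
apply: run_seq (Hloop [::]) _; rewrite cats0.
apply: run_seq; first by rewrite -[size w]size_rev; apply: run_pour.
rewrite /= revK cats0.
by have := @run_pour I2 I0 ([::], [::], w, [::]) isT; rewrite /= cats0.
Qed.

Lemma PT_computable (f : seq bool -> seq bool) : PT f -> poly_time_computable f.
Proof.
move=> Hf; have [Q HQ] := PT_size Hf; move: Hf => [pf [Pf Hf]].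
pose B := PAdd (PMul (PC 4) PX) (PC 1).
apply: (@exec_computes (Seq read_in (Seq pf write_out)) _
  (PAdd (PAdd (PMul (PC 9) PX) (PC 9)) (PAdd (psubst Pf B) (PMul (PC 11) (psubst Q B))))) => w.
have := Hf w [::]; rewrite !cats0 => H.
have [t [Ht He]] := run_seq (run_read_in w) (run_seq H (run_write_out (f w))).
exists t; split=> //; apply: leq_trans Ht _.
have Hb : sz w <= ev B (size w) by apply: sz_bits.
rewrite /= !ev_subst; have := ev_mono Pf Hb; have := ev_mono Q Hb.
have := HQ w; have : size (f w) < sz (f w) by exact: size_sz.
lia.
Qed.

Lemma PT_decidable (f : seq bool -> bool) : PT f -> in_P (fun w => f w = true).
Proof.
move=> [pf [Pf Hf]]; pose B := PAdd (PMul (PC 4) PX) (PC 1).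
apply: (@exec_decides (Seq read_in pf) _
  (PAdd (PAdd (PMul (PC 9) PX) (PC 4)) (psubst Pf B))) => w.
have := Hf w [::]; rewrite !cats0 => H.
have [t [Ht He]] := run_seq (run_read_in w) H.
exists t, (st (ser (enc (f w)))), (if f w then [:: false; false] else [::]); split=> //.
  apply: leq_trans Ht _.
  have Hb : sz w <= ev B (size w) by apply: sz_bits.
  by rewrite /= !ev_subst; have := ev_mono Pf Hb; lia.
by case: (f w).
Qed.

(** * Bounded iteration and functions on lists *)

Lemma PT_foldl (A C X : encType)
    (l : A -> seq X) (z : A -> C) (f : A -> C -> X -> C) :
  PT l -> PT z -> PT (fun p : A * (C * X) => f p.1 p.2.1 p.2.2) ->
  (exists S, forall a l1 l2, l a = l1 ++ l2 -> sz (foldl (f a) (z a) l1) <= ev S (sz a)) ->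
  PT (fun a => foldl (f a) (z a) (l a)).
Proof.
move=> Hl Hz Hf [S HS].
have [Q HQ] := PT_size Hl.
pose T := (A * (C * seq X))%type.
pose c (p : T) := if p.2.2 is _ :: _ then true else false.
pose g (p : T) := if p.2.2 is x :: t then (p.1, (f p.1 p.2.1 x, t)) else p.
pose start a : T := (a, (z a, l a)).
have Pproj : PT (fun p : T => p.2.2) by exact: PT_comp (PT_snd _ _) (PT_snd _ _).
have Pc : PT c.
  apply: (@PT_seq_case _ _ _ _ (fun _ => false) (fun _ _ _ => true)) => //;
  exact: PT_const.
have Pg : PT g.
  apply: (@PT_seq_case _ _ _ _ (fun p => p)
     (fun p x t => (p.1, (f p.1 p.2.1 x, t)))) => //; first exact: PT_id.
  have P1 : PT (fun p : T * (X * seq X) => p.1)  by exact: PT_fst.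
  have P2 : PT (fun p : T * (X * seq X) => p.2)  by exact: PT_snd.
  have P11 : PT (fun p : T * (X * seq X) => p.1.1) by exact: PT_comp (PT_fst _ _) P1.
  have P12 : PT (fun p : T * (X * seq X) => p.1.2) by exact: PT_comp (PT_snd _ _) P1.
  apply: (PT_pair P11); apply: PT_pair; last exact: PT_comp (PT_snd _ _) P2.
  apply: (PT_comp (f := fun p : T * (X * seq X) => (p.1.1, (p.1.2.1, p.2.1))) Hf).
  apply: (PT_pair P11); apply: PT_pair; last exact: PT_comp (PT_fst _ _) P2.
  exact: PT_comp (PT_fst _ _) P12.
have Ps : PT start by apply: PT_pair (PT_id _) (PT_pair Hz Hl).
have Hit a i : i <= size (l a) ->
    iter i g (start a) = (a, (foldl (f a) (z a) (take i (l a)), drop i (l a))).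
  elim: i => [|i IH] Hi; first by rewrite take0 drop0.
  rewrite iterS IH; last exact: ltnW.
  case E: (l a) Hi => [|x0 la] // Hi; rewrite -E in Hi *.
  by rewrite /g /= (drop_nth x0 Hi) (take_nth x0 Hi) foldl_rcons.
pose W a : T := (a, (foldl (f a) (z a) (l a), [::])).
suff PW : PT W.
  have PW2 : PT (fun a => (W a).2) by exact: (PT_comp (g := fun p : T => p.2) (PT_snd _ _) PW).
  exact: (PT_comp (g := fun p : C * seq X => p.1) (PT_fst _ _) PW2).
apply: (PT_while (N := Q) (S := PAdd (PAdd PX S) (PAdd Q (PC 3))) Ps Pc Pg) => a.
exists (size (l a)); split.
- by apply: leq_trans (HQ a); apply: ltnW; exact: size_sz.
- by rewrite Hit // take_size drop_size.
- by rewrite Hit // /c /= drop_size.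
- move=> i Hi; rewrite Hit; last exact: ltnW.
  by rewrite /c /=; case E: (drop i (l a)) => //; move: (size_drop i (l a)); rewrite E /=; lia.
- move=> i Hi; rewrite Hit // !sz_pair /=.
  have := HS a _ _ (esym (cat_take_drop i (l a))).
  have := @sz_cat _ (take i (l a)) (drop i (l a)); rewrite cat_take_drop.
  have := HQ a; have := @sz_gt0 _ (take i (l a)); lia.
Qed.

(** The usual case: each round adds an amount independent of the accumulator, so growth adds up and
    does not compound. *)
Lemma PT_foldl_grow (A C X : encType)
    (l : A -> seq X) (z : A -> C) (f : A -> C -> X -> C) :
  PT l -> PT z -> PT (fun p : A * (C * X) => f p.1 p.2.1 p.2.2) ->
  (exists S, forall a c x, sz (f a c x) <= sz c + ev S (sz a + sz x)) ->
  PT (fun a => foldl (f a) (z a) (l a)).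
Proof.
move=> Hl Hz Hf [S HS]; apply: PT_foldl => //.
have [Q HQ] := PT_size Hl; have [R HR] := PT_size Hz.
exists (PAdd R (PMul Q (psubst S (PAdd PX Q)))) => a l1 l2 El.
rewrite /= ev_subst /=; set B := ev S _.
have : sz (foldl (f a) (z a) l1) <= sz (z a) + size l1 * B.
  have : forall x l3 l4, l1 = l3 ++ x :: l4 -> ev S (sz a + sz x) <= B.
    move=> x l3 l4 E1; apply: ev_mono; rewrite leq_add2l.
    apply: leq_trans (HQ a); rewrite El E1.
    have := @sz_cat _ (l3 ++ x :: l4) l2; have := sz_cat l3 (x :: l4); rewrite sz_cons.
    by have := @sz_gt0 _ l2; have := @sz_gt0 _ l3; have := @sz_gt0 _ l4; lia.
  elim/last_ind: (l1) => [|l3 x IH] HB; first by rewrite /=; lia.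
  rewrite foldl_rcons size_rcons mulSn; apply: leq_trans (HS _ _ _) _.
  have := HB x l3 [::]; rewrite cats1 => /(_ erefl).
  have : sz (foldl (f a) (z a) l3) <= sz (z a) + size l3 * B.
    by apply: IH => y l5 l6 E; apply: (HB y l5 (rcons l6 x)); rewrite E rcons_cat.
  lia.
have : size l1 <= ev Q (sz a).
  apply: leq_trans (HQ a); rewrite El; have := @size_sz _ (l1 ++ l2); rewrite size_cat; lia.
move=> H1 H2; have := HR a; have : size l1 * B <= ev Q (sz a) * B by rewrite leq_mul2r H1 orbT.
lia.
Qed.

Lemma PT_fst1 (A B C : encType) (f : A -> B * C) : PT f -> PT (fun a => (f a).1).
Proof. exact: (PT_comp (PT_fst _ _)). Qed.

Lemma PT_snd1 (A B C : encType) (f : A -> B * C) : PT f -> PT (fun a => (f a).2).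
Proof. exact: (PT_comp (PT_snd _ _)). Qed.

Lemma PT_and (A : encType) (f g : A -> bool) : PT f -> PT g -> PT (fun a => f a && g a).
Proof. by move=> Hf Hg; apply: (PT_if Hf Hg); apply: PT_const. Qed.

Lemma PT_or (A : encType) (f g : A -> bool) : PT f -> PT g -> PT (fun a => f a || g a).
Proof. by move=> Hf Hg; apply: (PT_if Hf) Hg; apply: PT_const. Qed.

Lemma PT_neg (A : encType) (f : A -> bool) : PT f -> PT (fun a => ~~ f a).
Proof. by move=> Hf; apply: (PT_if Hf); apply: PT_const. Qed.

Lemma PT_eqb (A : encType) (f g : A -> bool) : PT f -> PT g -> PT (fun a => f a == g a).
Proof.
move=> Hf Hg; apply: (@PT_ext _ _ (fun a => if f a then g a else ~~ g a)).
  exact: PT_if Hf Hg (PT_neg Hg).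
by move=> a; case: (f a); case: (g a).
Qed.

Lemma PT_succ (A : encType) (n : A -> nat) : PT n -> PT (fun a => (n a).+1).
Proof. by move=> Hn; apply: PT_enc (PT_pair (PT_const _ tt) Hn) _. Qed.

Lemma PT_nseq (A : encType) (n : A -> nat) : PT n -> PT (fun a => nseq (n a) tt).
Proof.
move=> Hn; apply: PT_enc Hn _ => a; elim: (n a) => // m IH.
by rewrite -[enc (nseq _ _)]/(Nd Lf (enc (nseq m tt))) IH.
Qed.

Lemma PT_size1 (A X : encType) (l : A -> seq X) : PT l -> PT (fun a => size (l a)).
Proof.
move=> Hl; apply: (@PT_ext _ _ (fun a => foldl (fun c _ => c.+1) 0 (l a))).
  apply: (@PT_foldl_grow _ _ _ _ (fun _ => 0) (fun _ c _ => c.+1)) => //.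
  - exact: PT_const.
  - by apply: PT_succ; apply: PT_fst1; apply: PT_snd.
  - by exists (PC 2) => a c x; rewrite !sz_nat /=; lia.
move=> a; rewrite -[LHS]add0n; elim: (l a) 0 => [|x t IH] c /=; first by rewrite addn0.
by rewrite -IH addSnnS.
Qed.

Lemma PT_rev (A X : encType) (l : A -> seq X) : PT l -> PT (fun a => rev (l a)).
Proof.
move=> Hl; apply: (@PT_ext _ _ (fun a => foldl (fun c x => x :: c) [::] (l a))).
  apply: (@PT_foldl_grow _ _ _ _ (fun _ => [::]) (fun _ c x => x :: c)) => //.
  - exact: PT_const.
  - by apply: PT_cons; [apply: PT_snd1|apply: PT_fst1]; apply: PT_snd.
  - by exists (PAdd PX (PC 1)) => a c x; rewrite !sz_cons /=; lia.
by move=> a; rewrite /rev; elim: (l a) [::] => //= x t IH c; rewrite IH.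
Qed.

Lemma PT_cat (A X : encType) (l1 l2 : A -> seq X) : PT l1 -> PT l2 -> PT (fun a => l1 a ++ l2 a).
Proof.
move=> H1 H2; apply: (@PT_ext _ _ (fun a => foldl (fun c x => x :: c) (l2 a) (rev (l1 a)))).
  apply: (@PT_foldl_grow _ _ _ _ l2 (fun _ c x => x :: c)) => //; first exact: PT_rev.
  - by apply: PT_cons; [apply: PT_snd1|apply: PT_fst1]; apply: PT_snd.
  - by exists (PAdd PX (PC 1)) => a c x; rewrite !sz_cons /=; lia.
move=> a; rewrite -{1}[l1 a]revK; elim: (rev (l1 a)) (l2 a) => [|x t IH] l //=.
by rewrite rev_cons cat_rcons IH.
Qed.

Lemma PT_map (A B X : encType) (l : A -> seq X) (f : A -> X -> B) :
  PT l -> PT (fun p : A * X => f p.1 p.2) -> PT (fun a => [seq f a x | x <- l a]).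
Proof.
move=> Hl Hf; have [Q HQ] := PT_size Hf.
apply: (@PT_ext _ _ (fun a => rev (foldl (fun c x => f a x :: c) [::] (l a)))).
  apply: PT_rev; apply: (@PT_foldl_grow _ _ _ _ (fun _ => [::]) (fun a c x => f a x :: c)) => //.
  - exact: PT_const.
  - apply: PT_cons; last by apply: PT_fst1; apply: PT_snd.
    apply: (PT_comp (f := fun p : A * (seq B * X) => (p.1, p.2.2)) Hf).
    by apply: PT_pair (PT_fst _ _) (PT_snd1 (PT_snd _ _)).
  - exists (PAdd (psubst Q (PAdd PX (PC 1))) (PC 1)) => a c x; rewrite sz_cons /= ev_subst.
    by have := HQ (a, x); rewrite sz_pair /= !addn1; lia.
move=> a; have -> c : foldl (fun c x => f a x :: c) c (l a) = rev [seq f a x | x <- l a] ++ c.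
  by elim: (l a) c => //= x t IH c; rewrite IH rev_cons cat_rcons.
by rewrite cats0 revK.
Qed.

Lemma PT_flatten (A X : encType) (l : A -> seq (seq X)) : PT l -> PT (fun a => flatten (l a)).
Proof.
move=> Hl; apply: (@PT_ext _ _ (fun a => foldl (fun c x => c ++ x) [::] (l a))).
  apply: (@PT_foldl_grow _ _ _ _ (fun _ => [::]) (fun _ c x => c ++ x)) => //.
  - exact: PT_const.
  - by apply: PT_cat; [apply: PT_fst1|apply: PT_snd1]; apply: PT_snd.
  - by exists PX => a c x /=; have := sz_cat c x; lia.
move=> a; rewrite -[LHS]cat0s; elim: (l a) [::] => [|x t IH] c /=; first by rewrite cats0.
by rewrite -IH catA.
Qed.

Lemma PT_filter (A X : encType) (l : A -> seq X) (f : A -> X -> bool) :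
  PT l -> PT (fun p : A * X => f p.1 p.2) -> PT (fun a => [seq x <- l a | f a x]).
Proof.
move=> Hl Hf; apply: (@PT_ext _ _ (fun a => flatten [seq if f a x then [:: x] else [::] | x <- l a])).
  apply: PT_flatten; apply: (PT_map (f := fun a x => if f a x then [:: x] else [::])) => //.
  apply: PT_if => //; last exact: PT_const.
  by apply: PT_cons (PT_snd _ _) (PT_const _ _).
by move=> a; elim: (l a) => //= x t ->; case: (f a x).
Qed.

Lemma PT_all (A X : encType) (l : A -> seq X) (f : A -> X -> bool) :
  PT l -> PT (fun p : A * X => f p.1 p.2) -> PT (fun a => all (f a) (l a)).
Proof.
move=> Hl Hf; apply: (@PT_ext _ _ (fun a => foldl (fun c x => c && f a x) true (l a))).
  apply: (@PT_foldl_grow _ _ _ _ (fun _ => true) (fun a c x => c && f a x)) => //.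
  - exact: PT_const.
  - apply: PT_and; first by apply: PT_fst1; apply: PT_snd.
    apply: (PT_comp (f := fun p : A * (bool * X) => (p.1, p.2.2)) Hf).
    by apply: PT_pair (PT_fst _ _) (PT_snd1 (PT_snd _ _)).
  - by exists (PC 3) => a c x; rewrite /=; have := sz_bool (c && f a x); lia.
move=> a; rewrite -[LHS]andTb; elim: (l a) true => [|x t IH] c /=; first by rewrite andbT.
by rewrite -IH andbA.
Qed.

Lemma PT_has (A X : encType) (l : A -> seq X) (f : A -> X -> bool) :
  PT l -> PT (fun p : A * X => f p.1 p.2) -> PT (fun a => has (f a) (l a)).
Proof.
move=> Hl Hf; apply: (@PT_ext _ _ (fun a => ~~ all (fun x => ~~ f a x) (l a))).
  by apply: PT_neg; apply: (PT_all (f := fun a x => ~~ f a x)) => //; apply: PT_neg.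
by move=> a; rewrite -has_predC; apply: eq_has => x /=; rewrite negbK.
Qed.

Lemma PT_ohead (A X B : encType) (l : A -> seq X) (d : A -> B) (h : A -> X -> B) :
  PT l -> PT d -> PT (fun p : A * X => h p.1 p.2) ->
  PT (fun a => if l a is x :: _ then h a x else d a).
Proof.
move=> Hl Hd Hh; apply: (PT_seq_case (h := fun a x _ => h a x)) => //.
apply: (PT_comp (f := fun p : A * (X * seq X) => (p.1, p.2.1)) Hh).
by apply: PT_pair (PT_fst _ _) (PT_fst1 (PT_snd _ _)).
Qed.

Lemma PT_head (A X : encType) (l : A -> seq X) (d : A -> X) :
  PT l -> PT d -> PT (fun a => head (d a) (l a)).
Proof.
by move=> Hl Hd; apply: (PT_ohead (h := fun _ x => x)) => //; apply: PT_snd.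
Qed.

Lemma PT_behead (A X : encType) (l : A -> seq X) : PT l -> PT (fun a => behead (l a)).
Proof.
move=> Hl; apply: (PT_seq_case (g := fun _ => [::]) (h := fun _ _ t => t)) => //.
  exact: PT_const.
by apply: PT_snd1; apply: PT_snd.
Qed.

Lemma PT_iter (A C : encType) (n : A -> nat) (f : A -> C -> C) (z : A -> C) :
  PT n -> PT z -> PT (fun p : A * C => f p.1 p.2) ->
  (exists S, forall a c, sz (f a c) <= sz c + ev S (sz a)) ->
  PT (fun a => iter (n a) (f a) (z a)).
Proof.
move=> Hn Hz Hf [S HS].
apply: (@PT_ext _ _ (fun a => foldl (fun c _ => f a c) (z a) (nseq (n a) tt))).
  apply: (@PT_foldl_grow _ _ _ _ z (fun a c _ => f a c)) => //; first exact: PT_nseq.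
  - apply: (PT_comp (f := fun p : A * (C * unit) => (p.1, p.2.1)) Hf).
    by apply: PT_pair (PT_fst _ _) (PT_fst1 (PT_snd _ _)).
  - by exists S => a c x; apply: leq_trans (HS a c) _; rewrite leq_add2l; apply: ev_mono; lia.
by move=> a; elim: (n a) (z a) => // m IH c; rewrite iterSr IH.
Qed.

Lemma PT_pred (A : encType) (n : A -> nat) : PT n -> PT (fun a => (n a).-1).
Proof.
move=> Hn; apply: (@PT_ext _ _ (fun a => size (behead (nseq (n a) tt)))).
  by apply: PT_size1; apply: PT_behead; apply: PT_nseq.
by move=> a; rewrite size_behead size_nseq.
Qed.

Lemma PT_add (A : encType) (m n : A -> nat) : PT m -> PT n -> PT (fun a => m a + n a).
Proof.
move=> Hm Hn; apply: (@PT_ext _ _ (fun a => iter (m a) (fun c => c.+1) (n a))).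
  apply: (PT_iter (f := fun _ c => c.+1)) => //; first by apply: PT_succ; apply: PT_snd.
  by exists (PC 2) => a c; rewrite !sz_nat /=; lia.
by move=> a; elim: (m a) => //= k <-; rewrite addSn.
Qed.

Lemma PT_sub (A : encType) (m n : A -> nat) : PT m -> PT n -> PT (fun a => m a - n a).
Proof.
move=> Hm Hn; apply: (@PT_ext _ _ (fun a => iter (n a) (fun c => c.-1) (m a))).
  apply: (PT_iter (f := fun _ c => c.-1)) => //; first by apply: PT_pred; apply: PT_snd.
  by exists (PC 0) => a c; rewrite !sz_nat /=; lia.
by move=> a; elim: (n a) => [|k /= <-]; rewrite ?subn0 // subnS.
Qed.

Lemma PT_mul (A : encType) (m n : A -> nat) : PT m -> PT n -> PT (fun a => m a * n a).
Proof.
move=> Hm Hn; have [Q HQ] := PT_size Hn.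
apply: (@PT_ext _ _ (fun a => iter (m a) (addn (n a)) 0)).
  apply: (PT_iter (f := fun a c => n a + c) (z := fun _ => 0)) => //; first exact: PT_const.
    by apply: PT_add; [exact: PT_comp Hn (PT_fst _ _)|apply: PT_snd].
  by exists Q => a c; have := HQ a; rewrite !sz_nat /=; lia.
by move=> a; rewrite iter_addn_0 mulnC.
Qed.

Lemma PT_leq (A : encType) (m n : A -> nat) : PT m -> PT n -> PT (fun a => m a <= n a).
Proof.
move=> Hm Hn; apply: (@PT_ext _ _ (fun a => if nseq (m a - n a) tt is _ :: _ then false else true)).
  apply: (PT_ohead (d := fun _ => true) (h := fun _ _ => false)).
  - by apply: PT_nseq; apply: PT_sub.
  - exact: PT_const.
  - exact: PT_const.
by move=> a; rewrite -subn_eq0; case: (m a - n a).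
Qed.

Lemma PT_eqn (A : encType) (m n : A -> nat) : PT m -> PT n -> PT (fun a => m a == n a).
Proof.
move=> Hm Hn; apply: (@PT_ext _ _ (fun a => (m a <= n a) && (n a <= m a))).
  by apply: PT_and; apply: PT_leq.
by move=> a; rewrite eqn_leq.
Qed.

Lemma PT_ev (A : encType) (P : pexp) (n : A -> nat) : PT n -> PT (fun a => ev P (n a)).
Proof.
by move=> Hn; elim: P => //= [c|p Hp q Hq|p Hp q Hq]; [exact: PT_const|exact: PT_add|exact: PT_mul].
Qed.

Lemma PT_iota (A : encType) (n : A -> nat) : PT n -> PT (fun a => iota 0 (n a)).
Proof.
move=> Hn; have [Q HQ] := PT_size Hn.
have E (l : seq unit) : foldl (fun c _ => size c :: c) [::] l = rev (iota 0 (size l)).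
  elim/last_ind: l => [|l x IH] //.
  by rewrite foldl_rcons IH size_rcons size_rev size_iota -addn1 iotaD add0n rev_cat.
(* The number pushed grows with the accumulator, so [PT_foldl_grow] does not apply and the prefixes
   are bounded directly. *)
apply: (@PT_ext _ _ (fun a => rev (foldl (fun c _ => size c :: c) [::] (nseq (n a) tt)))).
  apply: PT_rev; apply: (PT_foldl (z := fun _ => [::]) (f := fun _ c _ => size c :: c)).
  - exact: PT_nseq.
  - exact: PT_const.
  - by apply: PT_cons; rewrite /=; [apply: PT_size1|]; apply: PT_fst1; apply: PT_snd.
  - exists (PAdd (PC 1) (PMul Q (PAdd Q (PC 1)))) => a l1 l2 El; rewrite E.
    have Hl1 : size l1 <= n a by rewrite -(size_nseq (n a) tt) El size_cat leq_addr.
    have Hs : sz (rev (iota 0 (size l1))) <= 1 + size l1 * (2 * size l1 + 1).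
      rewrite -E; elim/last_ind: (l1) => [|l x IH] //.
      move: IH; rewrite foldl_rcons sz_cons sz_nat size_rcons E size_rev size_iota.
      by move: (sz _) => k; move: (size l) => m H; nia.
    apply: leq_trans Hs _; rewrite /= leq_add2l.
    have := HQ a; rewrite sz_nat => HQa; apply: leq_mul; rewrite ?leq_add2r.
      by apply: leq_trans Hl1 _; lia.
    by apply: leq_trans (leq_mul (leqnn 2) Hl1) _; lia.
by move=> a; rewrite E revK size_nseq.
Qed.

Lemma PT_nth (A X : encType) (d : A -> X) (l : A -> seq X) (i : A -> nat) :
  PT d -> PT l -> PT i -> PT (fun a => nth (d a) (l a) (i a)).
Proof.
move=> Hd Hl Hi; apply: (@PT_ext _ _ (fun a => head (d a) (iter (i a) behead (l a)))).
  apply: PT_head => //; apply: (PT_iter (f := fun _ c => behead c)) => //.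
    by apply: PT_behead; apply: PT_snd.
  by exists (PC 0) => a [|x c]; rewrite /= ?sz_cons addn0 //; lia.
by move=> a; elim: (i a) (l a) => [|k IH] [|x t] //; rewrite iterSr //= -IH ?nth_nil.
Qed.

(* Redefined below whenever new functions are shown to be polynomial. *)
Ltac pt_ext := fail.

Ltac pt_step :=
  cbv beta;
  lazymatch goal with
  | |- PT (fun a => a) => exact: PT_id
  | |- PT (fun _ => ?c) => exact: PT_const
  | |- PT fst => exact: PT_fst
  | |- PT snd => exact: PT_snd
  | |- PT (fun a => fst (@?f a)) => apply: (PT_fst1 (f := f))
  | |- PT (fun a => snd (@?f a)) => apply: (PT_snd1 (f := f))
  | |- PT (fun a => pair (@?f a) (@?g a)) => apply: (PT_pair (f := f) (g := g))
  | |- PT (fun a => cons (@?f a) (@?g a)) => apply: (PT_cons (f := f) (g := g))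
  | |- PT (fun a => andb (@?f a) (@?g a)) => apply: (PT_and (f := f) (g := g))
  | |- PT (fun a => orb (@?f a) (@?g a)) => apply: (PT_or (f := f) (g := g))
  | |- PT (fun a => negb (@?f a)) => apply: (PT_neg (f := f))
  | |- PT (fun a => S (@?f a)) => apply: (PT_succ (n := f))
  | |- PT (fun a => Nat.pred (@?f a)) => apply: (PT_pred (n := f))
  | |- PT (fun a => addn (@?f a) (@?g a)) => apply: (PT_add (m := f) (n := g))
  | |- PT (fun a => subn (@?f a) (@?g a)) => apply: (PT_sub (m := f) (n := g))
  | |- PT (fun a => muln (@?f a) (@?g a)) => apply: (PT_mul (m := f) (n := g))
  | |- PT (fun a => leq (@?f a) (@?g a)) => apply: (PT_leq (m := f) (n := g))
  | |- PT (fun a => @eq_op Datatypes_nat__canonical__eqtype_Equality (@?f a) (@?g a)) =>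
      apply: (PT_eqn (m := f) (n := g))
  | |- PT (fun a => @eq_op Datatypes_bool__canonical__eqtype_Equality (@?f a) (@?g a)) =>
      apply: (PT_eqb (f := f) (g := g))
  | |- PT (fun a => size (@?f a)) => apply: (PT_size1 (l := f))
  | |- PT (fun a => rev (@?f a)) => apply: (PT_rev (l := f))
  | |- PT (fun a => cat (@?f a) (@?g a)) => apply: (PT_cat (l1 := f) (l2 := g))
  | |- PT (fun a => flatten (@?f a)) => apply: (PT_flatten (l := f))
  | |- PT (fun a => behead (@?f a)) => apply: (PT_behead (l := f))
  | |- PT (fun a => head (@?d a) (@?f a)) => apply: (PT_head (d := d) (l := f))
  | |- PT (fun a => nth (@?d a) (@?f a) (@?i a)) => apply: (PT_nth (d := d) (l := f) (i := i))
  | |- PT (fun a => iota 0 (@?f a)) => apply: (PT_iota (n := f))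
  | |- PT (fun a => map (fun x => @?h a x) (@?l a)) => apply: (PT_map (l := l) (f := h))
  | |- PT (fun a => filter (fun x => @?h a x) (@?l a)) => apply: (PT_filter (l := l) (f := h))
  | |- PT (fun a => all (fun x => @?h a x) (@?l a)) => apply: (PT_all (l := l) (f := h))
  | |- PT (fun a => has (fun x => @?h a x) (@?l a)) => apply: (PT_has (l := l) (f := h))
  | |- PT (fun a => if _ then _ else _) => apply: PT_if
  | |- _ => first [assumption | pt_ext
      | match goal with H : PT ?f |- PT (fun a => ?f (@?g a)) => apply: (PT_comp (f := g) H) end]
  end.

Ltac pt := repeat pt_step.


(** * The chess gadget *)

(* [LS k]: bishop of variable k; [LO i j]: literal j of clause i; [LH i j]:
   rook able to clear one of the literals j and j+1 of clause i; [LE i j]: exit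
   of a rook having cleared literal j; [LX k s]: end of the track of the literal
   of variable k and sign s.  The rook at [LR] collects the [LX] up to [LC], the
   bishop at [LB] collects the [LE] up to [LZ], where both meet. *)
Inductive lab :=
  | LS of nat | LO of nat & nat | LH of nat & nat | LE of nat & nat
  | LX of nat & bool | LR | LC | LB | LZ.

Lemma lab_dec (l l' : lab) : {l = l'} + {l <> l'}.
Proof. decide equality; try exact: PeanoNat.Nat.eq_dec; exact: Bool.bool_dec. Qed.

Definition piece_of (l : lab) : piece :=
  match l with
  | LS _ | LB => Bishop
  | LH _ _ | LR => Rook
  | _ => Pawn
  end.

Section Gadget.
Context (n m : nat) (sg : nat -> nat -> bool) (vr : nat -> nat -> nat).
Context (vr_lt : forall i j, i < m -> j < 4 -> vr i j < n).

Definition valid (l : lab) : Prop :=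
  match l with
  | LS k => k < n
  | LO i j | LE i j => i < m /\ j < 4
  | LH i j => i < m /\ j < 3
  | LX k _ => k < n
  | _ => True
  end.

(** One even column per literal; [xL] is the column after all of them. *)
Definition xcol (i j : nat) : nat := 8 * i + 2 * j + 2.
Definition xL : nat := 8 * m + 2.
(** The homes [qv k] are [8 * xL] rows apart while a track deviates from its home row by at most
    [xL], so no row or diagonal meets the tracks of two variables. Homes are written as twice [qh]
    to make them visibly even. *)
Definition qh (k : nat) : nat := 4 * xL * k.+1.
Definition qv (k : nat) : nat := 2 * qh k.
(** The exits stand at [(xK + y, y)]: each keeps the row of its literal, all share one diagonal and
    no two share a column. The shift exceeds every row in use, so no diagonal links the exits with
    the tracks. *)
Definition xK : nat := 2 * qh n.+1.

(** Positive literals lie on the rising diagonal through the home square, negative ones on the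
    falling one; for valid indices the subtraction does not truncate. *)
Definition yrow (i j : nat) : nat :=
  if sg i j then qv (vr i j) + xcol i j else qv (vr i j) - xcol i j.

Definition px (l : lab) : nat :=
  match l with
  | LS _ => 0
  | LO i j | LH i j => xcol i j
  | LE i j => xK + yrow i j
  | LX _ _ | LR | LC => xL
  | LB => xK + 2
  | LZ => xK + qv n
  end.

Definition py (l : lab) : nat :=
  match l with
  | LS k => qv k
  | LO i j | LE i j => yrow i j
  | LH i j => yrow i j.+1
  | LX k s => if s then qv k + xL else qv k - xL
  | LR => 0
  | LC | LZ => qv n
  | LB => 2
  end.

Definition pos (l : lab) : square := (Z.of_nat (px l), Z.of_nat (py l)).

(** [qh] is nonlinear, so [lia] is given only its gaps, by this and the next two lemmas. *)
Lemma q_cases k k' : (k = k' /\ qh k = qh k') \/ (qh k + 4 * xL <= qh k' \/ qh k' + 4 * xL <= qh k).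
Proof.
rewrite /qh; case: (ltngtP k k') => H; [right; left|right; right|by left; rewrite H];
  rewrite addnC -mulnS leq_mul2l; lia.
Qed.

Lemma q_low k : 4 * xL <= qh k.
Proof. by rewrite /qh mulnS leq_addr. Qed.

Lemma q_lt k k' : k < k' -> qh k + 4 * xL <= qh k'.
Proof. by case: (q_cases k k') => [[-> _]|[]]; rewrite /qh ?ltnn //; nia. Qed.

Lemma xcol_bounds i j : i < m -> j < 4 -> 2 <= xcol i j <= 8 * m.
Proof. rewrite /xcol; lia. Qed.

Lemma vfacts4 i j : i < m /\ j < 4 -> [/\ i < m, j < 4, vr i j < n & 2 <= xcol i j <= 8 * m].
Proof. by case=> Hi Hj; split=> //; [apply: vr_lt|apply: xcol_bounds]. Qed.

Lemma vfacts3 i j : i < m /\ j < 3 -> [/\ i < m, j < 3, vr i j.+1 < n,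
  2 <= xcol i j <= 8 * m & xcol i j.+1 = xcol i j + 2 /\ xcol i j + 2 <= 8 * m].
Proof. by case=> Hi Hj; split=> //; [apply: vr_lt|apply: xcol_bounds|]; rewrite /xcol; lia. Qed.

Ltac qfacts :=
  repeat match goal with
  | H : is_true (?i < m) /\ is_true (?j < 4) |- _ => let K := fresh in have K := vfacts4 H; clear H; destruct K
  | H : is_true (?i < m) /\ is_true (?j < 3) |- _ => let K := fresh in have K := vfacts3 H; clear H; destruct K as [? ? ? ? [? ?]]
  end;
  repeat match goal with
  | H : is_true (?k < n) |- _ =>
      lazymatch goal with K : is_true (qh k + 4 * xL <= qh n) |- _ => fail
      | _ => have := q_lt H; intro; have := q_low k; intro end
  end;
  have := q_lt (ltnSn n); intro; have := q_low n; intro;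
  repeat match goal with
  | H : is_true (?k < n), H' : is_true (?k' < n) |- _ =>
      lazymatch k with k' => fail | _ => idtac end;
      lazymatch goal with
      | K : (k = k' /\ _) \/ _ |- _ => fail
      | K : (k' = k /\ _) \/ _ |- _ => fail
      | _ => have := q_cases k k'; intro end
  end.

Ltac geo :=
  intros; cbv [px py yrow qv xK valid] in *; qfacts;
  assert (xL = 8 * m + 2) by reflexivity;
  repeat match goal with H : _ \/ (_ \/ _) |- _ =>
     case: H => [[? ?]|[?|?]] end;
  repeat match goal with
  | |- context [if ?b then _ else _] => destruct b eqn:?
  | H : context [if ?b then _ else _] |- _ => destruct b eqn:?
  end;
  first [lia | unfold xcol in *; lia].

Lemma xcol_inj i j i' j' : j < 4 -> j' < 4 -> xcol i j = xcol i' j' -> i = i' /\ j = j'.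
Proof. rewrite /xcol; lia. Qed.

Lemma yrow_inj i j i' j' : valid (LO i j) -> valid (LO i' j') ->
  yrow i j = yrow i' j' -> i = i' /\ j = j'.
Proof.
move=> H H' E; suff : xcol i j = xcol i' j' by apply: xcol_inj; [case: H|case: H'].
by move: E; rewrite /yrow; geo.
Qed.

Lemma pos_inj l l' : valid l -> valid l' -> px l = px l' -> py l = py l' -> l = l'.
Proof.
case: l => [k|i j|i j|i j|k s||||]; case: l' => [k'|i' j'|i' j'|i' j'|k' s'||||];
  intros; try done; try (exfalso; geo).
- suff -> : k = k' by []; geo.
- have [-> -> //] : i = i' /\ j = j' by apply: yrow_inj.
- have [] : i = i' /\ j.+1 = j'.+1 by apply: yrow_inj.
  by move=> -> [->].
- have [-> -> //] : i = i' /\ j = j' by apply: yrow_inj.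
- suff [-> ->] : k = k' /\ s = s' by []; geo.
Qed.

(** The squares on which a rook may ever stand: they are closed under [rnext], which admits every
    aligned square whatever stands in between. *)
Definition rzone (l : lab) : Prop :=
  match l with LS _ | LB => False | _ => True end.

Definition rnext (l l' : lab) : Prop :=
  match l, l' with
  | LH i j, LO i' j' => i' = i /\ (j' = j \/ j' = j.+1)
  | LH i j, LE i' j' => i' = i /\ j' = j.+1
  | LO i j, LE i' j' => i' = i /\ j' = j
  | LO i j, LH i' j' => i' = i /\ (j = j' \/ j = j'.+1)
  | LE i j, LO i' j' => i' = i /\ j' = j
  | LE i j, LH i' j' => i' = i /\ j = j'.+1
  | LX _ _, LX _ _ | LX _ _, LR | LX _ _, LC | LR, LX _ _ | LR, LC
  | LC, LX _ _ | LC, LR | LC, LZ | LZ, LC => True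
  | _, _ => False
  end.

Lemma rook_next l l' : valid l -> valid l' -> l <> l' -> rzone l ->
  px l = px l' \/ py l = py l' -> rnext l l'.
Proof.
case: l => [k|i j|i j|i j|k s||||] //; case: l' => [k'|i' j'|i' j'|i' j'|k' s'||||] //;
  intros V V' N _ [E|E]; rewrite /rnext;
  try done; try (exfalso; geo); try geo.
- have [Ei Ej] : i = i' /\ j = j' by apply: xcol_inj; [case: V|case: V'|].
  by apply: N; rewrite Ei Ej.
- have [Ei Ej] : i = i' /\ j = j' by apply: yrow_inj.
  by apply: N; rewrite Ei Ej.
- have [Ei Ej] : i = i' /\ j = j' by apply: xcol_inj; [case: V => _ /ltnW|case: V' => _ /ltnW|].
  by apply: N; rewrite Ei Ej.
- have [Ei [Ej]] : i = i' /\ j.+1 = j'.+1 by apply: yrow_inj.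
  by apply: N; rewrite Ei Ej.
- have [Ei Ej] : i = i' /\ j = j' by apply: yrow_inj => //; move: E => /addnI.
  by apply: N; rewrite Ei Ej.
- have [Ei Ej] : i = i' /\ j = j' by apply: yrow_inj.
  by apply: N; rewrite Ei Ej.
Qed.

(** From a literal a bishop meets only the home and the track of that literal; the diagonal of the
    exits is a world of its own. *)
Definition bnext (l l' : lab) : Prop :=
  match l, l' with
  | LS k, LO i j => vr i j = k
  | LS k, LX k' s => k' = k
  | LO i j, LS k => vr i j = k
  | LO i j, LO i' j' => vr i' j' = vr i j /\ sg i' j' = sg i j
  | LO i j, LX k s => k = vr i j /\ s = sg i j
  | LX k s, LS k' => k' = k
  | LX k s, LO i j => vr i j = k /\ sg i j = s
  | LE _ _, LE _ _ | LE _ _, LB | LE _ _, LZ | LB, LE _ _ | LB, LZ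
  | LZ, LE _ _ | LZ, LB => True
  | _, _ => False
  end.

Definition bzone (l : lab) : Prop :=
  match l with LS _ | LO _ _ | LX _ _ | LE _ _ | LB | LZ => True | _ => False end.

Lemma bishop_next l l' : valid l -> valid l' -> l <> l' -> bzone l ->
  px l + py l' = px l' + py l \/ px l + py l = px l' + py l' -> bnext l l'.
Proof.
case: l => [k|i j|i j|i j|k s||||] //; case: l' => [k'|i' j'|i' j'|i' j'|k' s'||||] //;
  intros V V' N _ [E|E]; rewrite /bnext; try done; try (exfalso; geo); try geo.
- by apply: N; suff -> : k = k' by []; geo.
- by apply: N; suff -> : k = k' by []; geo.
- by apply: N; suff [-> ->] : k = k' /\ s = s' by []; geo.
- by apply: N; suff [-> ->] : k = k' /\ s = s' by []; geo.
Qed.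

End Gadget.

(** * Positions as maps on labels, and the invariant of play *)

Section Boards.
Context (n m : nat) (sg : nat -> nat -> bool) (vr : nat -> nat -> nat).
Context (vr_lt : forall i j, i < m -> j < 4 -> vr i j < n).

Local Notation pX := (px n m sg vr).
Local Notation pY := (py n m sg vr).
Local Notation pP := (pos n m sg vr).
Local Notation vd := (valid n m).

Lemma posE l l' : vd l -> vd l' -> pP l = pP l' -> l = l'.
Proof.
move=> V V' [] /Nat2Z.inj Ex /Nat2Z.inj Ey.
exact: (pos_inj vr_lt V V' Ex Ey).
Qed.

Definition depicts (s : board) (g : lab -> option piece) : Prop :=
  List.NoDup (map snd s) /\
  forall p a, List.In (p, a) s <-> exists l, [/\ vd l, a = pP l & g l = Some p].

Definition gmove (g : lab -> option piece) (l1 l2 l : lab) : option piece :=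
  if lab_dec l l1 then None else if lab_dec l l2 then g l1 else g l.

Lemma gmoveE g l1 l2 l : l1 <> l2 ->
  [\/ l = l1 /\ gmove g l1 l2 l = None, l = l2 /\ gmove g l1 l2 l = g l1
    | [/\ l <> l1, l <> l2 & gmove g l1 l2 l = g l]].
Proof.
move=> N; rewrite /gmove; destruct (lab_dec l l1) as [E|N1]; first by constructor 1.
by destruct (lab_dec l l2) as [E|N2]; [constructor 2|constructor 3].
Qed.

Lemma depicts_occ s g l : depicts s g -> vd l -> occupied s (pP l) <-> g l <> None.
Proof.
move=> [_ H] V; split=> [[p /H [l' [V' E Hg]]]|].
  by rewrite (posE V V' E) Hg.
by case E: (g l) => [p|] // _; exists p; apply/H; exists l.
Qed.

Lemma depicts_perm_move s g p p2 l1 l2 rest :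
  depicts s g -> vd l1 -> vd l2 -> l1 <> l2 -> g l1 = Some p ->
  Permutation s ((p, pP l1) :: (p2, pP l2) :: rest) ->
  depicts ((p, pP l2) :: rest) (gmove g l1 l2).
Proof.
move=> [ND H] V1 V2 N Hg1 HP.
have /= ND1 := Permutation_NoDup (Permutation_map snd HP) ND.
have [Hn1 /List.NoDup_cons_iff [Hn2 ND']] := (List.NoDup_cons_iff _ _).1 ND1; split.
  by apply/List.NoDup_cons_iff.
have Hs q x : List.In (q, x) rest -> List.In (q, x) s.
  by move=> Hin; apply: Permutation_in (Permutation_sym HP) _; right; right.
have Hsnd q x : List.In (q, x) rest -> List.In x (map snd rest).
  by move=> Hin; apply: (List.in_map snd rest (q, x)).
move=> q x; split.
- case=> [[Ep Ex]|Hin].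
    exists l2; split=> //; have [[E _]|[_ ->]|[_ /(_ erefl) []]] := gmoveE g l2 N.
      by case: N.
    by rewrite Hg1 Ep.
  have [l [V E Hg]] := (H q x).1 (Hs _ _ Hin); have Hx := Hsnd _ _ Hin.
  exists l; split=> //; have [[E1 _]|[E2 _]|[_ _ ->]] // := gmoveE g l N.
    by case: Hn1; right; rewrite -E1 -E.
  by case: Hn2; rewrite -E2 -E.
- case=> l [V Ex]; have [[_ ->]|[E ->]|[N1 N2 ->]] // := gmoveE g l N => Hg.
    by left; move: Hg; rewrite Ex E Hg1 => -[->].
  have Hin : List.In (q, x) s by apply/H; exists l.
  have [[_ E]|[[_ E]|Hin']] := Permutation_in _ HP Hin; last by right.
    by case: N1; apply: posE; rewrite // -Ex.
  by case: N2; apply: posE; rewrite // -Ex.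
Qed.

(** A capture needs an occupied target, so play never leaves the labelled squares. *)
Lemma depicts_move s g s' : depicts s g -> chess_move s s' ->
  exists l1 l2 p, [/\ vd l1 /\ vd l2, l1 <> l2, g l1 = Some p, g l2 <> None &
    can_capture s p (pP l1) (pP l2) /\ depicts s' (gmove g l1 l2)].
Proof.
move=> R [k1 [a [k2 [b [rest [ab [HP [Hc Es']]]]]]]]; have [_ H] := R.
have [l1 [V1 E1 G1]] : exists l, [/\ vd l, a = pP l & g l = Some k1].
  by apply/H; apply: Permutation_in (Permutation_sym HP) _; left.
have [l2 [V2 E2 G2]] : exists l, [/\ vd l, b = pP l & g l = Some k2].
  by apply/H; apply: Permutation_in (Permutation_sym HP) _; right; left.
have N : l1 <> l2 by move=> E; apply: ab; rewrite E1 E2 E.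
exists l1, l2, k1; split=> //; first by rewrite G2.
by move: HP Hc; rewrite Es' E1 E2 => HP Hc; split=> //; apply: depicts_perm_move HP.
Qed.

Lemma depicts_step s g l1 l2 p : depicts s g -> vd l1 -> vd l2 -> l1 <> l2 ->
  g l1 = Some p -> g l2 <> None -> can_capture s p (pP l1) (pP l2) ->
  exists s', chess_move s s' /\ depicts s' (gmove g l1 l2).
Proof.
move=> R V1 V2 N G1; case G2: (g l2) => [p2|] // _ Hc; have [_ H] := R.
have H1 : List.In (p, pP l1) s by apply/H; exists l1.
have H2 : List.In (p2, pP l2) s by apply/H; exists l2.
have [A [B E]] := List.in_split _ _ H1.
have H2' : List.In (p2, pP l2) (A ++ B)%list.
  move: H2; rewrite E => /List.in_app_iff[Hin|[E2|Hin]]; apply: (proj2 (List.in_app_iff _ _ _)).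
  - by left.
  - by case: N; apply: posE => //; exact: (congr1 snd E2).
  - by right.
have [A' [B' E']] := List.in_split _ _ H2'.
have HP : Permutation s ((p, pP l1) :: (p2, pP l2) :: (A' ++ B')%list).
  rewrite E; apply: Permutation_trans (Permutation_sym (Permutation_middle _ _ _)) _.
  apply: perm_skip; rewrite E'; exact: Permutation_sym (Permutation_middle _ _ _).
exists ((p, pP l2) :: (A' ++ B')%list); split; last exact: depicts_perm_move HP.
exists p, (pP l1), p2, (pP l2), (A' ++ B')%list; split=> //.
by move=> /(posE V1 V2).
Qed.

Lemma px_even l : exists h, pX l = 2 * h.
Proof.
have Hx i j : exists h, xcol i j = 2 * h by exists (4 * i + j + 1); rewrite /xcol; lia.
have Hy i j : exists h, yrow m sg vr i j = 2 * h.
  have [h Eh] := Hx i j; rewrite /yrow /qv Eh; case: ifP => _.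
    by exists (qh m (vr i j) + h); lia.
  by exists (qh m (vr i j) - h); lia.
case: l => [k|i j|i j|i j|k s||||] /=; try exact: Hx;
  try (by exists (4 * m + 1); rewrite /xL; lia).
- by exists 0.
- by have [h ->] := Hy i j; exists (qh m n.+1 + h); rewrite /xK; lia.
- by exists (qh m n.+1 + 1); rewrite /xK; lia.
- by exists (qh m n.+1 + qh m n); rewrite /xK /qv; lia.
Qed.

Lemma rook_capture s l l' : vd l -> vd l' -> l <> l' -> rzone l ->
  can_capture s Rook (pP l) (pP l') -> rnext l l'.
Proof.
move=> V V' N Z [Hl _]; apply: (rook_next (sg := sg) vr_lt V V' N Z).
by case: Hl => /Nat2Z.inj E; [left|right].
Qed.

Lemma bishop_capture s l l' : vd l -> vd l' -> l <> l' -> bzone l ->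
  can_capture s Bishop (pP l) (pP l') -> bnext sg vr l l'.
Proof.
move=> V V' N Z [Hl _]; apply: (bishop_next vr_lt V V' N Z).
by move: Hl; rewrite /bishop_line /pos; cbn [fst snd]; lia.
Qed.

(** Parity of the columns is enough, since a pawn captures on an adjacent column. *)
Lemma pawn_capture s l l' : ~ can_capture s Pawn (pP l) (pP l').
Proof.
case=> H _; have [h E] := px_even l; have [h' E'] := px_even l'.
by move: H; rewrite /pos; cbn [fst snd]; rewrite E E'; lia.
Qed.

Definition ok_piece (al : nat -> option bool) (p : piece) (l : lab) : Prop :=
  match p with
  | Pawn => True
  | Rook => rzone l
  | Bishop =>
      match l with
      | LO i j => al (vr i j) = Some (sg i j)
      | LX k s => al k = Some s
      | _ => bzone l
      end
  | _ => False
  end.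

Definition pawn_at (g : lab -> option piece) (i j : nat) : nat :=
  if g (LO i j) is Some Pawn then 1 else 0.
Definition rook_at (g : lab -> option piece) (i j : nat) : nat :=
  if g (LH i j) is Some _ then 1 else 0.

(* Each literal cleared by rooks costs a helper, so the literals outnumber the
   helpers until a bishop takes one of them. *)
Definition clause_inv (al : nat -> option bool) (g : lab -> option piece) (i : nat) : Prop :=
  (exists2 j, j < 4 & al (vr i j) = Some (sg i j)) \/
  rook_at g i 0 + rook_at g i 1 + rook_at g i 2 <
  pawn_at g i 0 + pawn_at g i 1 + pawn_at g i 2 + pawn_at g i 3.

(* [al] records the direction already taken by the bishops that have left their
   home square. *)
Definition play_inv (al : nat -> option bool) (g : lab -> option piece) : Prop :=
  [/\ forall l p, vd l -> g l = Some p -> ok_piece al p l,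
      forall k, k < n -> g (LS k) <> None -> al k = None,
      forall i j, i < m -> j < 4 -> g (LE i j) = Some Rook -> g (LO i j) = None,
      forall i, i < m -> clause_inv al g i
    & exists l p, [/\ vd l, g l = Some p & p <> Pawn]].

Lemma pawn_at_gmove g l1 l2 p i j : l1 <> l2 -> g l1 = Some p -> p <> Pawn ->
  l2 <> LO i j -> pawn_at (gmove g l1 l2) i j = pawn_at g i j.
Proof.
move=> N G Np H2; rewrite /pawn_at.
have [[E ->]|[E _]|[_ _ ->]] // := gmoveE g (LO i j) N; last by case: H2.
by rewrite E G; case: (p) Np.
Qed.

Lemma rook_at_gmove g l1 l2 i j : l1 <> l2 -> g l2 <> None ->
  rook_at (gmove g l1 l2) i j <= rook_at g i j.
Proof.
move=> N G2; rewrite /rook_at.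
have [[E ->]|[E ->]|[_ _ ->]] // := gmoveE g (LH i j) N.
by rewrite E; case: (g l2) G2 => // q _; case: (g l1).
Qed.

Lemma rook_at_left g l1 l2 p i j : l1 <> l2 -> g l1 = Some p -> l1 = LH i j ->
  rook_at (gmove g l1 l2) i j = 0 /\ rook_at g i j = 1.
Proof.
move=> N G E; rewrite /rook_at -E G; split=> //.
by have [[_ ->]|[/N []]|[[]]] := gmoveE g l1 N.
Qed.

Lemma clause_inv_other al g l1 l2 p i : l1 <> l2 -> g l1 = Some p -> p <> Pawn ->
  g l2 <> None -> (forall j, l2 <> LO i j) -> clause_inv al g i ->
  clause_inv al (gmove g l1 l2) i.
Proof.
move=> N G Np G2 H2 [?|H]; [by left|right].
have Hp j := pawn_at_gmove N G Np (H2 j); have Hr j := rook_at_gmove i j N G2.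
have := Hr 0; have := Hr 1; have := Hr 2; rewrite !Hp; lia.
Qed.

Lemma clause_inv_helper al g i j j' : j < 3 -> j' = j \/ j' = j.+1 ->
  g (LH i j) = Some Rook -> g (LO i j') <> None -> clause_inv al g i ->
  clause_inv al (gmove g (LH i j) (LO i j')) i.
Proof.
move=> j3 Hj' G G2 [?|H]; [by left|right].
have N : LH i j <> LO i j' by [].
have Hp k : pawn_at g i k <= pawn_at (gmove g (LH i j) (LO i j')) i k + (k == j').
  case: eqP => [_|E]; first by rewrite {1}/pawn_at; case: (g _) => [[]|]; lia.
  by rewrite (pawn_at_gmove N G) ?addn0 // => -[E']; case: E.
have Hr k := rook_at_gmove i k N G2.
have [Hr1 Hr2] := rook_at_left N G erefl.
by case: Hj' => Ej; subst j'; case: j j3 G G2 N Hp Hr Hr1 Hr2 => [|[|[|//]]] _ _ _ _ Hp Hr Hr1 Hr2;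
  move: (Hp 0) (Hp 1) (Hp 2) (Hp 3) (Hr 0) (Hr 1) (Hr 2) H; rewrite Hr1 Hr2 /=; lia.
Qed.

Lemma clause_inv_ext al al' g i : (forall k s, al k = Some s -> al' k = Some s) ->
  clause_inv al g i -> clause_inv al' g i.
Proof. by move=> Hal [[j j4 /Hal E]|H]; [left; exists j|right]. Qed.

Lemma inv_rook s al g l1 l2 : depicts s g -> play_inv al g -> vd l1 -> vd l2 -> l1 <> l2 ->
  g l1 = Some Rook -> g l2 <> None -> can_capture s Rook (pP l1) (pP l2) ->
  play_inv al (gmove g l1 l2).
Proof.
move=> R [I1 I2 I3 I4 I5] V1 V2 N G1 G2 Hc.
have Z := I1 _ _ V1 G1; have Hn := rook_capture V1 V2 N Z Hc.
split.
- move=> l p V; have [[_ ->]|[-> ->]|[_ _ ->]] // := gmoveE g l N; last exact: I1.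
  by rewrite G1 => -[<-]; case: (l1) (l2) Hn => [?|? ?|? ?|? ?|? ?||||] [?|? ?|? ?|? ?|? ?||||].
- move=> k kn; have [[_ ->]|[E _]|[_ _ ->]] // := gmoveE g (LS k) N; last exact: I2.
  by move: Hn; rewrite -E; case: (l1).
- move=> i j Hi Hj.
  have HO : g (LO i j) = None -> gmove g l1 l2 (LO i j) = None.
    by move=> H; have [[_ ->]|[E _]|[_ _ ->]] // := gmoveE g (LO i j) N; case: G2; rewrite -E.
  have [[_ ->]|[E _]|[_ _ ->]] // := gmoveE g (LE i j) N; last by move=> H; apply/HO/I3.
  move=> _; move: Hn; rewrite -E.
  case E1: l1 => [k|i' j'|i' j'|i' j'|k b||||] //= [Ei Ej]; subst i j l1 l2.
    by have [[_ ->]|[]|[]] := gmoveE g (LO i' j') N.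
  (* Seen from [LH i' j'], the exit of literal [j'.+1] lies beyond that literal on the same row, so
     a clear path shows the literal to be gone. *)
  apply: HO; case GO: (g _) => [q|] //; case: Hc => _ Hc.
  have VO : vd (LO i' j'.+1) by [].
  case: (Hc (Z.of_nat (pX (LO i' j'.+1)) - Z.of_nat (pX (LH i' j')))%Z); rewrite /pos; cbn [fst snd].
    rewrite /= /xcol /xK /qh /xL; nia.
  have -> : ((Z.of_nat (pX (LH i' j')) +
     (Z.of_nat (pX (LO i' j'.+1)) - Z.of_nat (pX (LH i' j'))) *
     Z.sgn (Z.of_nat (pX (LE i' j'.+1)) - Z.of_nat (pX (LH i' j'))))%Z =
     Z.of_nat (pX (LO i' j'.+1))).
    rewrite Z.sgn_pos; first lia.
    rewrite /= /xcol /xK /qh /xL; nia.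
  rewrite /= Z.sub_diag Z.mul_0_r Z.add_0_r.
  by apply/(depicts_occ R VO); rewrite GO.
- move=> i Hi; case E2: l2 => [k|i' j'|i' j'|i' j'|k b||||]; rewrite -E2;
    try by (apply: (clause_inv_other N G1) => //; [rewrite E2|exact: I4]).
  have [Ei|Ni] := eqVneq i' i; last first.
    apply: (clause_inv_other N G1) => //; last exact: I4.
    by rewrite E2 => j [E]; move: Ni; rewrite E eqxx.
  move: Hn; rewrite E2; case E1: l1 => [k|i1 j1|i1 j1|i1 j1|k b||||] //= [Ei1 Ej1]; subst.
    by apply: (clause_inv_helper _ Ej1 G1) => //; [case: V1|exact: I4].
  (* A rook coming back from an exit would take a literal without spending a helper; the third part
     of the invariant says that this literal is already gone. *)
  by case: G2; apply: I3 => //; case: V1.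
- exists l2, Rook; split=> //.
  by have [[/esym]|[_ ->]|[_ []]] := gmoveE g l2 N.
Qed.

Lemma inv_bishop s al g l1 l2 : depicts s g -> play_inv al g -> vd l1 -> vd l2 -> l1 <> l2 ->
  g l1 = Some Bishop -> g l2 <> None -> can_capture s Bishop (pP l1) (pP l2) ->
  exists al', play_inv al' (gmove g l1 l2).
Proof.
move=> R [I1 I2 I3 I4 I5] V1 V2 N G1 G2 Hc.
have Z := I1 _ _ V1 G1.
have Hn : bnext sg vr l1 l2.
  by apply: bishop_capture Hc => //; move: Z; case: (l1).
(* One of the two tracks is chosen when a bishop leaves its home square. *)
pose al' := match l1, l2 with
  | LS k, LO i j => fun k' => if k' == k then Some (sg i j) else al k'
  | LS k, LX _ b => fun k' => if k' == k then Some b else al k'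
  | _, _ => al end.
have Hext k b : al k = Some b -> al' k = Some b.
  rewrite /al'; case E1: l1 => [k1||||||||] //; subst.
  have A1 : al k1 = None by apply: I2 => //; rewrite G1.
  by case: (l2) => //= ? ?; case: eqP => // ->; rewrite A1.
have Hok l p : ok_piece al p l -> ok_piece al' p l.
  by case: p => //=; case: l => //= *; apply: Hext.
have Hnew : ok_piece al' Bishop l2.
  move: Hn Z; rewrite /al' /=; case: (l1) => [k1|i1 j1|i1 j1|i1 j1|k1 b1||||];
    case: (l2) => [k2|i2 j2|i2 j2|i2 j2|k2 b2||||] //=.
  - by move=> ->; rewrite eqxx.
  - by move=> ->; rewrite eqxx.
  - by move=> [-> ->].
  - by move=> [-> ->].
  - by move=> [-> ->].
exists al'; split.
- move=> l p V; have [[_ ->]|[-> ->]|[_ _ ->]] // := gmoveE g l N.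
    by rewrite G1 => -[<-].
  by move=> Hg; apply/Hok/I1.
- move=> k kn; have [[_ ->]|[E _]|[N1 N2 ->]] // := gmoveE g (LS k) N.
    (* No bishop captures on the home of [k]: it would have to stand on a track of [k], so that
       [al k] is set, whereas an occupied home forces [None]. *)
    have A : al k = None by apply: I2; rewrite // E.
    by move: Hn Z; rewrite -E; case: (l1) => //= *; subst; congruence.
  move=> Hg; rewrite /al'; case E1: l1 => [k1||||||||]; try exact: I2.
  by case: (l2) => *; try exact: I2; case: eqP => [E|_]; try exact: I2; case: N1; rewrite E E1.
- move=> i j Hi Hj.
  have [[_ ->]|[_ ->]|[_ _ ->]] // := gmoveE g (LE i j) N; first by rewrite G1.
  move=> H; have H' := I3 _ _ Hi Hj H.
  by have [[_ ->]|[E _]|[_ _ ->]] // := gmoveE g (LO i j) N; case: G2; rewrite -E.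
- move=> i Hi; case E2: l2 => [k|i' j'|i' j'|i' j'|k b||||]; rewrite -E2;
    try by (apply: (clause_inv_ext Hext); apply: (clause_inv_other N G1) => //;
            [rewrite E2|exact: I4]).
  have [Ei|Ni] := eqVneq i' i; last first.
    apply: (clause_inv_ext Hext); apply: (clause_inv_other N G1) => //; last exact: I4.
    by rewrite E2 => j [E]; move: Ni; rewrite E eqxx.
  by left; exists j'; [move: V2; rewrite E2 => -[]|move: Hnew; rewrite E2 -Ei].
- exists l2, Bishop; split=> //.
  by have [[/esym]|[_ ->]|[_ []]] := gmoveE g l2 N.
Qed.

Lemma inv_move al s g s' : depicts s g -> play_inv al g -> chess_move s s' ->
  exists al' g', depicts s' g' /\ play_inv al' g'.
Proof.
move=> R I M; have [l1 [l2 [p [[V1 V2] N G1 G2 [Hc R']]]]] := depicts_move R M.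
have [I1 _ _ _ _] := I; have Z := I1 _ _ V1 G1.
case: p G1 Hc Z => // G1 Hc _.
- exists al, (gmove g l1 l2); split=> //; exact: (inv_rook R I V1 V2 N G1 G2 Hc).
- have [al' I'] := inv_bishop R I V1 V2 N G1 G2 Hc.
  by exists al', (gmove g l1 l2).
- by case: (@pawn_capture s l1 l2).
Qed.

Lemma solvable_assignment s g : depicts s g -> play_inv (fun _ => None) g -> solvable s ->
  exists v : nat -> bool, forall i, i < m -> exists2 j, j < 4 & v (vr i j) = sg i j.
Proof.
move=> R I [s' [Hs Hlen]].
have [al [g' [R' I']]] : exists al g', depicts s' g' /\ play_inv al g'.
  move: (fun _ => None) I => al I.
  elim: Hs al g R I {Hlen} => {s s'} [s s' M|s|s s1 s2 _ IH1 _ IH2] al g R I.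
  - exact: inv_move R I M.
  - by exists al, g.
  - by have [al1 [g1 [R1 I1]]] := IH1 _ _ R I; apply: IH2 R1 I1.
have [_ _ _ I4 [l0 [p0 [V0 G0 Np]]]] := I'.
(* Variables with no recorded direction get [false]; satisfied literals rely on recorded directions
   only. *)
exists (fun k => al k == Some true) => i Hi.
case: (I4 i Hi) => [[j j4 E]|]; first by exists j => //; rewrite E; case: (sg i j).
(* The single piece left is the non-pawn kept by the invariant, so no literal pawn remains and the
   strict inequality is impossible. *)
suff Hp j : j < 4 -> pawn_at g' i j = 0 by rewrite !Hp.
move=> j4; rewrite /pawn_at; case E: (g' _) => [[]|] //.
have [_ H] := R'.
have H0 : List.In (p0, pP l0) s' by apply/H; exists l0.
have H1 : List.In (Pawn, pP (LO i j)) s' by apply/H; exists (LO i j).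
case: s' Hlen H0 H1 {Hs R' H} => [|a [|b s']] // _ [-> |//] [[Ep _]|//].
by case: Np.
Qed.

End Boards.

(** * Sequences of captures along a line *)

Section Play.
Context (n m : nat) (sg : nat -> nat -> bool) (vr : nat -> nat -> nat).
Context (vr_lt : forall i j, i < m -> j < 4 -> vr i j < n).

Local Notation pX := (px n m sg vr).
Local Notation pY := (py n m sg vr).
Local Notation pP := (pos n m sg vr).
Local Notation vd := (valid n m).
Local Notation rep := (@depicts n m sg vr).

Definition greach (g g' : lab -> option piece) : Prop :=
  forall s, rep s g -> exists s', clos_refl_trans board chess_move s s' /\ rep s' g'.

Lemma greach_trans g1 g2 g3 : greach g1 g2 -> greach g2 g3 -> greach g1 g3.
Proof.
move=> H1 H2 s /H1[s1 [C1 /H2[s2 [C2 R]]]]; exists s2; split=> //.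
exact: rt_trans C1 C2.
Qed.

Lemma depicts_ext s g g' : (forall l, vd l -> g l = g' l) -> rep s g -> rep s g'.
Proof.
move=> E [ND H]; split=> // p a; rewrite H.
by split=> -[l [V ? G]]; exists l; split=> //; move: G; rewrite E.
Qed.

Lemma greach_ext g g' : (forall l, vd l -> g l = g' l) -> greach g g'.
Proof. by move=> E s R; exists s; split; [apply: rt_refl|apply: depicts_ext R]. Qed.

Definition between (a b c : square) : Prop :=
  exists t, (0 < t < Z.max (Z.abs (b.1 - a.1)) (Z.abs (b.2 - a.2)))%Z /\
    c = (a.1 + t * Z.sgn (b.1 - a.1), a.2 + t * Z.sgn (b.2 - a.2))%Z.

Definition aligned (p : piece) (l l' : lab) : Prop :=
  match p with
  | Rook => pX l = pX l' \/ pY l = pY l'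
  | Bishop => pX l + pY l' = pX l' + pY l \/ pX l + pY l = pX l' + pY l'
  | _ => False
  end.

Lemma between_row l1 l2 l : pY l1 = pY l2 -> between (pP l1) (pP l2) (pP l) ->
  pY l = pY l1 /\ (pX l1 < pX l < pX l2 \/ pX l2 < pX l < pX l1).
Proof.
rewrite /between /pos; cbn [fst snd]; move=> E [t [Ht [Ex Ey]]]; move: Ht Ex Ey.
rewrite E Z.sub_diag /= Z.mul_0_r => Ht.
by case: (Z.sgn_spec (Z.of_nat (pX l2) - Z.of_nat (pX l1))) => [[? ->]|[[? ->]|[? ->]]]; lia.
Qed.

Lemma between_col l1 l2 l : pX l1 = pX l2 -> between (pP l1) (pP l2) (pP l) ->
  pX l = pX l1 /\ (pY l1 < pY l < pY l2 \/ pY l2 < pY l < pY l1).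
Proof.
rewrite /between /pos; cbn [fst snd]; move=> E [t [Ht [Ex Ey]]]; move: Ht Ex Ey.
rewrite E Z.sub_diag /= Z.mul_0_r => Ht.
by case: (Z.sgn_spec (Z.of_nat (pY l2) - Z.of_nat (pY l1))) => [[? ->]|[[? ->]|[? ->]]]; lia.
Qed.

(** Alignment is stated from the far end [l2], because the near end may be a home square, from which
    both tracks start. *)
Lemma between_diag l1 l2 l : aligned Bishop l1 l2 -> between (pP l1) (pP l2) (pP l) ->
  aligned Bishop l2 l /\ (pX l1 < pX l < pX l2 \/ pX l2 < pX l < pX l1).
Proof.
rewrite /between /pos /aligned; cbn [fst snd] => E [t [Ht [Ex Ey]]]; move: Ht Ex Ey.
by case: (Z.sgn_spec (Z.of_nat (pX l2) - Z.of_nat (pX l1))) => [[? ->]|[[? ->]|[? ->]]];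
  case: (Z.sgn_spec (Z.of_nat (pY l2) - Z.of_nat (pY l1))) => [[? ->]|[[? ->]|[? ->]]]; lia.
Qed.

Lemma greach_move g g' l1 l2 p : vd l1 -> vd l2 -> l1 <> l2 -> g l1 = Some p ->
  g l2 <> None -> aligned p l1 l2 ->
  (forall l, vd l -> between (pP l1) (pP l2) (pP l) -> g l = None) ->
  (forall l, vd l -> gmove g l1 l2 l = g' l) -> greach g g'.
Proof.
move=> V1 V2 N G1 G2 A Hb Hg s R.
have Hc : clear_path s (pP l1) (pP l2).
  move=> /= t Ht [q /(proj2 R)[l [V E G]]].
  by move: G; rewrite Hb //; exists t; split=> //; rewrite -E.
have Hcap : can_capture s p (pP l1) (pP l2).
  case: p A {G1} => // A; split=> //.
    by case: A => E; rewrite /rook_line /pos; cbn [fst snd]; rewrite E; [left|right].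
  by move: A; rewrite /aligned /bishop_line /pos; cbn [fst snd]; lia.
have [s' [M R']] := depicts_step vr_lt R V1 V2 N G1 G2 Hcap.
by exists s'; split; [apply: rt_step|apply: depicts_ext R'].
Qed.

(* The piece at [l0] captures, by increasing [d], all that stands on the line [P],
   up to the square [lf]. *)
Definition swept (p : piece) (P : lab -> bool) (d : lab -> nat) (lf l0 : lab)
    (g : lab -> option piece) (l : lab) : option piece :=
  if lab_dec l lf then Some p
  else if lab_dec l l0 || (P l && (d l0 < d l)) then None else g l.

(** Induction on the distance to [lf]: the piece captures the nearest occupied square ahead, to
    which the path is clear by minimality. *)
Lemma sweep p (P : lab -> bool) (d : lab -> nat) lf :
  (forall l l', vd l -> vd l' -> P l -> P l' -> d l = d l' -> l = l') ->
  vd lf -> P lf -> (forall l, vd l -> P l -> d l <= d lf) ->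
  forall l0 g, vd l0 -> g l0 = Some p -> g lf <> None -> d l0 < d lf ->
  (forall l l', l = l0 \/ P l -> P l' -> vd l -> vd l' -> d l < d l' ->
     aligned p l l' /\
     forall x, vd x -> between (pP l) (pP l') (pP x) -> P x /\ d l < d x < d l') ->
  greach g (swept p P d lf l0 g).
Proof.
move=> Hinj Vf Pf Hmax l0 g.
move Ek: (d lf - d l0) => k; elim/ltn_ind: k l0 g Ek => k IH l0 g Ek V0 G0 Gf D0 Hline.
pose Q e := exists x, [/\ vd x, P x, g x <> None, d l0 < d x & d x = e].
have [e [[[x [Vx Px Gx Dx Ee]] Hmin] _]] :
    exists ! e, Q e /\ forall e', Q e' -> (e <= e')%coq_nat.
  apply: Wf_nat.dec_inh_nat_subset_has_unique_least_element.
    by move=> e; apply: classic.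
  by exists (d lf), lf.
have Hx y : vd y -> P y -> d l0 < d y -> d y < d x -> g y = None.
  move=> Vy Py D1 D2; case E: (g y) => [q|] //.
  have : (e <= d y)%coq_nat by apply: Hmin; exists y; rewrite E.
  lia.
have N0 : l0 <> x by move=> E; move: Dx; rewrite E ltnn.
have [Al Hb] := Hline l0 x (or_introl erefl) Px V0 Vx Dx.
apply: (greach_trans (g2 := gmove g l0 x)).
  apply: (greach_move V0 Vx N0 G0 Gx Al) => // l V B.
  by have [Pl /andP[D1 D2]] := Hb l V B; apply: Hx.
case: (lab_dec x lf) => [Exf|Nxf].
  apply: greach_ext => l V; rewrite /swept -Exf.
  have [[E ->]|[E ->]|[N1 N2 ->]] := gmoveE g l N0.
  - by rewrite E; destruct (lab_dec l0 x); destruct (lab_dec l0 l0).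
  - by rewrite E; destruct (lab_dec x x).
  - destruct (lab_dec l x) => //; destruct (lab_dec l l0) => //=.
    case: ifP => // /andP[Pl Dl]; apply: Hx => //.
    rewrite ltn_neqAle Exf Hmax // andbT; apply/eqP => E; apply: N2.
    by apply: Hinj => //; rewrite Exf.
have Dxf : d x < d lf.
  rewrite ltn_neqAle Hmax // andbT; apply/eqP => E; apply: Nxf; exact: Hinj.
have Gx' : gmove g l0 x x = Some p.
  by have [[E _]|[_ ->]|[_ []]] := gmoveE g x N0; [case: N0|rewrite G0|].
have Gf' : gmove g l0 x lf <> None.
  have [[E _]|[E _]|[_ _ ->]] // := gmoveE g lf N0; last by case: Nxf.
  by move: D0; rewrite E ltnn.
have Hk : d lf - d x < k by lia.
have := IH _ Hk x (gmove g l0 x) erefl Vx Gx' Gf' Dxf _.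
move=> /(_ _)/greach_trans; apply.
  by move=> l l' Hl; apply: Hline; case: Hl => [->|]; right.
apply: greach_ext => l V; rewrite /swept.
destruct (lab_dec l lf) => //.
have [[E ->]|[E ->]|[N1 N2 ->]] := gmoveE g l N0.
- by subst l; destruct (lab_dec l0 l0) => //=; case: ifP.
- by subst l; rewrite Px Dx orbT; destruct (lab_dec x x).
- destruct (lab_dec l x) => //; destruct (lab_dec l l0) => //=.
  case Pl: (P l) => //=; case: (ltngtP (d l0) (d l)) => D1; case: (ltngtP (d x) (d l)) => D2 //; try lia.
    by rewrite Hx.
  by case: N2; apply: Hinj.
Qed.

End Play.

(** * A winning play from a satisfying assignment *)

Section Win.
Context (n m : nat) (sg : nat -> nat -> bool) (vr : nat -> nat -> nat).
Context (vr_lt : forall i j, i < m -> j < 4 -> vr i j < n).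

Local Notation pX := (px n m sg vr).
Local Notation pY := (py n m sg vr).
Local Notation pP := (pos n m sg vr).
Local Notation vd := (valid n m).
Local Notation reach := (@greach n m sg vr).

Context (v : nat -> bool).
Context (v_sat : forall i, i < m -> exists2 j, j < 4 & v (vr i j) = sg i j).

Definition jt (i : nat) : nat := find (fun j => v (vr i j) == sg i j) (iota 0 4).

Lemma jtP i : i < m -> jt i < 4 /\ v (vr i (jt i)) = sg i (jt i).
Proof.
move=> Hi; have [j j4 E] := v_sat Hi.
have H : has (fun j => v (vr i j) == sg i j) (iota 0 4).
  by apply/hasP; exists j; [rewrite mem_iota|apply/eqP].
have H4 : jt i < 4 by rewrite /jt -[4]/(size (iota 0 4)) -has_find.
by split=> //; have /eqP := nth_find 0 H; rewrite nth_iota.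
Qed.

(** Helpers leave in the order of [3 * i + j]. Those before the true literal clear the literal of
    their column, the others that of their row, so exactly [jt i] is spared. *)
Definition taken (a i j : nat) : bool :=
  if j < jt i then 3 * i + j < a
  else if j == jt i then false else 3 * i + j.-1 < a.

(* Position after the first [a] helper rooks have left through the exits; the
   helpers of clause [i] clear all its literals but the true one [jt i]. *)
Definition gA (a : nat) (l : lab) : option piece :=
  match l with
  | LO i j => if taken a i j then None else Some Pawn
  | LH i j => if 3 * i + j < a then None else Some Rook
  | LE i j => if taken a i j then Some Rook else Some Pawn
  | _ => Some (piece_of l)
  end.

Lemma bounds l : vd l -> pX l <= xK n m + qv m n /\
  match l with
  | LS _ => pX l = 0
  | LO _ _ | LH _ _ => 0 < pX l < xL m
  | LE _ _ => xK n m + 2 < pX l < xK n m + qv m n /\ 2 < pY l < qv m n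
  | LX _ _ => pX l = xL m /\ 0 < pY l < qv m n
  | LR | LC => pX l = xL m
  | LB => pX l = xK n m + 2
  | LZ => pX l = xK n m + qv m n
  end /\ xL m < xK n m.
Proof.
have Hn := q_lt m (ltnSn n); have Hq := q_low m n.
have Hx : xL m = 8 * m + 2 by [].
case: l => [k|i j|i j|i j|k s||||] V; rewrite /= /yrow /qv /xK; cbv [valid] in V;
  try (have [i4 j4 Hv Hc] := vfacts4 vr_lt V; have Hv' := q_lt m Hv; have Hv0 := q_low m (vr i j));
  try (have [i4 j4 Hv Hc [Hc' Hc2]] := vfacts3 vr_lt V);
  try (have V' := q_lt m V; have V0 := q_low m k);
  repeat case: ifP => _; lia.
Qed.

Lemma taken_last i j : i < m -> j < 4 -> taken (3 * m) i j = (j != jt i).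
Proof. by move=> Hi Hj; have [H _] := jtP Hi; rewrite /taken; case: (ltngtP j (jt i)) => ?; lia. Qed.

Lemma takenS i j i' j' : i' < m -> j < 3 -> j' < 4 ->
  taken (3 * i + j).+1 i' j' =
  taken (3 * i + j) i' j' || (i' == i) && (j' == (if j < jt i then j else j.+1)).
Proof.
move=> Hi Hj Hj'; rewrite /taken; case: (eqVneq i' i) => [->|Ni].
  by case: (ltngtP j' (jt i)) => ?; case: (ltnP j (jt i)) => ?; lia.
by have [J _] := jtP Hi; case: (ltngtP j' (jt i')) => ?; lia.
Qed.

(** Two captures: the helper takes its literal and then runs along the row of that literal to the
    exit; no labelled square lies in between in either case. *)
Lemma helper_leaves i j : i < m -> j < 3 ->
  reach (gA (3 * i + j)) (gA (3 * i + j).+1).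
Proof.
move=> Hi Hj; set a := 3 * i + j; set t := if j < jt i then j else j.+1.
have Ht : t = j \/ t = j.+1 by rewrite /t; case: ifP; [left|right].
have t4 : t < 4 by case: Ht => ->; lia.
have HtS i' j' : i' < m -> j' < 4 -> taken a.+1 i' j' = taken a i' j' || (i' == i) && (j' == t).
  by move=> Hi' Hj'; apply: takenS.
have Ta : taken a i t = false.
  rewrite /taken /t /a; case: (ltnP j (jt i)) => Hc; first by rewrite Hc ltnn.
  have -> : (j.+1 < jt i) = false by lia.
  have -> : (j.+1 == jt i) = false by lia.
  by rewrite /= ltnn.
clearbody t.
have VH : vd (LH i j) by []. have VO : vd (LO i t) by []. have VE : vd (LE i t) by [].
have GH : gA a (LH i j) = Some Rook by rewrite /= ltnn.
have Hx : pX (LO i t) = xcol i t by [].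
have /= BH := bounds VH; have /= BO := bounds VO; have /= BE := bounds VE.
have Hxc : xcol i j.+1 = xcol i j + 2 by rewrite /xcol; lia.
set g1 := gmove (gA a) (LH i j) (LO i t).
have S1 : reach (gA a) g1.
  apply: (greach_move vr_lt VH VO _ GH) => //; first by rewrite /= Ta.
    by rewrite /aligned /=; case: Ht => ->; [left|right].
  move=> l V B; exfalso; case: Ht => Et.
    have [Ex Ey] := between_col (l1 := LH i j) (l2 := LO i t) (congr1 (xcol i) (esym Et)) B.
    have Nl : LO i t <> l by move=> E; subst l; lia.
    have := rook_next (sg := sg) vr_lt VO V Nl I (or_introl _); rewrite Hx Et => /(_ (esym Ex)).
    case: l V Ex Ey {B Nl} => //= i' j' V Ex Ey; first by case=> ? [?|?]; subst; lia.
    by have := @bounds (LE i' j') V; rewrite /=; lia.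
  have [Ey Ex] := between_row (l1 := LH i j) (l2 := LO i t) (congr1 (yrow m sg vr i) (esym Et)) B.
  have Nl : LO i t <> l by move=> E; subst l; lia.
  have := rook_next (sg := sg) vr_lt VO V Nl I (or_intror _); rewrite /= Et => /(_ (esym Ey)).
  case: l V Ex Ey {B Nl} => //= i' j' V Ex Ey.
    by case=> ? [?|?]; subst; rewrite /xcol in Ex; lia.
  by have := @bounds (LE i' j') V; have := bounds VO; rewrite /=; lia.
have N1 : LH i j <> LO i t by [].
have G1O : g1 (LO i t) = Some Rook.
  by rewrite /g1; have [[E _]|[_ ->]|[_ []]] := gmoveE (gA a) (LO i t) N1.
apply: (greach_trans S1).
apply: (greach_move vr_lt VO VE _ G1O) => //.
- by rewrite /g1; have [[E _]|[E _]|[_ _ ->]] // := gmoveE (gA a) (LE i t) N1; rewrite /= Ta.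
- by right.
- move=> l V B; exfalso.
  have [Ey Ex] := between_row (l1 := LO i t) (l2 := LE i t) erefl B.
  have Nl : LO i t <> l by move=> E; subst l; lia.
  have := rook_next (sg := sg) vr_lt VO V Nl I (or_intror (esym Ey)).
  case: l V Ex Ey {B Nl} => //= i' j' V Ex Ey.
    have /= := @bounds (LH i' j') V; have : xcol i' j'.+1 = xcol i' j' + 2 by rewrite /xcol; lia.
    by move=> ? ? [Ei [Ej|Ej]]; subst i' t; lia.
  by case=> ? ?; subst; lia.
- move=> l V.
  have N2 : LO i t <> LE i t by [].
  have [[-> ->]|[-> ->]|[M1 M2 ->]] := gmoveE g1 l N2.
  + by rewrite /= HtS // !eqxx /= orbT.
  + by rewrite G1O /= HtS // !eqxx /= orbT.
  + rewrite /g1; have [[-> ->]|[E _]|[M3 M4 ->]] := gmoveE (gA a) l N1.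
    * by rewrite /= ltnSn.
    * by case: M1.
    * case: l V M1 M2 M3 M4 => //= i' j' [Vi Vj] M1 M2 M3 M4.
      - rewrite HtS //; case: eqP => [Ei|_]; last by rewrite orbF.
        by case: eqP => [Ej|_]; [case: M1; rewrite Ei Ej|rewrite orbF].
      - have -> : (3 * i' + j' < a.+1) = (3 * i' + j' < a) => //.
        have : ~ (i' = i /\ j' = j) by case=> Ei Ej; apply: M3; rewrite Ei Ej.
        by rewrite /a; lia.
      - rewrite HtS //; case: eqP => [Ei|_]; last by rewrite orbF.
        by case: eqP => [Ej|_]; [case: M2; rewrite Ei Ej|rewrite orbF].
Qed.

Lemma helpers_leave a : a <= 3 * m -> reach (gA 0) (gA a).
Proof.
elim: a => [|a IH] Ha; first by apply: greach_ext.
apply: (greach_trans (IH (ltnW Ha))).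
have -> : a = 3 * (a %/ 3) + a %% 3 by lia.
by apply: helper_leaves; lia.
Qed.

(** All helpers have left, and each of the first [b] bishops has swept the track of its sign [v k]
    and stands on the end of it. *)
Definition gB (b : nat) (l : lab) : option piece :=
  match l with
  | LS k => if k < b then None else Some Bishop
  | LO i j => if (j != jt i) || (vr i j < b) && (sg i j == v (vr i j)) then None else Some Pawn
  | LH _ _ => None
  | LE i j => if j == jt i then Some Pawn else Some Rook
  | LX k s => if (k < b) && (s == v k) then Some Bishop else Some Pawn
  | _ => Some (piece_of l)
  end.

Definition on_track (k : nat) (s : bool) (l : lab) : bool :=
  match l with
  | LO i j => (vr i j == k) && (sg i j == s)
  | LX k' s' => (k' == k) && (s' == s)
  | _ => false
  end.

Lemma track_line k s l : vd l -> l = LS k \/ on_track k s l ->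
  if s then pY l = qv m k + pX l else pY l + pX l = qv m k.
Proof.
move=> V [E|]; first by subst l; case: s; rewrite /= addn0.
have Hx : xL m = 8 * m + 2 by [].
have H0 := q_low m k.
case: l V => // [i j|k' s'] V /= /andP[/eqP E1 /eqP E2].
  subst k s; have [i4 j4 Hv Hc] := vfacts4 vr_lt V.
  by rewrite /yrow /qv; case: (sg i j); lia.
by rewrite E1 E2 /qv; case: (s); lia.
Qed.

Lemma on_track_next k s l l' : vd l -> vd l' -> on_track k s l -> l <> l' ->
  aligned n m sg vr Bishop l l' -> l' = LS k \/ on_track k s l'.
Proof.
move=> V V' T N A.
have : bnext sg vr l l' by apply: (bishop_next vr_lt V V' N) A; case: (l) T.
case: l T {V N A} => // [i j|k1 s1] /= /andP[/eqP E1 /eqP E2]; case: l' {V'} => //= *; subst;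
  try (by left); right; repeat match goal with H : _ /\ _ |- _ => case: H => * end; subst;
  by apply/andP; split; apply/eqP; congruence.
Qed.

Lemma track_swept k : k < n -> reach (gB k) (gB k.+1).
Proof.
move=> Hk; pose s := v k.
have VX : vd (LX k s) by []. have VS : vd (LS k) by [].
have HL : xL m = 8 * m + 2 by [].
have Hpos l : vd l -> on_track k s l -> 0 < pX l <= xL m.
  by move=> V; have := bounds V; case: (l) => //= *; lia.
have TX : on_track k s (LX k s) by rewrite /= !eqxx.
apply: (greach_trans (g2 := swept Bishop (on_track k s) pX (LX k s) (LS k) (gB k))).
  apply: (sweep vr_lt) => //.
  - move=> l l' V V' T T' E; apply: (pos_inj (sg := sg) vr_lt V V' E).
    have := track_line V (or_intror T); have := track_line V' (or_intror T').
    by case: (s); lia.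
  - by move=> l V T; have := Hpos l V T => /andP[].
  - by rewrite /= ltnn.
  - by rewrite /= ltnn.
  - by rewrite -[pX (LS k)]/0; have /andP[] := Hpos _ VX TX.
  - move=> l l' Hl T' V V' D.
    have A : aligned n m sg vr Bishop l l'.
      have Tl : l = LS k \/ on_track k s l by case: Hl => H; [left|right].
      have := track_line V Tl; have := track_line V' (or_intror T').
      by rewrite /aligned; case: (s); lia.
    split=> // x Vx B; have [A' Dx] := between_diag A B.
    have Nx : l' <> x by move=> E; subst x; lia.
    have [E|Tx] := on_track_next V' Vx T' Nx A'; last by split=> //; lia.
    by subst x; move: Dx; rewrite /=; lia.
apply: greach_ext => l V; rewrite /swept.
destruct (lab_dec l (LX k s)) as [E|N1].
  by subst l; rewrite /= ltnSn /s eqxx.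
destruct (lab_dec l (LS k)) as [E|N2]; first by subst l; rewrite /= ltnSn.
case T: (on_track k s l); rewrite /=.
  have /andP[-> _] := Hpos l V T.
  case: l T N1 N2 {V} => //= [i j|k' s'] /andP[/eqP E1 /eqP E2] N1 N2; subst.
    by rewrite ltnSn E2 eqxx orbT.
  by case: N1.
case: l V T N1 N2 => //= [k'|i j|k' s'] V T N1 N2.
- have -> : (k' < k.+1) = (k' < k) => //.
  have : k' <> k by move=> E; apply: N2; rewrite E.
  by lia.
- suff -> : (vr i j < k.+1) && (sg i j == v (vr i j)) = (vr i j < k) && (sg i j == v (vr i j)) by [].
  rewrite ltnS leq_eqVlt; case: eqP T => [E|_] //=; rewrite E -/s => ->; by rewrite andbF.
- suff -> : (k' < k.+1) && (s' == v k') = (k' < k) && (s' == v k') by [].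
  rewrite ltnS leq_eqVlt; case: eqP T => [E|_] //=; rewrite E -/s => ->; by rewrite andbF.
Qed.

Lemma tracks_swept k : k <= n -> reach (gB 0) (gB k).
Proof.
elim: k => [|k IH] Hk; first by apply: greach_ext.
exact: greach_trans (IH (ltnW Hk)) (track_swept Hk).
Qed.

(** The rook from [LR] has collected all track ends and stands on [LC]. *)
Definition gC (l : lab) : option piece :=
  match l with
  | LE i j => if j == jt i then Some Pawn else Some Rook
  | LC => Some Rook
  | LB => Some Bishop
  | LZ => Some Pawn
  | _ => None
  end.

Definition on_column (l : lab) : bool := match l with LX _ _ | LC => true | _ => false end.

Lemma column_swept : reach (gB n) gC.
Proof.
have VR : vd LR by []. have VC : vd LC by [].
have BC l : vd l -> on_column l -> pX l = xL m /\ 0 < pY l <= qv m n.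
  move=> V; have := bounds V; case: (l) => //= *; first by lia.
  by rewrite /qv; have := q_low m n; have : xL m = 8 * m + 2 by []; lia.
apply: (greach_trans (g2 := swept Rook on_column pY LC LR (gB n))).
  apply: (sweep vr_lt) => //.
  - move=> l l' V V' T T' E; apply: (pos_inj (sg := sg) vr_lt V V') E.
    by have [-> _] := BC l V T; have [-> _] := BC l' V' T'.
  - by move=> l V T; have [_ /andP[]] := BC l V T.
  - by have [_ /andP[]] := BC LC VC isT.
  - move=> l l' Hl T' V V' D.
    have [Ex' _] := BC l' V' T'.
    have Ex : pX l = xL m by case: Hl => [->|/(BC l V)[]].
    split; first by left; rewrite Ex.
    move=> x Vx B; have [Exx Dx] := between_col (etrans Ex (esym Ex')) B.
    have Nx : l' <> x by move=> E; subst x; lia.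
    have Z : rzone l' by case: (l') T'.
    have Hn := rook_next (sg := sg) vr_lt V' Vx Nx Z (or_introl (etrans Ex' (esym (etrans Exx Ex)))).
    have [Tx|[E|E]] : on_column x \/ (x = LR \/ x = LZ).
    + by move: Hn T'; clear; case: l' => [?|? ?|? ?|? ?|? ?||||] //=; case: x => //=; auto.
    + by split=> //; lia.
    + by subst x; move: Dx; rewrite /=; lia.
    + by subst x; have /= := bounds VC; move: Exx; rewrite Ex /=; lia.
apply: greach_ext => l V; rewrite /swept.
destruct (lab_dec l LC) as [->|N1] => //.
destruct (lab_dec l LR) as [->|N2] => //=.
case T: (on_column l).
  by have [_ /andP[H _]] := BC l V T; rewrite H /=; case: (l) T N1.
case: l V T N1 N2 => //= [k|i j] V _ _ _; first by rewrite V.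
(* The only literal spared by the helpers is the true one, which lies on a track that a bishop has
   swept. *)
case: eqP => [->|] //=; have [i4 j4 Hv _] := vfacts4 vr_lt V.
by have [_ ->] := jtP i4; rewrite (vr_lt i4) ?eqxx //; have [] := jtP i4.
Qed.

(** The bishop from [LB] has collected all exits and stands on [LZ], in the row of the rook on
    [LC]. *)
Definition gD (l : lab) : option piece :=
  match l with LC => Some Rook | LZ => Some Bishop | _ => None end.

Definition on_exit (l : lab) : bool := match l with LE _ _ | LZ => true | _ => false end.

Lemma exits_swept : reach gC gD.
Proof.
have VB : vd LB by []. have VZ : vd LZ by [].
have HL : xL m = 8 * m + 2 by [].
have Hq : 2 < qv m n by rewrite /qv; have := q_low m n; lia.
have BE l : vd l -> on_exit l -> pX l = xK n m + pY l /\ xK n m + 2 < pX l <= xK n m + qv m n.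
  by move=> V; have := bounds V; case: (l) => //= *; lia.
have AE l l' : vd l -> vd l' -> l = LB \/ on_exit l -> on_exit l' -> aligned n m sg vr Bishop l l'.
  move=> V V' Hl T'; have [E' _] := BE l' V' T'; left.
  by case: Hl => [E|/(BE l V)[E _]]; [subst l; rewrite /=|]; lia.
apply: (greach_trans (g2 := swept Bishop on_exit pX LZ LB gC)).
  apply: (sweep vr_lt) => //.
  - move=> l l' V V' T T' E; apply: (pos_inj (sg := sg) vr_lt V V' E).
    by have [] := BE l V T; have [] := BE l' V' T'; lia.
  - by move=> l V T; have [_ /andP[]] := BE l V T.
  - by have [_ /andP[]] := BE LZ VZ isT.
  - move=> l l' Hl T' V V' D; have A := AE l l' V V' Hl T'.
    split=> // x Vx B; have [A' Dx] := between_diag A B.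
    have Nx : l' <> x by move=> E; subst x; lia.
    have Z : bzone l' by case: (l') T'.
    have Hn := bishop_next vr_lt V' Vx Nx Z A'.
    have Bl : xK n m + 2 <= pX l.
      by case: Hl => [->|/(BE l V)[_ /andP[/ltnW]]].
    have [Tx|E] : on_exit x \/ x = LB.
    + by move: Hn T'; clear; case: l' => [?|? ?|? ?|? ?|? ?||||] //=; case: x => //=; auto.
    + by split=> //; lia.
    + by subst x; move: Dx; rewrite /=; lia.
apply: greach_ext => l V; rewrite /swept.
destruct (lab_dec l LZ) as [->|N1] => //.
destruct (lab_dec l LB) as [->|N2] => //=.
case T: (on_exit l).
  have [_ /andP[H _]] := BE l V T.
  have -> : pX LB < pX l by rewrite /=.
  by case: (l) T N1.
by case: l V T N1 N2.
Qed.

Lemma last_capture : exists g, reach gD g /\ forall l, vd l -> g l <> None -> l = LZ.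
Proof.
exists (gmove gD LC LZ); split.
  apply: (greach_move vr_lt (l1 := LC) (l2 := LZ) (p := Rook)) => //; first by right.
  move=> l V B; have [Ey Dx] := between_row (l1 := LC) (l2 := LZ) erefl B.
  by case: l V Ey Dx {B} => //= *; lia.
move=> l V; have N : LC <> LZ by [].
have [[_ ->]|[-> _]|[N1 N2 ->]] // := gmoveE gD l N.
by case: l N1 N2 {V}.
Qed.

Lemma winning_play s : depicts n m sg vr s (fun l => Some (piece_of l)) -> solvable s.
Proof.
move=> R0; have [g [Hg HZ]] := last_capture.
have H : reach (fun l => Some (piece_of l)) g.
  apply: greach_trans Hg; apply: greach_trans exits_swept; apply: greach_trans column_swept.
  apply: greach_trans (tracks_swept (leqnn n)).
  apply: (greach_trans (g2 := gA (3 * m))).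
    apply: greach_trans (helpers_leave (leqnn _)); apply: greach_ext.
    have T0 i j : taken 0 i j = false by rewrite /taken !ltn0; do 2?case: ifP.
    by case=> //= i j _; rewrite T0.
  apply: greach_ext; case=> //= i j V; have [Vi Vj] := V.
  - by rewrite taken_last // orbF.
  - have -> : 3 * i + j < 3 * m by lia.
    by [].
  - by rewrite taken_last //; case: eqP.
have [s' [C [ND' R']]] := H s R0.
exists s'; split=> //.
have Hin x : List.In x (map snd s') -> x = pP LZ.
  case/List.in_map_iff => [[p y] [/= -> Hi]].
  have [l [V -> E]] := (R' p x).1 Hi.
  by have -> : l = LZ by apply: HZ; rewrite // E.
(* The capturing piece survives each move, so a nonempty board never becomes empty; together with
   [Hin] this leaves exactly one piece. *)
have Hne : s' <> [::].
  move=> E; subst s'.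
  have : forall s1 s2, clos_refl_trans board chess_move s1 s2 -> s1 <> [::] -> s2 <> [::].
    move=> s1 s2; elim=> // [x y [k1 [a [k2 [b [rest [_ [_ [_ ->]]]]]]]] _ //|x y z _ H1 _ H2 Hx].
    exact: H2 (H1 Hx).
  move=> /(_ _ _ C); apply => // E; subst s.
  by have := (R0.2 Bishop (pP LB)).2; case; exists LB.
case: s' Hne Hin ND' {C R'} => // [[p a] [|[q b] s']] // _ Hin ND.
have /= Ea : a = pP LZ by apply: Hin; left.
have /= Eb : b = pP LZ by apply: Hin; right; left.
by case: ((List.NoDup_cons_iff _ _).1 ND) => Hn _; case: Hn; left; rewrite /= Ea Eb.
Qed.

End Win.

(** * The gadget as an instance *)

Lemma In_cat T (x : T) (l1 l2 : seq T) : List.In x (l1 ++ l2) <-> List.In x l1 \/ List.In x l2.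
Proof. exact: List.in_app_iff. Qed.

Lemma In_flatten_iota T (f : nat -> seq T) x a n :
  List.In x (flatten [seq f k | k <- iota a n]) <->
  exists2 k, a <= k < a + n & List.In x (f k).
Proof.
elim: n a => [|n IH] a /=; first by split=> // -[k]; lia.
rewrite In_cat IH; split=> [[H|[k Hk H]]|[k Hk H]].
- by exists a => //; lia.
- by exists k => //; lia.
- case: (eqVneq k a) => [<-|Na]; [by left|by right; exists k => //; lia].
Qed.

Lemma NoDup_cat T (l1 l2 : seq T) : List.NoDup l1 -> List.NoDup l2 ->
  (forall x, List.In x l1 -> List.In x l2 -> False) -> List.NoDup (l1 ++ l2).
Proof.
elim: l1 => [|x l1 IH] //= /List.NoDup_cons_iff[Hx ND1] ND2 Hd.
apply/List.NoDup_cons_iff; split.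
  by move=> /In_cat[//|H]; apply: (Hd x) => //; left.
by apply: IH => // y H1 H2; apply: (Hd y) => //; right.
Qed.

Lemma NoDup_flatten_iota T (f : nat -> seq T) (key : T -> nat) a n :
  (forall k, List.NoDup (f k)) -> (forall k x, List.In x (f k) -> key x = k) ->
  List.NoDup (flatten [seq f k | k <- iota a n]).
Proof.
move=> Hf Hk; elim: n a => [|n IH] a /=; first exact: List.NoDup_nil.
apply: NoDup_cat => // x /Hk <- /In_flatten_iota[k Hlt /Hk E]; lia.
Qed.

Lemma NoDup_map_inj S T (f : S -> T) (l : seq S) :
  (forall x y, List.In x l -> List.In y l -> f x = f y -> x = y) ->
  List.NoDup l -> List.NoDup (map f l).
Proof.
elim: l => [|x l IH] //= Hf; first by move=> _; exact: List.NoDup_nil.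
move=> /List.NoDup_cons_iff[Hx ND]; apply/List.NoDup_cons_iff; split.
  move=> /List.in_map_iff[y [E Hy]]; apply: Hx.
  by rewrite -(Hf y x) //; [right|left].
by apply: IH => // y z Hy Hz; apply: Hf; right.
Qed.

Definition var_labs (k : nat) : seq lab := [:: LS k; LX k true; LX k false].
Definition clause_labs (i : nat) : seq lab :=
  [:: LO i 0; LO i 1; LO i 2; LO i 3; LH i 0; LH i 1; LH i 2;
      LE i 0; LE i 1; LE i 2; LE i 3].
Definition labs (n m : nat) : seq lab :=
  flatten [seq var_labs k | k <- iota 0 n] ++
  flatten [seq clause_labs i | i <- iota 0 m] ++ [:: LR; LC; LB; LZ].

Lemma In_labs n m l : List.In l (labs n m) <-> valid n m l.
Proof.
rewrite /labs !In_cat !In_flatten_iota; split.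
- case=> [[k Hk]|[[i Hi]|]] /=; intuition (subst; simpl; auto; lia).
- case: l => [k|i j|i j|i j|k s||||] /= V; try (by right; right; intuition).
  + by left; exists k => //=; auto.
  + case: V => Hi Hj; right; left; exists i => //=.
    by case: j Hj => [|[|[|[|]]]] //; intuition.
  + case: V => Hi Hj; right; left; exists i => //=.
    by case: j Hj => [|[|[|]]] //; intuition.
  + case: V => Hi Hj; right; left; exists i => //=.
    by case: j Hj => [|[|[|[|]]]] //; intuition.
  + by left; exists k => //=; case: s; intuition.
Qed.

Lemma NoDup_labs n m : List.NoDup (labs n m).
Proof.
pose kv l := match l with LS k | LX k _ => k | _ => 0 end.
pose kc l := match l with LO i _ | LH i _ | LE i _ => i | _ => 0 end.
apply: NoDup_cat.
- apply: (NoDup_flatten_iota (key := kv)) => k.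
    by repeat (apply: List.NoDup_cons; first by rewrite /=; intuition discriminate); exact: List.NoDup_nil.
  by move=> x /= H; intuition (subst; simpl; auto).
- apply: NoDup_cat.
  + apply: (NoDup_flatten_iota (key := kc)) => i.
      by repeat (apply: List.NoDup_cons; first by rewrite /=; intuition discriminate); exact: List.NoDup_nil.
    by move=> x /= H; intuition (subst; simpl; auto).
  + by repeat (apply: List.NoDup_cons; first by rewrite /=; intuition discriminate); exact: List.NoDup_nil.
  + by move=> x /In_flatten_iota[i _] /= H1 H2; intuition (subst; discriminate).
- move=> x /In_flatten_iota[k _] /= H1 /In_cat[/In_flatten_iota[i _] /= H2|/= H2];
  by intuition (subst; discriminate).
Qed.

Definition gadget n m (sg : nat -> nat -> bool) (vr : nat -> nat -> nat) :
    seq (piece * (nat * nat)) :=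
  [seq (piece_of l, (px n m sg vr l, py n m sg vr l)) | l <- labs n m].

Section Gadget_correct.
Context (n m : nat) (sg : nat -> nat -> bool) (vr : nat -> nat -> nat).
Context (vr_lt : forall i j, i < m -> j < 4 -> vr i j < n).

Lemma gadget_valid : valid_instance (2 * xK n m) (gadget n m sg vr).
Proof.
have Hx : xL m = 8 * m + 2 by [].
have Hq := q_lt m (ltnSn n); have H0 := q_low m n.
split; first by rewrite /xK; lia.
split.
  move=> k x y /List.in_map_iff[l [[_ <- <-] /In_labs V]].
  have [B _] := bounds sg vr_lt V; rewrite /qv in B; rewrite /xK in B *; split; first lia.
  case: l V {B} => [k'|i j|i j|i j|k' s||||] V; rewrite /= /yrow /qv; cbv [valid] in V;
  try (have [i4 j4 Hv Hc] := vfacts4 vr_lt V; have Hv' := q_lt m Hv);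
  try (have [i4 j4 Hv Hc [Hc' Hc2]] := vfacts3 vr_lt V; have Hv' := q_lt m Hv);
  try (have V' := q_lt m V);
  repeat case: ifP => _; lia.
rewrite /gadget -map_comp; apply: NoDup_map_inj (NoDup_labs n m).
move=> l l' /In_labs V /In_labs V' [Ex Ey]; exact: (pos_inj vr_lt V V' Ex Ey).
Qed.

Lemma gadget_depicts :
  depicts n m sg vr (to_board (gadget n m sg vr)) (fun l => Some (piece_of l)).
Proof.
rewrite /to_board /gadget -map_comp; split.
  rewrite -map_comp; apply: NoDup_map_inj (NoDup_labs n m).
  move=> l l' /In_labs V /In_labs V'; exact: (posE vr_lt V V').
move=> p a; rewrite List.in_map_iff; split.
  by case=> l [[<- <-] /In_labs V]; exists l.
by case=> l [V -> [<-]]; exists l; split=> //; apply/In_labs.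
Qed.

Lemma gadget_inv : play_inv n m sg vr (fun _ => None) (fun l => Some (piece_of l)).
Proof.
split=> //.
- by move=> l p V [<-]; case: l V.
(* At the start each clause has three helpers against four pawns. *)
- by move=> i Hi; right.
- by exists LB, Bishop.
Qed.

Lemma gadget_solvable : solvable (to_board (gadget n m sg vr)) <->
  exists v : nat -> bool, forall i, i < m -> exists2 j, j < 4 & v (vr i j) = sg i j.
Proof.
split=> [|[v Hv]]; first exact: (solvable_assignment vr_lt gadget_depicts gadget_inv).
exact: (winning_play vr_lt Hv gadget_depicts).
Qed.

End Gadget_correct.

(** * Injectivity of the encoding *)

Lemma enc_nat_inj a b r r' : enc_nat a ++ r = enc_nat b ++ r' -> a = b /\ r = r'.
Proof.
have H (u w x y : seq bool) :
    (flatten [seq [:: true; b] | b <- u] ++ [:: false]) ++ x =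
    (flatten [seq [:: true; b] | b <- w] ++ [:: false]) ++ y -> u = w /\ x = y.
  elim: u w => [|c u IH] [|d w] //=; first by case.
  by case=> -> /IH[-> ->].
have Hp p q : pos_bits p = pos_bits q -> p = q.
  elim: p q => [p IH|p IH|] [q|q|] //= [].
  - by move/IH ->.
  - by case: (p).
  - by move/IH ->.
  - by case: (q).
have Hp0 p : pos_bits p <> [::] by case: p.
rewrite /enc_nat => /H[E ->]; split=> //; move: E; rewrite /nat_bits => E.
suff : N.of_nat a = N.of_nat b by move/Nnat.Nat2N.inj.
by move: E; case: (N.of_nat a) => [|p]; case: (N.of_nat b) => [|q] //; [by move/esym/Hp0|by move/Hp0|by move/Hp ->].
Qed.

(** [SolitaireChess] speaks of some instance with the given code; injectivity makes it the intended
    one. *)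
Lemma enc_instance_inj N ps N' ps' :
  enc_instance N ps = enc_instance N' ps' -> N = N' /\ ps = ps'.
Proof.
rewrite /enc_instance => /enc_nat_inj[-> /enc_nat_inj[Es Ef]]; split=> //.
elim: ps ps' Es Ef => [|[k [x y]] ps IH] [|[k' [x' y']] ps'] // [Es].
cbn [map flatten foldr fst snd]; rewrite -!(catA (enc_nat _)) => /enc_nat_inj[Ek /enc_nat_inj[-> /enc_nat_inj[-> /(IH _ Es) ->]]].
by move: Ek; case: k; case: k'.
Qed.

Lemma chess_correct n m sg vr : (forall i j, i < m -> j < 4 -> vr i j < n) ->
  SolitaireChess (enc_instance (2 * xK n m) (gadget n m sg vr)) <->
  exists v : nat -> bool, forall i, i < m -> exists2 j, j < 4 & v (vr i j) = sg i j.
Proof.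
move=> vr_lt; rewrite -(gadget_solvable sg vr_lt); split.
  by case=> N [ps [/enc_instance_inj[_ <-] [_ H]]].
move=> H; exists (2 * xK n m), (gadget n m sg vr); split=> //; split=> //.
exact: gadget_valid.
Qed.

(** * The Cook-Levin tableau *)

Definition lit : Type := (bool * nat)%type.
Definition clause : Type := (lit * (lit * (lit * lit)))%type.

Definition lit_at (c : clause) (j : nat) : lit :=
  if j == 0 then c.1 else if j == 1 then c.2.1
  else if j == 2 then c.2.2.1 else c.2.2.2.

Definition lit_true (v : nat -> bool) (l : lit) : bool := v l.2 == l.1.

Definition clause_true (v : nat -> bool) (c : clause) : bool :=
  [|| lit_true v c.1, lit_true v c.2.1, lit_true v c.2.2.1 | lit_true v c.2.2.2].

(** The widest clause: state, scanned symbol and the content of one cell determine the content of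
    one cell a step later. Shorter clauses are padded by repeating a literal. *)
Definition imp3 (a b c d : nat) : clause := ((false, a), ((false, b), ((false, c), (true, d)))).
Definition unit_clause (a : nat) : clause := ((true, a), ((true, a), ((true, a), (true, a)))).
Definition or3_clause (a b c : nat) : clause := ((true, a), ((true, b), ((true, c), (true, c)))).
Definition not_both (a b : nat) : clause := ((false, a), ((false, b), ((false, b), (false, b)))).

Lemma imp3P v a b c d : clause_true v (imp3 a b c d) <-> (v a -> v b -> v c -> v d).
Proof.
rewrite /clause_true /lit_true /=; case: (v a); case: (v b); case: (v c); case: (v d) => //=;
  by split=> // /(_ isT isT isT).
Qed.

Lemma unit_clauseP v a : clause_true v (unit_clause a) = v a.
Proof. by rewrite /clause_true /lit_true /=; case: (v a). Qed.

Lemma or3_clauseP v a b c : clause_true v (or3_clause a b c) = [|| v a, v b | v c].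
Proof. by rewrite /clause_true /lit_true /=; case: (v a); case: (v b); case: (v c). Qed.

Lemma not_both_clauseP v a b : clause_true v (not_both a b) = ~~ (v a && v b).
Proof. by rewrite /clause_true /lit_true /=; case: (v a); case: (v b). Qed.

Definition tp (M : TM) (c : config M) (side : bool) : seq (sym M) :=
  if side then cr c else cl c.

(** Where the new symbol lies after the move: index 0 on the right is the scanned cell, index 0 on
    the left the cell before it. *)
Definition written (d : dir) : bool * nat :=
  match d with DR => (false, 0) | DS => (true, 0) | DL => (true, 1) end.

(* Pairs (source, target) of cells, relative to the head before and after a
   move in direction [d]; the boolean tells the right part of the tape. *)
Definition transfers (d : dir) (j : nat) : seq ((bool * nat) * (bool * nat)) :=
  match d with
  | DR => [:: ((true, j.+1), (true, j)); ((false, j), (false, j.+1))]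
  | DS => [:: ((true, j.+1), (true, j.+1)); ((false, j), (false, j))]
  | DL => [:: ((false, 0), (true, 0)); ((true, j.+1), (true, j.+2)); ((false, j.+1), (false, j))]
  end.

Lemma transfers_bound d j (e : (bool * nat) * (bool * nat)) : e \in transfers d j -> e.1.2 <= j.+1 /\ e.2.2 <= j.+2.
Proof.
case: d; rewrite /= !inE; first by case/or3P => /eqP-> /=; lia.
  by case/orP => /eqP-> /=; lia.
by case/orP => /eqP-> /=; lia.
Qed.

(** No cell of the new configuration is left out, and its source is at most one cell further from
    the head. So the known part of the tape shrinks by at most one cell per step. *)
Lemma transfers_cover d side j : (side, j) = written d \/
  exists j0 (e : (bool * nat) * (bool * nat)), [/\ e \in transfers d j0, e.2 = (side, j), e.1.2 <= j.+1 & j0 <= j].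
Proof.
case: d => /=; case: side.
- case: j => [|[|j]]; [right|by left|right].
    by exists 0, ((false, 0), (true, 0)); rewrite inE eqxx.
  by exists j, ((true, j.+1), (true, j.+2)); rewrite !inE eqxx orbT; split=> //=; lia.
- by right; exists j, ((false, j.+1), (false, j)); rewrite !inE eqxx !orbT.
- by right; exists j, ((true, j.+1), (true, j)); rewrite !inE eqxx.
- case: j => [|j]; [by left|right].
  by exists j, ((false, j), (false, j.+1)); rewrite !inE eqxx orbT; split=> //=; lia.
- case: j => [|j]; [by left|right].
  by exists j, ((true, j.+1), (true, j.+1)); rewrite !inE eqxx; split=> //=; lia.
- by right; exists j, ((false, j), (false, j)); rewrite !inE eqxx orbT; split=> //=.
Qed.

Lemma tm_step_cells (M : TM) (c : config M) q' s' d :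
  tm_delta (cq c) (nth None (cr c) 0) = Some (q', s', d) ->
  exists c', [/\ tm_step c = Some c', cq c' = q',
    nth None (tp c' (written d).1) (written d).2 = s' &
    forall j (e : (bool * nat) * (bool * nat)), e \in transfers d j ->
      nth None (tp c' e.2.1) e.2.2 = nth None (tp c e.1.1) e.1.2].
Proof.
move=> Hd; have Er : read_sym (cr c) = nth None (cr c) 0 by case: (cr c).
rewrite /tm_step Er Hd; eexists; split; first reflexivity.
- by case: d {Hd} => //; case: (cl c).
- by case: d {Hd} => //; case: (cl c).
- move=> j e; case: d {Hd} => /=; rewrite !inE.
  + case/or3P => /eqP-> /=; case: (cl c) => [|x l] //=; by rewrite ?nth_behead ?nth_nil.
  + by case/orP => /eqP-> /=; rewrite ?nth_behead.
  + by case/orP => /eqP-> /=; rewrite ?nth_behead.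
Qed.

Section Tableau.
Context (M : TM).

Local Notation Sym := (option (bool + tm_G M)).
Local Notation nQ := #|tm_Q M|.
Local Notation nS := #|{: option (bool + tm_G M)}|.

Definition rankS (s : Sym) : nat := enum_rank s.
Definition rankQ (q : tm_Q M) : nat := enum_rank q.
Definition ncodes : nat := nQ + 2 * nS.

Context (W : nat).

(* [vS t q]: the state at time [t] is [q]; [vT t side j s]: at time [t] the cell at
   distance [j] from the head on that side holds [s].  As cells are counted from
   the head, every step clause has at most one positive literal and uniqueness of
   states and symbols need not be imposed. *)
Definition vS (t : nat) (q : tm_Q M) : nat := (t * W + 0) * ncodes + rankQ q.
Definition vT (t : nat) (side : bool) (j : nat) (s : Sym) : nat :=
  (t * W + j) * ncodes + (nQ + (if side then nS else 0) + rankS s).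

(** Variable numbers are read in mixed radix as [(t, j, c)], where [c] codes a state, a symbol on
    the left or a symbol on the right. *)
Definition assignment (cf : nat -> config M) (x : nat) : bool :=
  let c := x %% ncodes in let t := x %/ ncodes %/ W in let j := x %/ ncodes %% W in
  if c < nQ then rankQ (cq (cf t)) == c
  else if c < nQ + nS then nQ + rankS (nth None (cl (cf t)) j) == c
  else nQ + nS + rankS (nth None (cr (cf t)) j) == c.

Lemma decode t j c : j < W -> c < ncodes ->
  let x := (t * W + j) * ncodes + c in
  [/\ x %% ncodes = c, x %/ ncodes %/ W = t & x %/ ncodes %% W = j].
Proof.
move=> jW cC x; have C0 : 0 < ncodes by lia.
have W0 : 0 < W by lia.
rewrite /x modnMDl divnMDl // modn_small // [c %/ _]divn_small // addn0.
by rewrite divnMDl // modnMDl modn_small // [j %/ _]divn_small // addn0.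
Qed.

Lemma rankS_lt s : rankS s < nS. Proof. exact: ltn_ord. Qed.
Lemma rankQ_lt q : rankQ q < nQ. Proof. exact: ltn_ord. Qed.

Lemma rankS_eq s s' : (rankS s == rankS s') = (s == s').
Proof. by apply/eqP/eqP => [/ord_inj/enum_rank_inj|->]. Qed.

Lemma rankQ_eq q q' : (rankQ q == rankQ q') = (q == q').
Proof. by apply/eqP/eqP => [/ord_inj/enum_rank_inj|->]. Qed.

Lemma assignment_S cf t q : 0 < W -> assignment cf (vS t q) = (cq (cf t) == q).
Proof.
move=> W0; have Hq := rankQ_lt q.
have [] := @decode t 0 (rankQ q) W0; first by rewrite /ncodes; lia.
by rewrite /assignment /vS => -> -> ->; rewrite Hq rankQ_eq.
Qed.

Lemma assignment_T cf t side j s : j < W ->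
  assignment cf (vT t side j s) = (nth None (tp (cf t) side) j == s).
Proof.
move=> jW; have Hs := rankS_lt s.
have [] := @decode t j (nQ + (if side then nS else 0) + rankS s) jW.
  by rewrite /ncodes; case: side; lia.
rewrite /assignment /vT => -> -> ->; case: side => /=.
  have -> : (nQ + nS + rankS s < nQ) = false by lia.
  have -> : (nQ + nS + rankS s < nQ + nS) = false by lia.
  by rewrite eqn_add2l rankS_eq.
rewrite addn0; have -> : (nQ + rankS s < nQ) = false by lia.
by rewrite ltn_add2l Hs eqn_add2l rankS_eq.
Qed.

(** A halting pair of state and symbol is forbidden unless it accepts, so acceptance needs no clause
    of its own. *)
Definition step_clauses (B t : nat) (q : tm_Q M) (s : Sym) : seq clause :=
  let a := vS t q in let b := vT t true 0 s in
  match tm_delta q s with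
  | None => if tm_acc q then [::] else [:: not_both a b]
  | Some (q', s', d) =>
      [:: imp3 a b b (vS t.+1 q'); imp3 a b b (vT t.+1 (written d).1 (written d).2 s')] ++
      flatten [seq flatten [seq [seq imp3 a b (vT t e.1.1 e.1.2 x) (vT t.+1 e.2.1 e.2.2 x)
        | x <- enum {: Sym}] | e <- transfers d j] | j <- iota 0 B]
  end.

Definition run_clauses (B T : nat) : seq clause :=
  flatten [seq flatten [seq flatten [seq step_clauses B t q s
    | s <- enum {: Sym}] | q <- enum (tm_Q M)] | t <- iota 0 T.+1].

Definition bit (b : bool) : Sym := Some (inl b).

(** The certificate is left open: each of [Y] cells holds a bit or a blank, and a blank forces the
    next cell to be blank, so a model spells a word of length at most [Y]. *)
Definition init_clauses (pre : seq bool) (Y : nat) : seq clause :=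
  unit_clause (vS 0 (tm_start M)) ::
  [seq unit_clause (vT 0 false j None) | j <- iota 0 W] ++
  [seq unit_clause (if nth false pre j then vT 0 true j (bit true) else vT 0 true j (bit false))
    | j <- iota 0 (size pre)] ++
  flatten [seq [:: or3_clause (vT 0 true (size pre + i) (bit false)) (vT 0 true (size pre + i) (bit true))
                      (vT 0 true (size pre + i) None);
                   imp3 (vT 0 true (size pre + i) None) (vT 0 true (size pre + i) None)
                        (vT 0 true (size pre + i) None) (vT 0 true (size pre + i).+1 None)]
          | i <- iota 0 Y] ++
  [seq unit_clause (vT 0 true (size pre + Y + i) None) | i <- iota 0 (W - (size pre + Y))].

(** The facts of the run hold in [v], and others may hold too. The condition [j + t < B] is the
    horizon that shrinks as in [transfers_cover]. *)
Definition tracks (v : nat -> bool) (B t : nat) (c : config M) : Prop :=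
  v (vS t (cq c)) /\
  forall side j, j + t < B -> v (vT t side j (nth None (tp c side) j)).

Lemma all_flattenP (T : Type) (I : eqType) (p : pred T) (f : I -> seq T) (r : seq I) :
  all p (flatten [seq f i | i <- r]) <-> forall i, i \in r -> all p (f i).
Proof.
elim: r => [|i r IH] //=; rewrite all_cat; split.
  by case/andP=> H1 /IH H2 j; rewrite inE => /orP[/eqP->|/H2].
move=> H; apply/andP; split; first by apply: H; rewrite mem_head.
by apply/IH => j jr; apply: H; rewrite inE jr orbT.
Qed.

Lemma run_clausesP v B T : all (clause_true v) (run_clauses B T) <->
  forall t q s, t <= T -> all (clause_true v) (step_clauses B t q s).
Proof.
rewrite /run_clauses; split.
- move=> /all_flattenP H t q s Ht.
  have := H t; rewrite mem_iota add0n ltnS => /(_ Ht) /all_flattenP/(_ q).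
  by rewrite mem_enum => /(_ isT) /all_flattenP; apply; rewrite mem_enum.
- move=> H; apply/all_flattenP => t; rewrite mem_iota add0n ltnS /= => Ht.
  by apply/all_flattenP => q _; apply/all_flattenP => s _; apply: H.
Qed.

Lemma tracks_step v B T t c q' s' d :
  all (clause_true v) (run_clauses B T) -> t <= T -> t < B -> tracks v B t c ->
  tm_delta (cq c) (nth None (cr c) 0) = Some (q', s', d) ->
  exists c', tm_step c = Some c' /\ tracks v B t.+1 c'.
Proof.
move=> /run_clausesP H Ht HB [Hq Hc] Hd.
have [c' [Es Eq Ew Ee]] := tm_step_cells Hd; exists c'; split=> //.
have H0 := Hc true 0 HB; rewrite /tp in H0.
have := H t (cq c) (nth None (cr c) 0) Ht; rewrite /step_clauses Hd /=.
case/and3P => /imp3P H1 /imp3P H2 /all_flattenP H3; split; first by rewrite Eq; apply: H1.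
move=> side j Hj; have [Ej|[j0 [e [He Ee2 Hj1 Hj0]]]] := transfers_cover d side j.
  by rewrite -Ew -Ej /= in H2 *; apply: H2.
have Hj0B : j0 < B by lia.
have := H3 j0; rewrite mem_iota add0n /= => /(_ Hj0B)/all_flattenP/(_ e He).
rewrite all_map => /allP/(_ (nth None (tp c e.1.1) e.1.2)).
rewrite mem_enum => /(_ isT) /imp3P.
have -> : nth None (tp c' side) j = nth None (tp c e.1.1) e.1.2.
  by rewrite -(Ee _ _ He) Ee2.
by rewrite Ee2 /=; apply => //; apply: Hc; lia.
Qed.

Lemma tracks_accept v B T k t c c' :
  all (clause_true v) (run_clauses B T) -> t + k <= T -> T < B -> tracks v B t c ->
  tm_steps k c = Some c' -> tm_step c' = None -> tm_acc (cq c').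
Proof.
move=> Hall; elim: k t c => [|k IH] t c Ht HB Htr /=.
  case=> <- Hn; have [Hq Hc] := Htr.
  have Er : read_sym (cr c) = nth None (cr c) 0 by case: (cr c).
  move: Hn; rewrite /tm_step Er.
  case Hd: (tm_delta _ _) => [[[q s] d]|] // _.
  have Ht' : t <= T by lia.
  have := (run_clausesP _ _ _).1 Hall t (cq c) (nth None (cr c) 0) Ht'.
  rewrite /step_clauses Hd; case: (tm_acc _) => //=.
  by rewrite not_both_clauseP Hq (Hc true 0) //; lia.
case Es: (tm_step c) => [c1|] // Hk Hn.
have Er : read_sym (cr c) = nth None (cr c) 0 by case: (cr c).
case Hd: (tm_delta (cq c) (nth None (cr c) 0)) => [[[q s] d]|]; last first.
  by move: Es; rewrite /tm_step Er Hd.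
have [||c2 [Es2 Htr2]] := tracks_step Hall _ _ Htr Hd; [lia|lia|].
move: Es2; rewrite Es => -[E]; subst c2.
by apply: (IH t.+1 c1) => //; lia.
Qed.

(** A halted configuration is repeated, so that every time has a configuration to read the
    assignment from. *)
Definition next (c : config M) : config M := if tm_step c is Some c' then c' else c.

Lemma run_clauses_true c0 B T : B.+2 <= W ->
  (forall t, t <= T.+1 -> tm_step (iter t next c0) = None -> tm_acc (cq (iter t next c0))) ->
  all (clause_true (assignment (fun t => iter t next c0))) (run_clauses B T).
Proof.
move=> HW Hacc; set cf := fun t => iter t next c0; apply/run_clausesP => t q s Ht.
have W0 : 0 < W by lia.
have Er : read_sym (cr (cf t)) = nth None (cr (cf t)) 0 by case: (cr (cf t)).
rewrite /step_clauses; case Hd: (tm_delta q s) => [[[q' s'] d]|]; last first.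
  case Ha: (tm_acc q) => //=; rewrite not_both_clauseP andbT assignment_S // assignment_T //.
  apply/negP => /andP[/eqP Eq /eqP Es].
  have := Hacc t (leqW Ht); rewrite -/(cf t) Eq Ha => H.
  by apply/notF/H; rewrite /tm_step Er Eq -[cr _]/(tp (cf t) true) Es Hd.
have Hgen x : (cq (cf t) = q -> nth None (tp (cf t) true) 0 = s -> x) ->
    (assignment cf (vS t q) -> assignment cf (vT t true 0 s) -> x).
  by rewrite assignment_S // assignment_T // => Hx /eqP Eq /eqP Es; apply: Hx.
have Hstep : cq (cf t) = q -> nth None (tp (cf t) true) 0 = s ->
    [/\ cq (cf t.+1) = q', nth None (tp (cf t.+1) (written d).1) (written d).2 = s' &
    forall j (e : (bool * nat) * (bool * nat)), e \in transfers d j ->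
      nth None (tp (cf t.+1) e.2.1) e.2.2 = nth None (tp (cf t) e.1.1) e.1.2].
  move=> Eq Es; have := Hd; rewrite -{1}Eq -{1}Es => /tm_step_cells[c' [E1 E2 E3 E4]].
  by have -> : cf t.+1 = c' by rewrite /cf iterS -/(cf t) /next E1.
have Hw : (written d).2 < W by case: (d); rewrite /=; lia.
rewrite /=; apply/and3P; split.
- apply/imp3P; apply: Hgen => Eq Es _; have [E _ _] := Hstep Eq Es.
  by rewrite assignment_S // E.
- apply/imp3P; apply: Hgen => Eq Es _; have [_ E _] := Hstep Eq Es.
  by rewrite assignment_T // E.
- apply/all_flattenP => j; rewrite mem_iota add0n /= => Hj.
  apply/all_flattenP => e He; rewrite all_map; apply/allP => x _ /=.
  (* Targets reach up to [j.+2], which is below [W] because [j < B] and [B.+2 <= W]. *)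
  have [B1 B2] := transfers_bound He.
  apply/imp3P; apply: Hgen => Eq Es; have [_ _ E] := Hstep Eq Es.
  by rewrite !assignment_T ?(E _ _ He) //; lia.
Qed.

Lemma init_clausesP v pre Y : size pre + Y < W ->
  all (clause_true v) (init_clauses pre Y) <->
  [/\ v (vS 0 (tm_start M)), forall j, j < W -> v (vT 0 false j None),
      forall j, j < size pre -> v (vT 0 true j (bit (nth false pre j))),
      forall i, i < Y -> [|| v (vT 0 true (size pre + i) (bit false)),
          v (vT 0 true (size pre + i) (bit true)) | v (vT 0 true (size pre + i) None)] /\
        (v (vT 0 true (size pre + i) None) -> v (vT 0 true (size pre + i).+1 None)) &
      forall j, size pre + Y <= j < W -> v (vT 0 true j None)].
Proof.
move=> HW; rewrite /init_clauses /= unit_clauseP !all_cat !all_map; split.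
- case/and5P => H1 /allP H2 /allP H3 /all_flattenP H4 /allP H5; split=> //.
  + by move=> j Hj; have := H2 j; rewrite mem_iota /= unit_clauseP; apply.
  + move=> j Hj; have := H3 j; rewrite mem_iota /= unit_clauseP => /(_ Hj).
    by case: (nth false pre j).
  + move=> i Hi; have := H4 i; rewrite mem_iota /= => /(_ Hi).
    rewrite or3_clauseP andbT => /andP[Ha /imp3P Hb]; split=> // H; exact: Hb.
  + move=> j Hj; have := H5 (j - (size pre + Y)); rewrite mem_iota /= unit_clauseP subnKC; last lia.
    by apply; lia.
- case=> H1 H2 H3 H4 H5; apply/and5P; split=> //.
  + by apply/allP => j; rewrite mem_iota /= unit_clauseP => Hj; apply: H2.
  + apply/allP => j; rewrite mem_iota /= unit_clauseP => Hj; have := H3 j Hj.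
    by case: (nth false pre j).
  + apply/all_flattenP => i; rewrite mem_iota /= => Hi; have [Ha Hb] := H4 i Hi.
    by rewrite or3_clauseP Ha andbT /=; apply/imp3P => H _ _; apply: Hb.
  + by apply/allP => i; rewrite mem_iota /= unit_clauseP => Hi; apply: H5; lia.
Qed.

End Tableau.

(** * Correctness of the tableau *)

Definition pair_prefix (w : seq bool) : seq bool :=
  flatten [seq [:: b; b] | b <- w] ++ [:: false; true].

Lemma pair_encE w y : pair_enc w y = pair_prefix w ++ y.
Proof. by rewrite /pair_enc /pair_prefix -catA. Qed.

Lemma nth_init_cells (M : TM) (z : seq bool) j :
  nth None [seq Some (inl b) : option (bool + tm_G M) | b <- z] j =
  if j < size z then bit M (nth false z j) else None.
Proof.
case: ltnP => H; first by rewrite (nth_map false).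
by rewrite nth_default // size_map.
Qed.

(** [B] exceeds the time bound, so the scanned cell stays within the horizon for [T] steps, and also
    the length of the input; two further cells make room for the targets of [transfers]. *)
Definition tableau (M : TM) (pre : seq bool) (Y T : nat) : seq clause :=
  let B := (T + (size pre + Y)).+1 in
  init_clauses M B.+2 pre Y ++ run_clauses M B.+2 B T.

Lemma tableau_correct (M : TM) (V : language) w Y T :
  (forall y, size y <= Y -> exists c', halts_within (M := M) (pair_enc w y) T c' /\
     (tm_acc (cq c') = true <-> V (pair_enc w y))) ->
  (exists v, all (clause_true v) (tableau M (pair_prefix w) Y T)) <->
  exists y, size y <= Y /\ V (pair_enc w y).
Proof.
set pre := pair_prefix w; move=> HM; rewrite /tableau.
set B := (T + (size pre + Y)).+1; have HB : size pre + Y < B.+2 by rewrite /B; lia.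
split.
- case=> v; rewrite all_cat => /andP[/init_clausesP-/(_ HB) [H1 H2 H3 H4 H5] Hrun].
  (* The certificate consists of the cells before the first blank one. A cell may satisfy both of
     its bits, and is then read as [true]. *)
  pose blank_at i := v (vT B.+2 0 true (size pre + i) (None : option (bool + tm_G M))).
  pose len := find blank_at (iota 0 Y).
  have HlenY : len <= Y by rewrite -[Y in _ <= Y](size_iota 0 Y); apply: find_size.
  pose y := [seq v (vT B.+2 0 true (size pre + i) (bit M true)) | i <- iota 0 len].
  have Hy : size y = len by rewrite size_map size_iota.
  have Hbefore i : i < len -> blank_at i = false.
    move=> Hi; have := before_find 0 Hi; rewrite nth_iota //; lia.
  have Hafter i : len <= i -> size pre + i < B.+2 -> blank_at i.
    move=> Hi; case: (leqP Y i) => [Yi Hb|Yi _]; first by apply: H5; lia.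
    have Hl : blank_at len.
      have Hh : has blank_at (iota 0 Y) by rewrite has_find size_iota -/len; lia.
      by have := nth_find 0 Hh; rewrite nth_iota // -/len; lia.
    have -> : i = len + (i - len) by lia.
    have : len + (i - len) <= Y by lia.
    elim: (i - len) => [|k IH] Hk; first by rewrite addn0.
    have [_] := H4 (len + k) ltac:(lia); rewrite /blank_at addnS addnS; apply.
    by apply: IH; lia.
  exists y; rewrite Hy; split=> //.
  have [c' [[k [Hk [Hst Hn]]] <-]] := HM y ltac:(by rewrite Hy).
  apply: (tracks_accept Hrun (k := k) (t := 0)) Hst Hn => //; first by rewrite /B; lia.
  split=> // -[] j; rewrite addn0 => Hj; last first.
    by rewrite /= nth_nil; apply: H2; lia.
  rewrite /tp /tm_init /= nth_init_cells pair_encE -/pre size_cat Hy nth_cat.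
  case: (ltnP j (size pre)) => Hj1.
    by rewrite ifT; [apply: H3|lia].
  have Ej : j = size pre + (j - size pre) by lia.
  case: ltnP => Hj2; last by rewrite Ej; apply: Hafter; lia.
  rewrite (nth_map 0) ?size_iota ?nth_iota ?add0n; try lia.
  rewrite -Ej; have [] := H4 (j - size pre) ltac:(lia).
  rewrite -Ej => + _; have := Hbefore (j - size pre) ltac:(lia); rewrite /blank_at -Ej => ->.
  by rewrite orbF; case E: (v (vT B.+2 0 true j (bit M true))); rewrite ?E ?orbF.
- case=> y [Hy HV]; have [c' [[k [Hk [Hst Hn]]] Hacc]] := HM y Hy.
  have Ha : tm_acc (cq c') by apply/Hacc.
  pose c0 := tm_init M (pair_enc w y).
  exists (assignment B.+2 (fun t => iter t (@next M) c0)); rewrite all_cat; apply/andP; split.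
    have H0 j s : j < B.+2 -> assignment B.+2 (fun t => iter t (@next M) c0) (vT B.+2 0 true j s) =
        ((if j < size pre + size y then bit M (nth false (pre ++ y) j) else None) == s).
      by move=> Hj; rewrite assignment_T //= nth_init_cells pair_encE size_cat.
    apply/init_clausesP => //; split.
    + by rewrite assignment_S.
    + by move=> j Hj; rewrite assignment_T //= nth_nil.
    + by move=> j Hj; rewrite H0; [rewrite nth_cat Hj ifT ?eqxx //; lia|lia].
    + move=> i Hi; rewrite !H0; try lia.
      case: (ltnP (size pre + i) (size pre + size y)) => Hc.
        by split=> //; case: (nth _ _ _).
      by split; [rewrite eqxx !orbT|rewrite ifF // ; lia].
    + by move=> j Hj; rewrite H0; [rewrite ifF // ; lia|lia].
  apply: run_clauses_true => // t Ht Hnt.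
  (* Both sides are halted configurations of the same run, hence fixed by [next], and the earlier
     one equals the later one. *)
  suff -> : iter t (@next M) c0 = c' by [].
  have Hit : forall j c c1, tm_steps j c = Some c1 -> iter j (@next M) c = c1.
    elim=> [|j IH] c c1 /=; first by case.
    by case Es: (tm_step c) => [c2|] // /IH <-; rewrite -iterS iterSr /next Es.
  have Hfix : forall j, iter j (@next M) c' = c'.
    by elim=> //= j ->; rewrite /next Hn.
  case: (leqP k t) => Hkt.
    by rewrite -(subnKC Hkt) addnC iterD (Hit _ _ _ Hst).
  have Hfix2 : forall j, iter j (@next M) (iter t (@next M) c0) = iter t (@next M) c0.
    by elim=> //= j ->; rewrite /next Hnt.
  by rewrite -(Hit _ _ _ Hst) -(subnKC (ltnW Hkt)) addnC iterD Hfix2.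
Qed.

(** * Polynomial time of the reduction *)

(** Binary codes are obtained by counting up from zero, which is polynomial because the coordinates
    of the gadget are polynomial in value. *)
Fixpoint binc (l : seq bool) : seq bool :=
  match l with
  | [::] => [:: true]
  | false :: t => true :: t
  | true :: t => false :: binc t
  end.

Lemma nat_bitsS n : nat_bits n.+1 = binc (nat_bits n).
Proof.
rewrite /nat_bits Nnat.Nat2N.inj_succ; case: (N.of_nat n) => //= p.
by elim: p => //= p ->.
Qed.

Lemma nat_bits_iter n : nat_bits n = iter n binc [::].
Proof. by elim: n => // n IH; rewrite nat_bitsS IH. Qed.

(** Increment as a left fold over the pair of carry and reversed output, the shape that
    [PT_foldl_grow] accepts. *)
Definition binc_fold (l : seq bool) : bool * seq bool :=
  foldl (fun (s : bool * seq bool) b => (s.1 && b, (s.1 != b) :: s.2)) (true, [::]) l.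

Lemma binc_foldE l :
  binc l = rev (if (binc_fold l).1 then true :: (binc_fold l).2 else (binc_fold l).2).
Proof.
pose f (s : bool * seq bool) b := (s.1 && b, (s.1 != b) :: s.2).
have H0 t o : foldl f (false, o) t = (false, rev t ++ o).
  elim: t o => [|b t IH] o //=; rewrite IH rev_cons cat_rcons.
  by case: b.
have H1 t o : rev (if (foldl f (true, o) t).1 then true :: (foldl f (true, o) t).2
                   else (foldl f (true, o) t).2) = rev o ++ binc t.
  elim: t o => [|[|] t IH] o /=.
  - by rewrite rev_cons -cats1.
  - by rewrite IH rev_cons cat_rcons.
  - by rewrite H0 /= rev_cat revK rev_cons cat_rcons.
by rewrite -[LHS]cat0s -(H1 l [::]).
Qed.

Lemma PT_binc (A : encType) (l : A -> seq bool) : PT l -> PT (fun a => binc (l a)).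
Proof.
move=> Hl; have Hf : PT (fun a => binc_fold (l a)).
  apply: (PT_foldl_grow (z := fun _ => (true, [::]))
    (f := fun _ (s : bool * seq bool) b => (s.1 && b, (s.1 != b) :: s.2))) => //.
  - exact: PT_const.
  - by pt.
  - exists (PC 10) => a [c o] b; rewrite !sz_pair sz_cons /=.
    by have := sz_bool (c && b); have := sz_bool (c != b); lia.
apply: (PT_ext _ (fun a => binc_foldE (l a))).
by pt.
Qed.

Lemma PT_nat_bits (A : encType) (n : A -> nat) : PT n -> PT (fun a => nat_bits (n a)).
Proof.
move=> Hn; apply: (PT_ext _ (fun a => nat_bits_iter (n a))).
apply: (PT_iter (f := fun _ l => binc l) (z := fun _ => [::])) => //; first exact: PT_const.
  by apply: PT_binc; pt.
exists (PC 4) => a; elim=> [|b t IH] //.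
have Ht : sz true = 3 by []. have Hf : sz false = 1 by [].
by move: IH; case: b; rewrite /= !sz_cons ?Ht ?Hf; lia.
Qed.

Lemma PT_enc_nat (A : encType) (n : A -> nat) : PT n -> PT (fun a => enc_nat (n a)).
Proof. by move=> Hn; rewrite /enc_nat; pt; apply: PT_nat_bits; pt. Qed.

(** Entries carry the number of a piece because [piece] is not an encodable type. *)
Definition enc_entries (N : nat) (e : seq (nat * (nat * nat))) : seq bool :=
  enc_nat N ++ enc_nat (size e) ++
  flatten [seq enc_nat p.1 ++ enc_nat p.2.1 ++ enc_nat p.2.2 | p <- e].

Lemma enc_instanceE N ps :
  enc_instance N ps = enc_entries N [seq (piece_idx p.1, p.2) | p <- ps].
Proof. by rewrite /enc_instance /enc_entries size_map -map_comp. Qed.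

Lemma PT_enc_entries (A : encType) (N : A -> nat) (e : A -> seq (nat * (nat * nat))) :
  PT N -> PT e -> PT (fun a => enc_entries (N a) (e a)).
Proof. by move=> HN He; rewrite /enc_entries; pt; apply: PT_enc_nat; pt. Qed.

Definition clause0 : clause := ((true, 0), ((true, 0), ((true, 0), (true, 0)))).
Definition sign_of (cs : seq clause) (i j : nat) : bool := (lit_at (nth clause0 cs i) j).1.
Definition var_of (cs : seq clause) (i j : nat) : nat := (lit_at (nth clause0 cs i) j).2.

Definition var_sum (c : clause) : nat := c.1.2 + (c.2.1.2 + (c.2.2.1.2 + c.2.2.2.2)).
(** The sum of all variable numbers bounds each of them; variables absent from the formula only add
    bishops whose tracks bear no literal. *)
Definition nvars (cs : seq clause) : nat := (foldl (fun s c => s + var_sum c) 0 cs).+1.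

Lemma var_of_lt cs i j : i < size cs -> j < 4 -> var_of cs i j < nvars cs.
Proof.
move=> Hi Hj; have H1 : var_of cs i j <= var_sum (nth clause0 cs i).
  rewrite /var_of /lit_at /var_sum; case: j Hj => [|[|[|[|j]]]] //= _; lia.
have Hmono t s : s <= foldl (fun s c => s + var_sum c) s t.
  by elim: t s => //= c t IH s; apply: leq_trans (IH _); apply: leq_addr.
rewrite /nvars ltnS; apply: leq_trans H1 _.
elim: cs i 0 Hi {j Hj} => [|c cs IH] [|i] s //= Hi; last exact: IH.
by apply: leq_trans (Hmono _ _); apply: leq_addl.
Qed.

Definition chess_of (cs : seq clause) : seq bool :=
  enc_instance (2 * xK (nvars cs) (size cs))
    (gadget (nvars cs) (size cs) (sign_of cs) (var_of cs)).

Lemma chess_of_correct cs :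
  SolitaireChess (chess_of cs) <-> exists v, all (clause_true v) cs.
Proof.
rewrite /chess_of chess_correct; last exact: var_of_lt.
split=> -[v Hv]; exists v.
- apply/(all_nthP clause0) => i Hi; have [j j4 E] := Hv i Hi.
  move: E; rewrite /var_of /sign_of /clause_true /lit_true /lit_at.
  by case: j j4 => [|[|[|[|j]]]] //= _ ->; rewrite eqxx ?orbT.
- move=> i Hi; have := (all_nthP clause0 Hv) i Hi.
  rewrite /clause_true /lit_true => /or4P[] /eqP E.
  + by exists 0.
  + by exists 1.
  + by exists 2.
  + by exists 3.
Qed.

Lemma PT_nvars (A : encType) (cs : A -> seq clause) : PT cs -> PT (fun a => nvars (cs a)).
Proof.
move=> H; apply: PT_succ.
apply: (PT_foldl_grow (z := fun _ => 0) (f := fun _ s c => s + var_sum c)) => //.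
- exact: PT_const.
- by rewrite /var_sum; pt.
- exists (PAdd PX PX) => a s c; rewrite !sz_nat /var_sum /=.
  have [[[b1 v1] [[b2 v2] [[b3 v3] [b4 v4]]]] ->] : exists c', c = c' by exists c.
  by rewrite !sz_pair !sz_nat /=; lia.
Qed.

Ltac pt_ext ::=
  lazymatch goal with
  | |- PT (fun a => nvars (@?f a)) => apply: (PT_nvars (cs := f))
  | |- PT (fun a => enc_entries (@?f a) (@?g a)) => apply: (PT_enc_entries (N := f) (e := g))
  end.

Definition entry (cs : seq clause) (l : lab) : nat * (nat * nat) :=
  (piece_idx (piece_of l),
   (px (nvars cs) (size cs) (sign_of cs) (var_of cs) l,
    py (nvars cs) (size cs) (sign_of cs) (var_of cs) l)).

Lemma PT_yrow (A : encType) (cs : A -> seq clause) (i : A -> nat) j : PT cs -> PT i ->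
  PT (fun a => yrow (size (cs a)) (sign_of (cs a)) (var_of (cs a)) (i a) j).
Proof.
move=> Hcs Hi; rewrite /yrow /sign_of /var_of /qv /qh /xL /xcol /lit_at.
by case: (j == 0); [pt|case: (j == 1); [pt|case: (j == 2); pt]].
Qed.

Lemma PT_chess_of (A : encType) (cs : A -> seq clause) : PT cs -> PT (fun a => chess_of (cs a)).
Proof.
move=> H; apply: (PT_comp (g := chess_of) _ H) => {A cs H}.
(* Labels are not encodable; distributing [entry] over the fixed shapes of labels leaves functions
   of the indices only. *)
apply: (@PT_ext _ _ (fun cs => enc_entries (2 * xK (nvars cs) (size cs))
  (flatten [seq [seq entry cs l | l <- var_labs k] | k <- iota 0 (nvars cs)] ++
   flatten [seq [seq entry cs l | l <- clause_labs i] | i <- iota 0 (size cs)] ++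
   [seq entry cs l | l <- [:: LR; LC; LB; LZ]]))); last first.
  move=> cs; rewrite /chess_of enc_instanceE /gadget -map_comp /labs !map_cat !map_flatten.
  by rewrite -!map_comp.
rewrite /xK /qh /xL; pt.
- rewrite /= /entry /= /qv /qh /xL; pt.
- rewrite /= /entry /= /xK /qh /xL /xcol.
  by pt; apply: (PT_yrow (cs := fun p => p.1) (i := fun p => p.2)); pt.
- by rewrite /= /entry /= /xK /qv /qh /xL; pt.
Qed.

(** The list is fixed in advance, so its elements need no code; it serves for the states and symbols
    of the machine. *)
Lemma PT_const_map (K : Type) (A X : encType) (l : seq K) (f : K -> A -> X) :
  (forall k, PT (f k)) -> PT (fun a => [seq f k a | k <- l]).
Proof. by move=> H; elim: l => [|k l IH] /=; [exact: PT_const|apply: PT_cons]. Qed.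

Section Tableau_time.
Context (M : TM) (A : encType).

Lemma PT_vS (W t : A -> nat) (q : tm_Q M) : PT W -> PT t -> PT (fun a => vS (W a) (t a) q).
Proof. by move=> *; rewrite /vS; pt. Qed.

Lemma PT_vT (W t j : A -> nat) (side : A -> bool) (s : option (bool + tm_G M)) :
  PT W -> PT t -> PT j -> PT side -> PT (fun a => vT (W a) (t a) (side a) (j a) s).
Proof. by move=> *; rewrite /vT; pt. Qed.

End Tableau_time.

Ltac pt_ext ::=
  lazymatch goal with
  | |- PT (fun a => nvars (@?f a)) => apply: (PT_nvars (cs := f))
  | |- PT (fun a => enc_entries (@?f a) (@?g a)) => apply: (PT_enc_entries (N := f) (e := g))
  | |- PT (fun a => @vS ?M (@?w a) (@?t a) ?q) => apply: (PT_vS (W := w) (t := t) q)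
  | |- PT (fun a => @vT ?M (@?w a) (@?t a) (@?b a) (@?j a) ?s) =>
      apply: (PT_vT (W := w) (t := t) (j := j) (side := b) s)
  | |- PT (fun a => imp3 (@?f a) (@?g a) (@?h a) (@?k a)) => rewrite /imp3
  | |- PT (fun a => unit_clause (@?f a)) => rewrite /unit_clause
  | |- PT (fun a => or3_clause (@?f a) (@?g a) (@?h a)) => rewrite /or3_clause
  | |- PT (fun a => not_both (@?f a) (@?g a)) => rewrite /not_both
  | |- PT (fun a => ev ?P (@?f a)) => apply: (PT_ev P (n := f))
  end.

Lemma PT_step_clauses (M : TM) (A : encType) (W B t : A -> nat) (q : tm_Q M) s :
  PT W -> PT B -> PT t -> PT (fun a => step_clauses (W a) (B a) (t a) q s).
Proof.
move=> HW HB Ht; rewrite /step_clauses.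
case: (tm_delta q s) => [[[q' s'] d]|]; last by case: (tm_acc q); pt.
apply: PT_cat; first by pt.
apply: PT_flatten; apply: (PT_map (f := fun a j => flatten [seq [seq imp3 (vS (W a) (t a) q)
   (vT (W a) (t a) true 0 s) (vT (W a) (t a) e.1.1 e.1.2 x) (vT (W a) (t a).+1 e.2.1 e.2.2 x)
   | x <- enum {: option (bool + tm_G M)}] | e <- transfers d j])); first by pt.
rewrite /=; apply: PT_flatten.
apply: (PT_map (l := fun p : A * nat => transfers d p.2) (f := fun (p : A * nat) e => [seq imp3 (vS (W p.1) (t p.1) q)
   (vT (W p.1) (t p.1) true 0 s) (vT (W p.1) (t p.1) e.1.1 e.1.2 x) (vT (W p.1) (t p.1).+1 e.2.1 e.2.2 x)
   | x <- enum {: option (bool + tm_G M)}])).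
  by case: d; rewrite /transfers; pt.
by apply: PT_const_map => x; pt.
Qed.

Lemma PT_tableau (M : TM) (A : encType) (pre : A -> seq bool) (Y T : A -> nat) :
  PT pre -> PT Y -> PT T -> PT (fun a => tableau M (pre a) (Y a) (T a)).
Proof.
move=> Hp HY HT; rewrite /tableau /init_clauses /run_clauses; apply: PT_cat.
  by pt.
apply: PT_flatten; apply: (PT_map (f := fun a t => flatten [seq flatten [seq
   step_clauses (T a + (size (pre a) + Y a)).+3 (T a + (size (pre a) + Y a)).+1 t q s
   | s <- enum {: option (bool + tm_G M)}] | q <- enum (tm_Q M)])); first by pt.
apply: PT_flatten; apply: PT_const_map => q; apply: PT_flatten; apply: PT_const_map => s.
by apply: PT_step_clauses; pt.
Qed.

Fixpoint ppow (k : nat) : pexp := if k is k'.+1 then PMul PX (ppow k') else PC 1.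

Lemma ev_pow k n : ev (ppow k) n = n ^ k.
Proof. by elim: k => //= k ->; rewrite expnS. Qed.

Definition pbound (c k : nat) : pexp := PAdd (PMul (PC c) (ppow k)) (PC c).

Lemma ev_pbound c k n : ev (pbound c k) n = c * n ^ k + c.
Proof. by rewrite /= ev_pow. Qed.

Lemma chess_NP_hard : NP_hard SolitaireChess.
Proof.
move=> L [V [[M [c [k HM]]] [c' [k' HL]]]].
(* Bounds the length of [pair_enc w y]: each bit of [w] doubled, a separator of two bits, and the
   certificate. *)
pose P := PAdd (PMul (PC 2) PX) (PAdd (PC 2) (pbound c' k')).
pose f w := chess_of (tableau M (pair_prefix w) (ev (pbound c' k') (size w))
                        (ev (psubst (pbound c k) P) (size w))).
exists f; split.
  apply: PT_computable; rewrite /f.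
  apply: PT_chess_of; apply: PT_tableau; rewrite /pair_prefix; pt.
move=> w; rewrite /f chess_of_correct (@tableau_correct M V).
  by rewrite HL ev_pbound.
move=> y Hy; have [x [[j [Hj Hr]] Hacc]] := HM (pair_enc w y).
exists x; split=> //; exists j; split=> //; apply: leq_trans Hj _.
rewrite ev_subst -ev_pbound; apply: ev_mono; rewrite pair_encE size_cat.
have -> : size (pair_prefix w) = 2 * size w + 2.
  by rewrite /pair_prefix size_cat size_flatten /shape -map_comp; elim: (w) => //= b t IH; lia.
by rewrite /P -[ev _ _]/(2 * size w + (2 + ev (pbound c' k') (size w))); lia.
Qed.

(** * The verifier *)

Fixpoint bval (l : seq bool) : nat := if l is b :: l' then b + 2 * bval l' else 0.

(** The value of the first [i] bits, padded with zeros: the invariant of the bitwise loops of [blt]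
    and [badd]. *)
Fixpoint low_bits (l : seq bool) (i : nat) : nat :=
  if i is i'.+1 then low_bits l i' + nth false l i' * 2 ^ i' else 0.

Lemma low_bits_cons b l i : low_bits (b :: l) i.+1 = b + 2 * low_bits l i.
Proof.
elim: i => [|i IH]; first by rewrite /= expn0 muln1 addn0.
by rewrite -[LHS]/(low_bits (b :: l) i.+1 + nth false l i * 2 ^ i.+1) IH expnS /=; lia.
Qed.

Lemma low_bits_full l i : size l <= i -> low_bits l i = bval l.
Proof.
elim: l i => [|b l IH] i Hi.
  by elim: i {Hi} => //= i ->; rewrite nth_nil.
by case: i Hi => // i Hi; rewrite low_bits_cons IH.
Qed.

Lemma low_bits_lt l i : low_bits l i < 2 ^ i.
Proof. by elim: i => //= i IH; rewrite expnS; case: (nth false l i); lia. Qed.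

(** Bits are scanned upwards, so the last disagreement decides; the sum of the sizes is a position
    past both lists. *)
Definition blt (l1 l2 : seq bool) : bool :=
  foldl (fun r i => if nth false l1 i == nth false l2 i then r else nth false l2 i)
    false (iota 0 (size l1 + size l2)).

Lemma bltE l1 l2 : blt l1 l2 = (bval l1 < bval l2).
Proof.
have H n : foldl (fun r i => if nth false l1 i == nth false l2 i then r else nth false l2 i)
    false (iota 0 n) = (low_bits l1 n < low_bits l2 n).
  elim: n => // n IH; rewrite -addn1 iotaD foldl_cat IH /= add0n addn1 /=.
  have := low_bits_lt l1 n; have := low_bits_lt l2 n.
  case: (nth false l1 n); case: (nth false l2 n) => /=; lia.
by rewrite /blt H !low_bits_full // ?leq_addr ?leq_addl.
Qed.

Definition ble (l1 l2 : seq bool) : bool := ~~ blt l2 l1.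
Definition beq (l1 l2 : seq bool) : bool := ble l1 l2 && ble l2 l1.

Lemma bleE l1 l2 : ble l1 l2 = (bval l1 <= bval l2).
Proof. by rewrite /ble bltE -leqNgt. Qed.

Lemma beqE l1 l2 : beq l1 l2 = (bval l1 == bval l2).
Proof. by rewrite /beq !bleE eqn_leq. Qed.

Definition badd_step (l1 l2 : seq bool) (s : bool * seq bool) (i : nat) : bool * seq bool :=
  (if s.1 then nth false l1 i || nth false l2 i else nth false l1 i && nth false l2 i,
   (s.1 != (nth false l1 i != nth false l2 i)) :: s.2).

Definition badd (l1 l2 : seq bool) : seq bool :=
  rev (foldl (badd_step l1 l2) (false, [::]) (iota 0 (size l1 + size l2).+1)).2.

Lemma bval_rcons l b : bval (rcons l b) = bval l + b * 2 ^ size l.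
Proof. by elim: l => [|c l IH] /=; rewrite ?expn0 ?expnS ?IH; [lia|nia]. Qed.

Lemma baddE l1 l2 : bval (badd l1 l2) = bval l1 + bval l2.
Proof.
have H n : let s := foldl (badd_step l1 l2) (false, [::]) (iota 0 n) in
    size s.2 = n /\ bval (rev s.2) + s.1 * 2 ^ n = low_bits l1 n + low_bits l2 n.
  elim: n => // n [Hs IH]; rewrite -addn1 iotaD foldl_cat /= add0n addn1 /=.
  move: Hs IH; case: (foldl _ _ _) => c o /= Hs IH; split; first by rewrite Hs.
  rewrite rev_cons bval_rcons size_rev Hs expnS; move: IH.
  by case: c; case: (nth false l1 n); case: (nth false l2 n) => /=; lia.
have [_] := H (size l1 + size l2).+1; rewrite /badd.
(* The last position scanned lies past both lists, where no carry is produced. *)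
have -> : (foldl (badd_step l1 l2) (false, [::]) (iota 0 (size l1 + size l2).+1)).1 = false.
  rewrite -addn1 iotaD foldl_cat /= add0n; case: (foldl _ _ _) => c o /=.
  by rewrite !nth_default ?leq_addr ?leq_addl //; case: c.
by rewrite mul0n addn0 => ->; rewrite !low_bits_full //; lia.
Qed.

Definition bone : seq bool := [:: true].

(** The last bit is the leading one; the default [true] admits the empty list, the code of 0. These
    lists are exactly the values of [nat_bits]. *)
Definition canonical (l : seq bool) : bool := last true l.

Lemma bval_binc l : bval (binc l) = (bval l).+1.
Proof. by elim: l => [|[|] l IH] //=; rewrite ?IH; lia. Qed.

Lemma bval_nat_bits n : bval (nat_bits n) = n.
Proof. by elim: n => // n IH; rewrite nat_bitsS bval_binc IH. Qed.

Lemma canonical_nat_bits n : canonical (nat_bits n).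
Proof.
rewrite /nat_bits /canonical; case: (N.of_nat n) => //= p.
have H b : last b (pos_bits p) = true by elim: p b => //= p IH b.
exact: H.
Qed.

Lemma canonical_inj l1 l2 : canonical l1 -> canonical l2 -> bval l1 = bval l2 -> l1 = l2.
Proof.
have H0 (l : seq bool) (b : bool) : last b l -> bval l = 0 -> l = [::].
  elim: l b => [|c l IH] b //= Hl E; have El : l = [::] by apply: (IH c) => //; lia.
  by move: Hl E; rewrite El /=; case: c.
have Hc (b : bool) (l : seq bool) : canonical (b :: l) -> canonical l by rewrite /canonical; case: l.
elim: l1 l2 => [|b l1 IH] [|c l2] // C1 C2.
- by move=> E; rewrite (H0 _ _ C2 (esym E)).
- by move=> E; rewrite (H0 _ _ C1 E).
- move=> /= E; have Eb : b = c by move: E; case: b {C1}; case: c {C2} => /=; lia.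
  by rewrite Eb (IH l2) //; [apply: Hc C1|apply: Hc C2|move: E; rewrite Eb; lia].
Qed.

Lemma nat_bits_bval l : canonical l -> nat_bits (bval l) = l.
Proof. by move=> C; apply: canonical_inj; rewrite ?canonical_nat_bits ?bval_nat_bits. Qed.

(** * Chess with binary coordinates *)

Definition bsquare : Type := (seq bool * seq bool)%type.
Definition bpiece : Type := (nat * bsquare)%type.

Definition same_square (a b : bsquare) : bool := beq a.1 b.1 && beq a.2 b.2.
Definition on_row (a b : bsquare) : bool := beq a.2 b.2.
Definition on_col (a b : bsquare) : bool := beq a.1 b.1.
(** Equality of differences is tested on sums, which avoids signed numbers. *)
Definition on_diag (a b : bsquare) : bool := beq (badd a.1 b.2) (badd b.1 a.2).
Definition on_anti (a b : bsquare) : bool := beq (badd a.1 a.2) (badd b.1 b.2).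
Definition inside (a c b : seq bool) : bool := blt a c && blt c b || blt b c && blt c a.

(** Meant to be asked of each piece: the squares of a path may be exponentially many in the length
    of the input, the pieces are not. *)
Definition bbetween (a b c : bsquare) : bool :=
  [|| [&& on_row a b, on_row a c & inside a.1 c.1 b.1],
      [&& on_col a b, on_col a c & inside a.2 c.2 b.2],
      [&& on_diag a b, on_diag a c & inside a.1 c.1 b.1]
    | [&& on_anti a b, on_anti a c & inside a.1 c.1 b.1]].

Definition bclear (s : seq bpiece) (a b : bsquare) : bool :=
  ~~ has (fun e => bbetween a b e.2) s.

Definition near (a b : seq bool) : bool := ble a (badd b bone) && ble b (badd a bone).
Definition dist1 (a b : seq bool) : bool := beq (badd a bone) b || beq (badd b bone) a.
Definition dist2 (a b : seq bool) : bool :=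
  beq (badd a [:: false; true]) b || beq (badd b [:: false; true]) a.

(* Pieces are numbered as in [piece_idx]. *)
Definition bcapture (s : seq bpiece) (k : nat) (a b : bsquare) : bool :=
  if k == 0 then near a.1 b.1 && near a.2 b.2
  else if k == 1 then [|| on_row a b, on_col a b, on_diag a b | on_anti a b] && bclear s a b
  else if k == 2 then (on_row a b || on_col a b) && bclear s a b
  else if k == 3 then (on_diag a b || on_anti a b) && bclear s a b
  else if k == 4 then dist1 a.1 b.1 && dist2 a.2 b.2 || dist2 a.1 b.1 && dist1 a.2 b.2
  else dist1 a.1 b.1 && beq (badd a.2 bone) b.2.

Definition piece_no (k : nat) : piece :=
  if k == 0 then King else if k == 1 then Queen else if k == 2 then Rook
  else if k == 3 then Bishop else if k == 4 then Knight else Pawn.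

Definition sq_of (a : bsquare) : square := (Z.of_nat (bval a.1), Z.of_nat (bval a.2)).
Definition board_of (s : seq bpiece) : board := [seq (piece_no e.1, sq_of e.2) | e <- s].

Lemma same_squareP a b : reflect (sq_of a = sq_of b) (same_square a b).
Proof.
apply: (iffP andP); rewrite !beqE; first by case=> /eqP E1 /eqP E2; rewrite /sq_of E1 E2.
by case=> /Nat2Z.inj-> /Nat2Z.inj->.
Qed.

Lemma occupied_board s x : occupied (board_of s) x <-> exists2 e, List.In e s & x = sq_of e.2.
Proof.
split; first by case=> k /List.in_map_iff[e [[_ E] H]]; exists e.
by case=> e H ->; exists (piece_no e.1); apply/List.in_map_iff; exists e.
Qed.

Lemma bclearP s a b : [|| on_row a b, on_col a b, on_diag a b | on_anti a b] ->
  bclear s a b <-> clear_path (board_of s) (sq_of a) (sq_of b).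
Proof.
move=> Hl; rewrite /bclear; split.
- move=> Hn; rewrite /clear_path => t Ht /occupied_board[e He [Ex Ey]].
  have {}Hn : ~~ bbetween a b e.2.
    move: Hn; rewrite -all_predC; elim: (s) He => //= c s' IH [->|He] /andP[//] _; exact: IH.
  move: Hn Hl Ht Ex Ey.
  rewrite /bbetween /on_row /on_col /on_diag /on_anti /inside !beqE !bltE !baddE /sq_of; cbn [fst snd].
  move: (bval a.1) (bval a.2) (bval b.1) (bval b.2) (bval e.2.1) (bval e.2.2) => xa ya xb yb xe ye.
  move=> Hn Hl Ht.
  by case: (Z.sgn_spec (Z.of_nat xb - Z.of_nat xa)) => [[? ->]|[[? ->]|[? ->]]];
    case: (Z.sgn_spec (Z.of_nat yb - Z.of_nat ya)) => [[? ->]|[[? ->]|[? ->]]]; lia.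
- move=> Hc; rewrite -all_predC; have : forall e, List.In e s -> ~~ bbetween a b e.2.
    move=> e He; apply/negP => Hb.
    have Ho : occupied (board_of s) (sq_of e.2) by apply/occupied_board; exists e.
    move: Hb Hl Hc Ho; rewrite /clear_path.
    rewrite /bbetween /on_row /on_col /on_diag /on_anti /inside !beqE !bltE !baddE /sq_of; cbn [fst snd].
    move: (bval a.1) (bval a.2) (bval b.1) (bval b.2) (bval e.2.1) (bval e.2.2) => xa ya xb yb xe ye.
    move=> Hb Hl Hc Ho.
    (* The parameter of the square of [e] on the path is its distance from [a] in king moves. *)
    apply: (Hc (Z.max (Z.abs (Z.of_nat xe - Z.of_nat xa)) (Z.abs (Z.of_nat ye - Z.of_nat ya)))); first lia.
    move: Ho; congr (occupied _ (_, _)).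
      by case: (Z.sgn_spec (Z.of_nat xb - Z.of_nat xa)) => [[? ->]|[[? ->]|[? ->]]]; lia.
    by case: (Z.sgn_spec (Z.of_nat yb - Z.of_nat ya)) => [[? ->]|[[? ->]|[? ->]]]; lia.
  elim: (s) => //= e s' IH H; apply/andP; split; first by apply: H; left.
  by apply: IH => c Hc'; apply: H; right.
Qed.

Lemma bcaptureP s k a b : sq_of a <> sq_of b ->
  bcapture s k a b <-> can_capture (board_of s) (piece_no k) (sq_of a) (sq_of b).
Proof.
move=> Nab; rewrite /bcapture /piece_no.
have Hrow : on_row a b || on_col a b <-> rook_line (sq_of a) (sq_of b).
  rewrite /on_row /on_col /rook_line !beqE /sq_of; cbn [fst snd]; lia.
have Hdiag : on_diag a b || on_anti a b <-> bishop_line (sq_of a) (sq_of b).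
  rewrite /on_diag /on_anti /bishop_line !beqE !baddE /sq_of; cbn [fst snd]; lia.
have near1 x y : dist1 x y <-> Z.abs (Z.of_nat (bval y) - Z.of_nat (bval x)) = 1%Z.
  by rewrite /dist1 !beqE !baddE /=; lia.
have near2 x y : dist2 x y <-> Z.abs (Z.of_nat (bval y) - Z.of_nat (bval x)) = 2%Z.
  by rewrite /dist2 !beqE !baddE /=; lia.
have near0 x y : near x y <-> (Z.abs (Z.of_nat (bval y) - Z.of_nat (bval x)) <= 1)%Z.
  by rewrite /near !bleE !baddE /=; lia.
case: ifP => _; [|case: ifP => _; [|case: ifP => _; [|case: ifP => _; [|case: ifP => _]]]];
  rewrite /can_capture /sq_of; cbn [fst snd].
- by rewrite -!near0; split=> /andP.
- split.
    move=> /andP[Hl Hc]; split; last exact: (bclearP s Hl).1.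
    by move: Hl; rewrite orbA => /orP[/Hrow|/Hdiag]; [left|right].
  move=> [Hl Hc]; have {}Hl : [|| on_row a b, on_col a b, on_diag a b | on_anti a b].
    by rewrite orbA; case: Hl => [/Hrow->|/Hdiag->]; rewrite ?orbT.
  by rewrite Hl; apply/(bclearP s Hl).
- split.
    move=> /andP[Hl Hc]; split; first exact/Hrow.
    by apply: (bclearP s _).1 => //; rewrite orbA Hl.
  move=> [/Hrow Hl Hc]; rewrite Hl; apply/(bclearP s _) => //; by rewrite orbA Hl.
- split.
    move=> /andP[Hl Hc]; split; first exact/Hdiag.
    by apply: (bclearP s _).1 => //; rewrite orbA Hl orbT.
  move=> [/Hdiag Hl Hc]; rewrite Hl; apply/(bclearP s _) => //; by rewrite orbA Hl orbT.
- rewrite -!near1 -!near2; split=> [/orP[] /andP[] ? ?|[[-> ->]|[-> ->]]] //; rewrite ?orbT //;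
    by [left|right].
- have -> : (Z.of_nat (bval b.1) - Z.of_nat (bval a.1) = -1 \/
    Z.of_nat (bval b.1) - Z.of_nat (bval a.1) = 1)%Z <->
    Z.abs (Z.of_nat (bval b.1) - Z.of_nat (bval a.1)) = 1%Z by lia.
  rewrite -near1 beqE baddE /=; split; first by case/andP=> -> H; split=> //; lia.
  by case=> -> H; lia.
Qed.

(* A move [e] of the certificate: [e.1] captures [e.2]. *)
Definition bmove : Type := (bpiece * bpiece)%type.

Definition same_piece (e f : bpiece) : bool := (e.1 == f.1) && same_square e.2 f.2.

Definition legal (s : seq bpiece) (e : bmove) : bool :=
  [&& has (same_piece e.1) s, has (same_piece e.2) s,
      ~~ same_square e.1.2 e.2.2 & bcapture s e.1.1 e.1.2 e.2.2].

(** The capturing piece is put in front, so that [behead] gives the pieces not involved. *)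
Definition make (s : seq bpiece) (e : bmove) : seq bpiece :=
  (e.1.1, e.2.2) ::
  [seq f <- s | ~~ same_square e.1.2 f.2 && ~~ same_square e.2.2 f.2].

Definition replay (s : seq bpiece) (es : seq bmove) : bool * seq bpiece :=
  foldl (fun (st : bool * seq bpiece) e => (st.1 && legal st.2 e, make st.2 e)) (true, s) es.

Definition squares_uniq (s : seq bpiece) : Prop := List.NoDup [seq sq_of e.2 | e <- s].

Lemma filter_other_square s e : ~ List.In (sq_of e) [seq sq_of f.2 | f <- s] ->
  [seq f : bpiece <- s | ~~ same_square e f.2] = s.
Proof.
elim: s => //= f s IH H; case: same_squareP => [E|_] /=; first by case: H; left.
by rewrite IH // => H'; apply: H; right.
Qed.

Lemma perm_remove s (e : bpiece) : squares_uniq s -> has (same_piece e) s ->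
  exists2 f, Permutation s (f :: [seq g <- s | ~~ same_square e.2 g.2]) &
    f.1 = e.1 /\ sq_of f.2 = sq_of e.2.
Proof.
rewrite /squares_uniq; elim: s => //= f s IH /List.NoDup_cons_iff[Hf ND] /orP[|Hs].
  case/andP=> /eqP E1 /same_squareP E2; exists f; last by rewrite E1 E2.
  have -> : same_square e.2 f.2 by apply/same_squareP.
  by rewrite /= filter_other_square // E2.
have [g HP [E1 E2]] := IH ND Hs.
case: same_squareP => [E|_] /=.
  case: Hf; rewrite -E -E2; apply: (List.in_map (fun e : bpiece => sq_of e.2)).
  by apply: Permutation_in (Permutation_sym HP) _; left.
exists g => //; apply: Permutation_trans (perm_skip f HP) _; exact: perm_swap.
Qed.

Lemma perm_make s e : squares_uniq s -> has (same_piece e.1) s -> has (same_piece e.2) s ->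
  ~~ same_square e.1.2 e.2.2 ->
  Permutation (board_of s) ((piece_no e.1.1, sq_of e.1.2) :: (piece_no e.2.1, sq_of e.2.2) ::
    board_of (behead (make s e))).
Proof.
move=> U H1 H2 N; have [f1 P1 [E1 E2]] := perm_remove U H1.
set s1 := [seq g <- s | ~~ same_square e.1.2 g.2] in P1.
have U1 : squares_uniq s1.
  have := Permutation_NoDup (Permutation_map (fun e : bpiece => sq_of e.2) P1) U.
  by move/List.NoDup_cons_iff => [].
have H2' : has (same_piece e.2) s1.
  apply/hasP; case/hasP: H2 => g Hg Hsame; exists g => //.
  rewrite mem_filter Hg andbT; apply: contra N => /same_squareP E.
  by apply/same_squareP; rewrite E; case/andP: Hsame => _ /same_squareP ->.
have [f2 P2 [E3 E4]] := perm_remove U1 H2'.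
have HP : Permutation s (f1 :: f2 :: behead (make s e)).
  apply: Permutation_trans P1 _; apply: perm_skip; apply: Permutation_trans P2 _.
  apply: perm_skip; rewrite /s1 -filter_predI /=.
  have -> : [seq g <- s | predI (fun g : bpiece => ~~ same_square e.2.2 g.2)
     (fun g : bpiece => ~~ same_square e.1.2 g.2) g] =
    [seq f <- s | ~~ same_square e.1.2 f.2 && ~~ same_square e.2.2 f.2].
    by apply: eq_filter => g /=; rewrite andbC.
  exact: Permutation_refl.
have := Permutation_map (fun e : bpiece => (piece_no e.1, sq_of e.2)) HP.
by rewrite /= E1 E2 E3 E4.
Qed.

Lemma make_uniq s e : squares_uniq s -> squares_uniq (make s e).
Proof.
move=> U; apply/List.NoDup_cons_iff; split.
  move=> /List.in_map_iff[f [E]]; rewrite /= => /List.filter_In[_].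
  by case/andP=> _ /same_squareP; rewrite E.
elim: s U => [|f s IH]; first by move=> _; constructor.
move=> /List.NoDup_cons_iff[Hf ND] /=; case: ifP => _; last exact: IH.
apply/List.NoDup_cons_iff; split; last exact: IH.
move=> /List.in_map_iff[g [E /List.filter_In[Hg _]]]; apply: Hf.
by apply/List.in_map_iff; exists g.
Qed.

Lemma legal_move s e : squares_uniq s -> legal s e -> chess_move (board_of s) (board_of (make s e)).
Proof.
move=> U /and4P[H1 H2 N Hc].
have Nab : sq_of e.1.2 <> sq_of e.2.2 by move/same_squareP; apply/negP.
exists (piece_no e.1.1), (sq_of e.1.2), (piece_no e.2.1), (sq_of e.2.2), (board_of (behead (make s e))).
split=> //; split; first exact: perm_make.
by split=> //; apply/bcaptureP.
Qed.

Lemma replay_ok s es : (replay s es).1 -> squares_uniq s ->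
  clos_refl_trans board chess_move (board_of s) (board_of (replay s es).2).
Proof.
rewrite /replay; elim: es s => [|e es IH] s /= Hok U; first exact: rt_refl.
have Hfalse b t : (foldl (fun (st : bool * seq bpiece) e => (st.1 && legal st.2 e, make st.2 e)) (b, t) es).1 -> b.
  by elim: es b t {IH Hok} => //= a es IH b t /IH /andP[].
have Hl := Hfalse _ _ Hok; rewrite Hl in Hok *.
apply: (rt_trans _ _ _ (board_of (make s e))); first by apply: rt_step; apply: legal_move.
apply: IH; first exact: Hok.
exact: make_uniq.
Qed.

Definition small (K : nat) (e : bpiece) : Prop :=
  e.1 <= 5 /\ size e.2.1 <= K /\ size e.2.2 <= K.

Lemma can_capture_perm s s' k a b : Permutation s s' ->
  can_capture s k a b -> can_capture s' k a b.
Proof.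
move=> HP; have Ho x : occupied s' x -> occupied s x.
  by case=> q H; exists q; apply: Permutation_in (Permutation_sym HP) H.
have Hcl : clear_path s a b -> clear_path s' a b.
  by rewrite /clear_path => H t Ht /Ho; apply: H.
by case: k => //= -[H1 H2]; split=> //; apply: Hcl.
Qed.

(** Moves reuse the coordinate lists of the pieces, so [K] bounds them throughout, and each capture
    removes one piece, which gives the number of moves. Boards agree only up to permutation because
    [chess_move] reorders. *)
Lemma replay_complete K s s' bs : clos_refl_trans_1n board chess_move s s' ->
  List.length s' = 1 -> Permutation s (board_of bs) -> squares_uniq bs ->
  (forall e, List.In e bs -> small K e) ->
  exists es, [/\ (replay bs es).1, size (replay bs es).2 = 1, (size es).+1 = size bs &
     forall e, List.In e es -> small K e.1 /\ small K e.2].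
Proof.
move=> H; elim: H bs => {s s'} [s|s s1 s' M _ IH] bs Hlen HP U Hsm.
  exists [::]; split=> //.
  - by have := Permutation_length HP; rewrite Hlen /board_of => E; rewrite -(size_map (fun e : bpiece => (piece_no e.1, sq_of e.2)) bs).
  - by have := Permutation_length HP; rewrite Hlen /board_of => E; rewrite -(size_map (fun e : bpiece => (piece_no e.1, sq_of e.2)) bs).
case: M => k1 [a [k2 [b [rest [Nab [HP1 [Hc Es1]]]]]]].
have Hin1 : List.In (k1, a) (board_of bs).
  by apply: Permutation_in HP _; apply: Permutation_in (Permutation_sym HP1) _; left.
have Hin2 : List.In (k2, b) (board_of bs).
  by apply: Permutation_in HP _; apply: Permutation_in (Permutation_sym HP1) _; right; left.
have [e1 [[Ek1 Ea] He1]] := (List.in_map_iff _ _ _).1 Hin1.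
have [e2 [[Ek2 Eb] He2]] := (List.in_map_iff _ _ _).1 Hin2.
have has_in e : List.In e bs -> has (same_piece e) bs.
  elim: (bs) => //= f l IHl [<-|H]; last by rewrite IHl ?orbT.
  by rewrite /same_piece eqxx /=; apply/orP; left; apply/same_squareP.
have N : ~~ same_square e1.2 e2.2.
  by apply/same_squareP; rewrite Ea Eb.
have Hleg : legal bs (e1, e2).
  apply/and4P; split; [exact: has_in|exact: has_in|exact: N|].
  apply/bcaptureP; first by rewrite Ea Eb.
  by rewrite Ea Eb Ek1; apply: can_capture_perm Hc.
have HP2 := perm_make U (has_in _ He1) (has_in _ He2) N (e := (e1, e2)).
rewrite /= in HP2; rewrite Ek1 Ea Ek2 Eb in HP2.
have HP3 : Permutation rest (board_of (behead (make bs (e1, e2)))).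
  apply: (Permutation_cons_inv (a := (k2, b))); apply: (Permutation_cons_inv (a := (k1, a))).
  exact: Permutation_trans (Permutation_sym HP1) (Permutation_trans HP HP2).
have HP4 : Permutation s1 (board_of (make bs (e1, e2))).
  by rewrite Es1 /make /= Ek1 Eb; apply: perm_skip.
have Hsm' e : List.In e (make bs (e1, e2)) -> small K e.
  case=> [<-|/List.filter_In[He _]]; last exact: Hsm.
  by have [H1 _] := Hsm _ He1; have [_ H2] := Hsm _ He2.
have [es [R1 R2 R3 R4]] := IH _ Hlen HP4 (make_uniq _ U) Hsm'.
exists ((e1, e2) :: es); split.
- by move: R1; rewrite /replay /= Hleg.
- by move: R2; rewrite /replay /= Hleg.
- have /= := Permutation_length HP2.
  rewrite /= R3 /board_of; have HL T (l : seq T) : List.length l = size l by [].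
  by rewrite !HL !size_map => ->.
- by move=> e [<-|/R4] //; split; apply: Hsm.
Qed.

(** * Decoding certificates *)

(** Read from right to left, the preorder code is a postfix expression, evaluated on a stack of
    trees. Malformed words yield some tree as well. *)
Definition unser_step (s : seq tree) (b : bool) : seq tree :=
  if b then (if s is x :: s' then (if s' is y :: r then Nd x y :: r else s) else s) else Lf :: s.

Definition unser (l : seq bool) : tree := head Lf (foldl unser_step [::] (rev l)).

Lemma unserK t : unser (ser t) = t.
Proof.
rewrite /unser; have H s : foldl unser_step s (rev (ser t)) = t :: s.
  elim: t s => [|a IHa b IHb] s //.
  by rewrite /= rev_cons rev_cat -cats1 !foldl_cat IHb IHa.
by rewrite H.
Qed.

Fixpoint lst (t : tree) : seq tree := if t is Nd a b then a :: lst b else [::].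

Lemma enc_lst t : enc (lst t) = t.
Proof. by elim: t => //= a _ b IH; congr Nd. Qed.

Lemma lst_enc (A : encType) (l : seq A) : lst (enc l) = map enc l.
Proof. by elim: l => //= x l <-. Qed.

Definition tfst (t : tree) : tree := head Lf (lst t).
Definition tsnd (t : tree) : tree := enc (behead (lst t)).

Lemma tsnd_Nd a b : tsnd (Nd a b) = b.
Proof. exact: enc_lst. Qed.

(** The decoders are total and have to be right on codes only, since the verifier recomputes the
    instance from what it has decoded. *)
Definition dec_nat (t : tree) : nat := size (lst t).
Definition dec_bits (t : tree) : seq bool := [seq 0 < size (lst u) | u <- lst t].
Definition dec_piece (t : tree) : bpiece :=
  (dec_nat (tfst t), (dec_bits (tfst (tsnd t)), dec_bits (tsnd (tsnd t)))).
Definition dec_move (t : tree) : bmove := (dec_piece (tfst t), dec_piece (tsnd t)).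

Definition certificate : Type := (seq bool * (seq bpiece * seq bmove))%type.

Definition dec_cert (t : tree) : certificate :=
  (dec_bits (tfst t), ([seq dec_piece u | u <- lst (tfst (tsnd t))],
     [seq dec_move u | u <- lst (tsnd (tsnd t))])).

Lemma dec_natK n : dec_nat (enc n) = n.
Proof. by elim: n => // n IH; rewrite -[in RHS]IH. Qed.

Lemma dec_bitsK (l : seq bool) : dec_bits (enc l) = l.
Proof. by rewrite /dec_bits lst_enc -map_comp map_id_in // => -[]. Qed.

Lemma dec_pieceK (e : bpiece) : dec_piece (enc e) = e.
Proof. by case: e => k [x y]; rewrite /dec_piece /= !tsnd_Nd /= dec_natK !dec_bitsK. Qed.

Lemma dec_moveK (e : bmove) : dec_move (enc e) = e.
Proof.
case: e => p q; rewrite /dec_move -[enc _]/(Nd (enc p) (enc q)) tsnd_Nd.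
by rewrite -[tfst _]/(enc p) !dec_pieceK.
Qed.

Lemma dec_certK (c : certificate) : dec_cert (enc c) = c.
Proof.
case: c => nb [bs es]; rewrite /dec_cert -[enc _]/(Nd (enc nb) (Nd (enc bs) (enc es))) !tsnd_Nd.
rewrite -!/(tfst (Nd _ _)) -[tfst (Nd (enc nb) _)]/(enc nb) -[tfst (Nd _ _)]/(enc bs).
rewrite dec_bitsK !lst_enc -!map_comp !map_id_in // => e _; [exact: dec_moveK|exact: dec_pieceK].
Qed.

Definition enc_bits (l : seq bool) : seq bool := flatten [seq [:: true; b] | b <- l] ++ [:: false].

Definition enc_piece (e : bpiece) : seq bool := enc_nat e.1 ++ enc_bits e.2.1 ++ enc_bits e.2.2.

Definition enc_code (nb : seq bool) (bs : seq bpiece) : seq bool :=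
  enc_bits nb ++ enc_nat (size bs) ++
  flatten [seq enc_piece e | e <- bs].

(** * Soundness and completeness of the verifier *)

Definition good_piece (nb : seq bool) (e : bpiece) : bool :=
  [&& e.1 <= 5, canonical e.2.1, canonical e.2.2, blt e.2.1 nb & blt e.2.2 nb].

Definition good (c : certificate) : bool :=
  [&& canonical c.1, 0 < size c.1, all (fun e => good_piece c.1 e) c.2.1,
      all (fun e => size [seq f <- c.2.1 | same_square e.2 f.2] <= 1) c.2.1,
      (replay c.2.1 c.2.2).1 & size (replay c.2.1 c.2.2).2 == 1].

(* The certificate is a suffix of [z]; the verifier tries all of them. *)
Definition verifier (z : seq bool) : bool :=
  has (fun i => let c := dec_cert (unser (drop i z)) in
    (z == pair_enc (enc_code c.1 c.2.1) (drop i z)) && good c) (iota 0 (size z)).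

(** Makes it sound to try every suffix: one that passes the test has decoded the actual instance. *)
Lemma pair_enc_inj w w' y y' : pair_enc w y = pair_enc w' y' -> w = w' /\ y = y'.
Proof.
rewrite /pair_enc; elim: w w' => [|b w IH] [|b' w'] //=; try by [case|case: b|case: b'].
by case=> <- _ /IH[-> ->].
Qed.

Lemma enc_natE n : enc_nat n = enc_bits (nat_bits n).
Proof. by []. Qed.

Lemma uniq_squares (bs : seq bpiece) :
  all (fun e => size [seq f <- bs | same_square e.2 f.2] <= 1) bs <-> squares_uniq bs.
Proof.
have Hs (e : bpiece) : same_square e.2 e.2 by apply/same_squareP.
rewrite /squares_uniq; elim: bs => [|e bs IH]; first by split=> // _; constructor.
rewrite [all _ _]/= Hs /=; split.
- case/andP; rewrite ltnS leqn0 => /nilP E Ha; constructor; last first.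
    apply/IH; apply/allP => f Hf; have := allP Ha _ Hf.
    by case: ifP => _ //= /ltnW.
  move=> /List.in_map_iff[f [Ef Hf]].
  have : List.In f [seq f <- bs | same_square e.2 f.2].
    by apply/List.filter_In; split=> //; apply/same_squareP.
  by rewrite E.
- move=> /List.NoDup_cons_iff[He /IH Ha]; apply/andP; split.
    rewrite ltnS leqn0; apply/nilP.
    suff : forall f, ~ List.In f [seq f <- bs | same_square e.2 f.2].
      by case: filter => // f l /(_ f) []; left.
    move=> f /List.filter_In[Hf /same_squareP Ef]; apply: He.
    by apply/List.in_map_iff; exists f.
  apply/allP => f Hf; case: same_squareP => [Ef|_]; last exact: (allP Ha _ Hf).
  case: He; apply/List.in_map_iff; exists f; split=> //.
  by elim: (bs) Hf => //= g l IHl; rewrite inE => /orP[/eqP->|/IHl]; [left|right].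
Qed.

Lemma verifier_sound w y : verifier (pair_enc w y) -> SolitaireChess w.
Proof.
case/hasP=> i _; cbv zeta; move: (drop i _) => y'; move: (dec_cert _) => [nb [bs es]] /andP[/eqP E].
rewrite /good; cbn [fst snd] in E; cbn [fst snd].
have [-> _] := pair_enc_inj E; case/and5P => Cn Sn Hg /uniq_squares U /andP[H1 /eqP H2].
pose ps := [seq (piece_no e.1, (bval e.2.1, bval e.2.2)) | e <- bs].
exists (bval nb), ps; split; [|split].
- rewrite /enc_instance /enc_code /ps size_map (enc_natE (bval _)) nat_bits_bval // -map_comp.
  congr (_ ++ (_ ++ flatten _)); apply/eq_in_map => e He /=.
  have /and5P[K C1 C2 _ _] := allP Hg _ He.
  rewrite (enc_natE (bval e.2.1)) (enc_natE (bval e.2.2)) !nat_bits_bval //; congr (enc_nat _ ++ _).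
  by case: e.1 K => [|[|[|[|[|[|]]]]]].
- split; [|split].
  + rewrite lt0n; apply/negP => /eqP E0.
    suff: nb = [::] by move=> E'; rewrite E' in Sn.
    by apply: canonical_inj.
  + move=> k x z /List.in_map_iff[e [[_ <- <-] He]].
    have He' : e \in bs.
      by elim: (bs) He => //= g l IHl [->|/IHl]; rewrite inE ?eqxx // => ->; rewrite orbT.
    by have /and5P[_ _ _] := allP Hg _ He'; rewrite !bltE.
  + move: U; rewrite /squares_uniq => U.
    apply: (List.NoDup_map_inv (fun p : nat * nat => (Z.of_nat p.1, Z.of_nat p.2) : square)).
    rewrite [List.map _ _](_ : _ = [seq sq_of e.2 | e <- bs]) //.
    by rewrite /ps; elim: (bs) => //= e l ->.
- have -> : to_board ps = board_of bs by rewrite /to_board /ps /board_of -map_comp.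
  by exists (board_of (replay bs es).2); split;
    [exact: replay_ok | rewrite /board_of -[List.length _]/(size _) size_map].
Qed.

Lemma sz_seq_le (A : encType) (l : seq A) K : (forall x, List.In x l -> sz x <= K) ->
  sz l <= size l * K.+1 + 1.
Proof.
elim: l => [|x l IH] H //; rewrite sz_cons /= mulSn.
by have := H x (or_introl erefl); have := IH (fun y Hy => H y (or_intror Hy)); lia.
Qed.

Lemma sz_small K (e : bpiece) : small K e -> sz e <= 8 * K + 15.
Proof.
case: e => k [x y] /= [/= H1 [H2 H3]]; rewrite !sz_pair /= sz_nat.
by have := sz_bits x; have := sz_bits y; lia.
Qed.

Lemma size_enc_bits l : size (enc_bits l) = 2 * size l + 1.
Proof. by rewrite /enc_bits size_cat; elim: l => //= b l IH; lia. Qed.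

Lemma size_enc_piece (e : bpiece) : size e.2.1 + size e.2.2 < size (enc_piece e).
Proof.
rewrite (size_cat (enc_nat _)) (size_cat (enc_bits _)) !size_enc_bits; lia.
Qed.

Lemma size_enc_code nb bs : size nb <= size (enc_code nb bs) /\ size bs <= size (enc_code nb bs).
Proof.
rewrite (size_cat (enc_bits _)) (size_cat (enc_nat _)) size_enc_bits; split; first lia.
suff: size bs <= size (flatten [seq enc_piece e | e <- bs]) by move: (size (enc_nat _)); lia.
elim: bs => //= e l IH; rewrite (size_cat (enc_piece _)); have := size_enc_piece e; lia.
Qed.

Lemma size_enc_code_piece nb bs (e : bpiece) : List.In e bs ->
  size e.2.1 <= size (enc_code nb bs) /\ size e.2.2 <= size (enc_code nb bs).
Proof.
move=> He; rewrite (size_cat (enc_bits _)) (size_cat (enc_nat _)); have := size_enc_piece e.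
suff: size (enc_piece e) <= size (flatten [seq enc_piece e | e <- bs]).
  by move: (size (enc_nat _)) (size (enc_bits _)); lia.
elim: bs He => //= f l IH; rewrite (size_cat (enc_piece _)).
case=> [->|/IH]; lia.
Qed.

Lemma verifier_complete w : SolitaireChess w ->
  exists y, size y <= 100 * size w ^ 2 + 100 /\ verifier (pair_enc w y).
Proof.
case=> N [ps [-> [[N0 [Hin ND]] [s' [Hs Hlen]]]]]; set w' := enc_instance N ps.
pose bs : seq bpiece := [seq (piece_idx p.1, (nat_bits p.2.1, nat_bits p.2.2)) | p <- ps].
have Eno k : piece_no (piece_idx k) = k by case: k.
have Eb : to_board ps = board_of bs.
  rewrite /to_board /bs /board_of -map_comp; apply: eq_map => p /=.
  by rewrite Eno /sq_of /= !bval_nat_bits.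
have U : squares_uniq bs.
  rewrite /squares_uniq.
  have -> : [seq sq_of e.2 | e <- bs] =
      List.map (fun p : nat * nat => (Z.of_nat p.1, Z.of_nat p.2)) (List.map snd ps).
    by rewrite /bs; elim: (ps) => //= p l ->; rewrite /sq_of /= !bval_nat_bits.
  apply: NoDup_map_inj ND.
  by move=> [x1 y1] [x2 y2] _ _ [/Nat2Z.inj-> /Nat2Z.inj->].
have Ew : w' = enc_code (nat_bits N) bs.
  by rewrite /w' /enc_instance /enc_code size_map -map_comp.
have [HN Hsize] := size_enc_code (nat_bits N) bs; rewrite -Ew in HN Hsize.
have Hsmall e : List.In e bs -> small (size w') e.
  move=> He; split; first by have /List.in_map_iff[p [<- _]] := He; case: p.1.
  by rewrite Ew; apply: size_enc_code_piece.
have Hs1 := (clos_rt_rt1n_iff _ _ _ _).1 Hs; rewrite Eb in Hs1.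
have [es [R1 R2 R3 R4]] := replay_complete Hs1 Hlen (Permutation_refl _) U Hsmall.
pose c : certificate := (nat_bits N, (bs, es)).
exists (ser (enc c)); split.
  (* With [n] the length of the instance, the parts add up to at most [24 * n ^ 2 + 52 * n + 5],
     well below the claimed bound. *)
  have -> : size (ser (enc c)) = (sz (nat_bits N) + (sz bs + sz es).+1).+1.
    by rewrite -[size _]/(sz c) !sz_pair.
  have B1 := sz_bits (nat_bits N); have B2 := sz_seq_le (fun e He => sz_small (Hsmall e He)).
  have B3 : sz es <= size es * (2 * (8 * size w' + 15)).+2 + 1.
    apply: sz_seq_le => e /R4[S1 S2]; rewrite sz_pair.
    by have := sz_small S1; have := sz_small S2; move: (sz e.1) (sz e.2) (size w'); lia.
  move: B1 B2 B3 R3 Hsize HN; rewrite -/w' expnS expn1.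
  move: (size w') (size bs) (size es) (size (nat_bits N)) (sz es) (sz bs) (sz (nat_bits N)).
  clear; move=> n a b m y x z B1 B2 B3 R3 Ha Hm.
  have Ea := leq_mul Ha (leqnn (8 * n + 16)).
  have Eb : b <= n by lia.
  have {}Eb := leq_mul Eb (leqnn (16 * n + 32)).
  have En : n <= n * n by case: (n) => // k; apply: leq_pmulr.
  rewrite (mulnDr n) in Ea; rewrite (mulnDr n) in Eb; rewrite (mulnCA n 8) in Ea; rewrite (mulnCA n 16) in Eb.
  move: (n * n) Ea Eb En => q Ea Eb En.
  rewrite (_ : (8 * n + 15).+1 = 8 * n + 16) in B2; last lia.
  rewrite (_ : (2 * (8 * n + 15)).+2 = 16 * n + 32) in B3; last lia.
  move: (a * (8 * n + 16)) (b * (16 * n + 32)) Ea Eb B2 B3 => u v Ea Eb B2 B3.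
  move: B1 B2 B3 Ea Eb En Hm; clear; lia.
apply/hasP; exists (size (pair_prefix w')).
  rewrite mem_iota add0n pair_encE size_cat leq0n -[X in X < _]addn0 ltn_add2l.
  exact: sz_gt0 c.
have -> : drop (size (pair_prefix w')) (pair_enc w' (ser (enc c))) = ser (enc c).
  by rewrite pair_encE drop_size_cat.
rewrite unserK dec_certK; cbv zeta; rewrite -[c.1]/(nat_bits N) -[c.2.1]/bs -Ew eqxx andTb.
rewrite /good -[c.1]/(nat_bits N) -[c.2.1]/bs -[c.2.2]/es R1 R2 eqxx !andbT canonical_nat_bits andTb.
apply/and3P; split.
- by case: N N0 {Hin w' Ew Hsize Hsmall HN R4 c} => // n _; rewrite nat_bitsS; case: nat_bits => [|[]].
- rewrite all_map; elim: (ps) Hin => //= -[k [i j]] l IHl H; rewrite IHl; last first.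
    by move=> k' i' j' Hl; apply: (H k'); right.
  have [Hi Hj] := H _ _ _ (or_introl erefl).
  rewrite /good_piece /= !canonical_nat_bits !bltE !bval_nat_bits Hi Hj.
  by case: (k).
- exact/uniq_squares.
Qed.

(** * Polynomial time of the verifier *)

Lemma PT_eq_bits (A : encType) (l1 l2 : A -> seq bool) :
  PT l1 -> PT l2 -> PT (fun a => l1 a == l2 a).
Proof.
move=> H1 H2; apply: (@PT_ext _ _ (fun a => (size (l1 a) == size (l2 a)) &&
    all (fun i => nth false (l1 a) i == nth false (l2 a) i) (iota 0 (size (l1 a))))); first by pt.
move=> a; apply/eqP/andP => [->|[/eqP Es /allP E]].
  by rewrite eqxx; split=> //; apply/allP.
by apply: (@eq_from_nth _ false) => // i Hi; apply/eqP/E; rewrite mem_iota.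
Qed.

Lemma PT_drop (A X : encType) (i : A -> nat) (l : A -> seq X) :
  PT i -> PT l -> PT (fun a => drop (i a) (l a)).
Proof.
move=> Hi Hl; apply: (@PT_ext _ _ (fun a => iter (i a) behead (l a))); last first.
  by move=> a; elim: (i a) (l a) => [|n IH] [|x t] //; rewrite iterSr //= -IH.
apply: (PT_iter (f := fun _ c => behead c)) => //; first by pt.
by exists (PC 0) => a [|x c]; rewrite /= ?sz_cons addn0 //; lia.
Qed.

Lemma PT_blt (A : encType) (l1 l2 : A -> seq bool) :
  PT l1 -> PT l2 -> PT (fun a => blt (l1 a) (l2 a)).
Proof.
move=> H1 H2; apply: (PT_foldl_grow (z := fun _ => false)
  (f := fun a r i => if nth false (l1 a) i == nth false (l2 a) i then r else nth false (l2 a) i)).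
- by pt.
- by pt.
- by pt.
- by exists (PC 3) => a c i /=; case: ifP => _; [lia|have := sz_bool (nth false (l2 a) i); lia].
Qed.

Lemma PT_badd (A : encType) (l1 l2 : A -> seq bool) :
  PT l1 -> PT l2 -> PT (fun a => badd (l1 a) (l2 a)).
Proof.
move=> H1 H2; rewrite /badd; pt.
apply: (PT_foldl_grow (z := fun _ => (false, [::])) (f := fun a => badd_step (l1 a) (l2 a))).
- by pt.
- by pt.
- by rewrite /badd_step; pt.
- exists (PC 10) => a [c o] i; rewrite /badd_step /= !sz_pair sz_cons /=.
  set b := (if _ then _ else _); set d := (_ != _).
  by have := sz_bool b; have := sz_bool d; have := @sz_gt0 _ c; lia.
Qed.

Ltac pt_ext ::=
  lazymatch goal with
  | |- PT (fun a => @eq_op _ (@?f a) (@?g a)) => apply: (PT_eq_bits (l1 := f) (l2 := g))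
  | |- PT (fun a => drop (@?f a) (@?g a)) => apply: (PT_drop (i := f) (l := g))
  | |- PT (fun a => blt (@?f a) (@?g a)) => apply: (PT_blt (l1 := f) (l2 := g))
  | |- PT (fun a => badd (@?f a) (@?g a)) => apply: (PT_badd (l1 := f) (l2 := g))
  end.

Lemma PT_beq (A : encType) (l1 l2 : A -> seq bool) :
  PT l1 -> PT l2 -> PT (fun a => beq (l1 a) (l2 a)).
Proof. by move=> H1 H2; rewrite /beq /ble; pt. Qed.

Lemma PT_canonical (A : encType) (l : A -> seq bool) : PT l -> PT (fun a => canonical (l a)).
Proof.
move=> Hl; apply: (@PT_ext _ _ (fun a => head true (rev (l a)))); first by pt.
by move=> a; rewrite /canonical; case/lastP: (l a) => // t b; rewrite last_rcons rev_rcons.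
Qed.

Lemma PT_same_square (A : encType) (x y : A -> bsquare) :
  PT x -> PT y -> PT (fun a => same_square (x a) (y a)).
Proof. by move=> Hx Hy; rewrite /same_square; pt; apply: PT_beq; pt. Qed.

Lemma PT_bbetween (A : encType) (x y c : A -> bsquare) :
  PT x -> PT y -> PT c -> PT (fun a => bbetween (x a) (y a) (c a)).
Proof.
move=> Hx Hy Hc; rewrite /bbetween /on_row /on_col /on_diag /on_anti /inside.
by pt; apply: PT_beq; pt.
Qed.

Lemma PT_bclear (A : encType) (s : A -> seq bpiece) (x y : A -> bsquare) :
  PT s -> PT x -> PT y -> PT (fun a => bclear (s a) (x a) (y a)).
Proof. by move=> Hs Hx Hy; rewrite /bclear; pt; apply: PT_bbetween; pt. Qed.

Lemma PT_bcapture (A : encType) (s : A -> seq bpiece) (k : A -> nat) (x y : A -> bsquare) :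
  PT s -> PT k -> PT x -> PT y -> PT (fun a => bcapture (s a) (k a) (x a) (y a)).
Proof.
move=> Hs Hk Hx Hy; rewrite /bcapture /near /dist1 /dist2 /ble /on_row /on_col /on_diag /on_anti.
by pt; (apply: PT_bclear || apply: PT_beq); pt.
Qed.

Lemma PT_legal (A : encType) (s : A -> seq bpiece) (e : A -> bmove) :
  PT s -> PT e -> PT (fun a => legal (s a) (e a)).
Proof.
move=> Hs He; rewrite /legal /same_piece.
by pt; (apply: PT_bcapture || apply: PT_same_square); pt.
Qed.

Lemma PT_make (A : encType) (s : A -> seq bpiece) (e : A -> bmove) :
  PT s -> PT e -> PT (fun a => make (s a) (e a)).
Proof. by move=> Hs He; rewrite /make; pt; apply: PT_same_square; pt. Qed.

Lemma sz_filter (A : encType) (p : A -> bool) (l : seq A) : sz [seq x <- l | p x] <= sz l.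
Proof. by elim: l => //= x l IH; case: ifP => _; rewrite !sz_cons; lia. Qed.

(** [make] adds one piece built from the move and otherwise only deletes, so a round adds at most
    the size of the move and a constant. *)
Lemma PT_replay (A : encType) (s : A -> seq bpiece) (es : A -> seq bmove) :
  PT s -> PT es -> PT (fun a => replay (s a) (es a)).
Proof.
move=> Hs He; apply: (PT_foldl_grow (z := fun a => (true, s a))
  (f := fun _ (st : bool * seq bpiece) e => (st.1 && legal st.2 e, make st.2 e))).
- by pt.
- by pt.
- by pt; [apply: PT_legal; pt|apply: PT_make; pt].
- exists (PAdd PX (PC 10)) => a [c t] [[k1 [x1 y1]] [k2 [x2 y2]]].
  rewrite /make !sz_pair /= sz_cons !sz_pair /=.
  set b := _ && _; set l := [seq _ <- t | _].
  have H1 := sz_bool b; have H2 : sz l <= sz t by apply: sz_filter.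
  lia.
Qed.

Lemma PT_Nd (A : encType) (f g : A -> tree) : PT f -> PT g -> PT (fun a => Nd (f a) (g a)).
Proof. by move=> Hf Hg; apply: PT_enc (PT_pair Hf Hg) _. Qed.

Lemma PT_lst (A : encType) (t : A -> tree) : PT t -> PT (fun a => lst (t a)).
Proof. by move=> Ht; apply: PT_enc Ht _ => a; apply: enc_lst. Qed.

Lemma PT_unser (A : encType) (l : A -> seq bool) : PT l -> PT (fun a => unser (l a)).
Proof.
move=> Hl; rewrite /unser; pt.
apply: (PT_foldl_grow (z := fun _ => [::]) (f := fun _ => unser_step)).
- by pt.
- by pt.
(* The nested match is replaced by a test on the length and by heads, which [pt] can handle. *)
- apply: (@PT_ext _ _ (fun p : A * (seq tree * bool) =>
    if p.2.2 then (if 2 <= size p.2.1 then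
      Nd (head Lf p.2.1) (head Lf (behead p.2.1)) :: behead (behead p.2.1) else p.2.1)
    else Lf :: p.2.1)); first by pt; apply: PT_Nd; pt.
  by case=> a [[|x [|y s]] b].
- exists (PC 10) => a s b; rewrite /unser_step /=; case: b; last first.
    by rewrite sz_cons -[sz Lf]/1; lia.
  case: s => [|x [|y s]]; rewrite ?sz_cons; try lia.
  by rewrite {1}/sz /= size_cat -!/(sz _) /sz /=; lia.
Qed.

Lemma PT_tfst (A : encType) (t : A -> tree) : PT t -> PT (fun a => tfst (t a)).
Proof. by move=> Ht; rewrite /tfst; pt; apply: PT_lst. Qed.

Lemma PT_tsnd (A : encType) (t : A -> tree) : PT t -> PT (fun a => tsnd (t a)).
Proof.
move=> Ht; apply: (PT_enc (f := fun a => behead (lst (t a)))) => //.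
by pt; apply: PT_lst.
Qed.

Lemma PT_dec_nat (A : encType) (t : A -> tree) : PT t -> PT (fun a => dec_nat (t a)).
Proof. by move=> Ht; rewrite /dec_nat; pt; apply: PT_lst. Qed.

Lemma PT_dec_bits (A : encType) (t : A -> tree) : PT t -> PT (fun a => dec_bits (t a)).
Proof. by move=> Ht; rewrite /dec_bits; pt; apply: PT_lst; pt. Qed.

Ltac pt_ext ::=
  lazymatch goal with
  | |- PT (fun a => tfst (@?f a)) => apply: (PT_tfst (t := f))
  | |- PT (fun a => tsnd (@?f a)) => apply: (PT_tsnd (t := f))
  | |- PT (fun a => lst (@?f a)) => apply: (PT_lst (t := f))
  | |- PT (fun a => dec_nat (@?f a)) => apply: (PT_dec_nat (t := f))
  | |- PT (fun a => dec_bits (@?f a)) => apply: (PT_dec_bits (t := f))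
  end.

Lemma PT_dec_cert (A : encType) (t : A -> tree) : PT t -> PT (fun a => dec_cert (t a)).
Proof. by move=> Ht; rewrite /dec_cert /dec_move /dec_piece; pt. Qed.

Lemma PT_enc_code (A : encType) (nb : A -> seq bool) (bs : A -> seq bpiece) :
  PT nb -> PT bs -> PT (fun a => enc_code (nb a) (bs a)).
Proof.
move=> Hn Hb; rewrite /enc_code /enc_piece /enc_bits.
by pt; apply: PT_enc_nat; pt.
Qed.

Ltac pt_ext ::=
  lazymatch goal with
  | |- PT (fun a => @eq_op _ (@?f a) (@?g a)) => apply: (PT_eq_bits (l1 := f) (l2 := g))
  | |- PT (fun a => drop (@?f a) (@?g a)) => apply: (PT_drop (i := f) (l := g))
  | |- PT (fun a => blt (@?f a) (@?g a)) => apply: (PT_blt (l1 := f) (l2 := g))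
  | |- PT (fun a => same_square (@?f a) (@?g a)) => apply: (PT_same_square (x := f) (y := g))
  | |- PT (fun a => canonical (@?f a)) => apply: (PT_canonical (l := f))
  | |- PT (fun a => replay (@?f a) (@?g a)) => apply: (PT_replay (s := f) (es := g))
  | |- PT (fun a => unser (@?f a)) => apply: (PT_unser (l := f))
  | |- PT (fun a => dec_cert (@?f a)) => apply: (PT_dec_cert (t := f))
  | |- PT (fun a => enc_code (@?f a) (@?g a)) => apply: (PT_enc_code (nb := f) (bs := g))
  end.

Lemma PT_good (A : encType) (c : A -> certificate) : PT c -> PT (fun a => good (c a)).
Proof. by move=> Hc; rewrite /good /good_piece; pt. Qed.

Lemma PT_verifier : PT verifier.
Proof.
have H : PT (fun p : seq bool * nat => dec_cert (unser (drop p.2 p.1))) by pt.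
by rewrite /verifier /pair_enc; pt; apply: PT_good; pt.
Qed.

Lemma chess_in_NP : in_NP SolitaireChess.
Proof.
exists (fun z => verifier z = true); split; first exact: PT_decidable PT_verifier.
exists 100, 2 => w; split; first exact: verifier_complete.
by case=> y [_ /verifier_sound].
Qed.

Theorem theorem1 : NP_complete SolitaireChess.
Proof. exact: conj chess_in_NP chess_NP_hard. Qed.
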